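(* Let $s_1\ge s_2\ge1$ be coprime integers, let $\dot x=P,\ \dot y=Q$ be a real polynomial $(s_1,s_2)$-quasi-homogeneous system of weight degree $m$ with a center at the origin, and let $\omega_\epsilon=\omega_0+\sum_{i\ge1}\epsilon^i\omega_i$ with $\omega_0=Q\,dx-P\,dy$, $\omega_i=Q_i\,dx-P_i\,dy$, where $P_i,Q_i$ are real polynomials of degree at most $n$. In generalized polar coordinates (followed by the rescaling of $r$ described in the context) the foliation $\omega_\epsilon=0$ takes the form $$dr+\sum_{i=1}^\infty\epsilon^i\tilde\omega_i=0,\qquad \tilde\omega_i=\sum_{j\in\mathcal S_{1}}r^j\big(g_{i,j}(\theta)\,dr-r f_{i,j}(\theta)\,d\theta\big),$$ and its Melnikov functions are determined as follows. (i) If $M_1(h)\not\equiv0$, then $M_1(h)=\sum_{j\in\mathcal S_1}h^{j+1}m_{1,j}$ with $m_{1,j}=\int_0^\tau f_{1,j}(\theta)\,d\theta$. (ii) If $M_1(h)=\dots=M_k(h)\equiv0$ $(k\ge1)$, then there exist functions $a_0(r,\theta)\equiv1$, $a_1(r,\theta,\theta_1)$, $a_2(r,\theta,\{\theta_1,\theta_2\})$, $\dots$, $a_k(r,\theta,\{\theta_n\}_{n=1}^k)$, $\tau$-periodic in the variables $\theta,\theta_1,\dots,\theta_k$, such that: (ii.a) $\Omega_l=\sum_{j=1}^la_{l-j}\tilde\omega_j$ $(l=2,\dots,k+1)$ has the form $$\Omega_l=\sum_{j\in\mathcal S_l}r^j\big(A_{l,j}(\theta,\{\theta_n\}_{n=1}^{l-1})\,dr-rB_{l,j}(\theta,\{\theta_n\}_{n=1}^{l-1})\,d\theta\big),$$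 where $A_{l,j},B_{l,j}$ are $\tau$-periodic in $\theta,\theta_1,\dots,\theta_{l-1}$; (ii.b) $a_1$ has the form $$a_1(r,\theta,\theta_1)=-\sum_{j\in\mathcal S_1}r^jb_{1,j}(\theta,\theta_1)=-\sum_{j\in\mathcal S_1}r^j\Big(g_{1,j}(\theta)+(j+1)\int_{\theta_1}^\theta f_{1,j}(s)\,ds\Big),$$ and for $2\le i\le k$ $$a_i(r,\theta,\{\theta_n\}_{n=1}^i)=-\sum_{j\in\mathcal S_i}r^jb_{i,j}(\theta,\{\theta_n\}_{n=1}^i)=-\sum_{j\in\mathcal S_i}r^j\Big(A_{i,j}(\theta,\{\theta_n\}_{n=1}^{i-1})+(j+1)\int_{\theta_i}^\theta B_{i,j}(s,\{\theta_n\}_{n=1}^{i-1})\,ds\Big).$$ Furthermore, $$M_{k+1}(h)=\sum_{j\in\mathcal S_{k+1}}h^{j+1}m_{k+1,j},\qquad m_{k+1,j}=\int_0^\tau B_{k+1,j}(\theta,\{\theta_n\}_{n=1}^k)\,d\theta.$$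
   Context: Quasi-homogeneity: $P(\lambda^{s_1}x,\lambda^{s_2}y)=\lambda^{s_1+m-1}P(x,y)$, $Q(\lambda^{s_1}x,\lambda^{s_2}y)=\lambda^{s_2+m-1}Q(x,y)$ for $\lambda>0$. Put $W=s_1+s_2+m-1$. Index sets: for $t\ge1$, $\mathcal S_t=\mathcal S^{(s_1,s_2,m)}_{n+1,t}=\{is_1+js_2-lW: i,j,l\in\mathbb N,\ l\le i+j\le l(n+1),\ 1\le l\le t\}$, with $\mathbb N=\{0,1,\dots\}$. Lyapunov functions: $(Cs(\theta),Sn(\theta))$ is the solution of $\dot z=-w^{2s_1-1},\ \dot w=z^{2s_2-1}$ with $z(0)=s_1^{-1/(2s_2)}$, $w(0)=0$; they are periodic with common period $\tau$ and satisfy $s_1Cs^{2s_2}+s_2Sn^{2s_1}=1$. Generalized polar coordinates: $x=r^{s_1}Cs(\theta)$, $y=r^{s_2}Sn(\theta)$, $r>0$. Decompose $\omega_i=\sum_J\omega_{i,J}$ with $\omega_{i,J}=Q_{i,J}dx-P_{i,J}dy$, where $Q_{i,J}$ (resp. $P_{i,J}$) is the $(s_1,s_2)$-quasi-homogeneous part of $Q_i$ (resp. $P_i$) of weight degree $J-s_1$ (resp. $J-s_2$). Define $$F=Cs^{2s_2-1}P(Cs,Sn)+Sn^{2s_1-1}Q(Cs,Sn),\quad G=s_1Cs\,Q(Cs,Sn)-s_2Sn\,P(Cs,Sn),$$ $$F_{i,J}=Cs^{2s_2-1}P_{i,J}(Cs,Sn)+Sn^{2s_1-1}Q_{i,J}(Cs,Sn),\quad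 G_{i,J}=s_1Cs\,Q_{i,J}(Cs,Sn)-s_2Sn\,P_{i,J}(Cs,Sn)$$ as functions of $\theta$. Since the origin is a center, $G(\theta)\ne0$ for all $\theta$ and $\int_0^\tau F/G\,d\theta=0$. Let $H(\theta)=\exp\int_0^\theta\frac{F(s)}{G(s)}ds$ ($\tau$-periodic), and $$f_{i,j}=H^j\,\frac{F_{i,j+W}\,G-G_{i,j+W}\,F}{G^2},\qquad g_{i,j}=H^j\,\frac{G_{i,j+W}}{G}.$$ The rescaling is $(r,\theta)\mapsto(rH(\theta),\theta)$, i.e. the generalized polar radius is replaced by $rH(\theta)$ with $r$ the new radius; the form is also divided by a nowhere zero function. The unperturbed closed orbits are $\{r=h\}$, $h>0$. Melnikov functions: the Poincaré map of $dr+\sum\epsilon^i\tilde\omega_i=0$ from $\theta=0$ to $\theta=\tau$, starting at $r=h>0$, is $\mathcal P(h,\epsilon)=h+\epsilon M_1(h)+\epsilon^2M_2(h)+\cdots$; $M_k$ is considered when $M_1\equiv\dots\equiv M_{k-1}\equiv0$. *)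

(* Defs.v *)
From Stdlib Require Import Reals ZArith Arith List Lia.
From Coquelicot Require Import Coquelicot.
Import ListNotations.
Open Scope R_scope.

(* A real polynomial of degree at most [n] is given by a table [c] of
   coefficients, of which only the entries with [a + b <= n] are used. *)
Definition eval2 (n : nat) (c : nat -> nat -> R) (x y : R) : R :=
  sum_f_R0 (fun a => sum_f_R0 (fun b => c a b * x ^ a * y ^ b) (n - a)) n.

(* The weight [k] is an integer: the weights [J - s1], [J - s2] may be
   negative, and then the part is zero. *)
Definition qh_part (s1 s2 : nat) (k : Z) (c : nat -> nat -> R) : nat -> nat -> R :=
  fun a b => if Z.eq_dec (Z.of_nat (a * s1 + b * s2)) k then c a b else 0.

Definition quasi_homogeneous (s1 s2 m : nat) (P Q : R -> R -> R) : Prop :=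
  forall lam x y, 0 < lam ->
    P (lam ^ s1 * x) (lam ^ s2 * y) = lam ^ (s1 + m - 1) * P x y /\
    Q (lam ^ s1 * x) (lam ^ s2 * y) = lam ^ (s2 + m - 1) * Q x y.

Definition is_solution (P Q : R -> R -> R) (x y : R -> R) : Prop :=
  forall t, is_derive x t (P (x t) (y t)) /\ is_derive y t (Q (x t) (y t)).

(* The origin is a singular point having a punctured neighbourhood filled
   with (nonconstant) periodic orbits. *)
Definition is_center (P Q : R -> R -> R) : Prop :=
  P 0 0 = 0 /\ Q 0 0 = 0 /\
  exists delta, 0 < delta /\
    forall x0 y0, 0 < x0 ^ 2 + y0 ^ 2 < delta ^ 2 ->
      exists (x y : R -> R) (T : R),
        is_solution P Q x y /\ x 0 = x0 /\ y 0 = y0 /\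
        0 < T /\ (forall t, x (t + T) = x t /\ y (t + T) = y t) /\
        (exists t, x t <> x0 \/ y t <> y0).

Definition is_lyapunov (s1 s2 : nat) (Cs Sn : R -> R) : Prop :=
  is_solution (fun _ w => - w ^ (2 * s1 - 1)) (fun z _ => z ^ (2 * s2 - 1)) Cs Sn /\
  Cs 0 = Rpower (INR s1) (- / (2 * INR s2)) /\ Sn 0 = 0.

Definition is_least_period (Cs Sn : R -> R) (tau : R) : Prop :=
  let per T := forall th, Cs (th + T) = Cs th /\ Sn (th + T) = Sn th in
  0 < tau /\ per tau /\ forall T, 0 < T < tau -> ~ per T.

Definition polF (s1 s2 : nat) (Cs Sn : R -> R) (P Q : R -> R -> R) (th : R) : R :=
  Cs th ^ (2 * s2 - 1) * P (Cs th) (Sn th) + Sn th ^ (2 * s1 - 1) * Q (Cs th) (Sn th).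

Definition polG (s1 s2 : nat) (Cs Sn : R -> R) (P Q : R -> R -> R) (th : R) : R :=
  INR s1 * Cs th * Q (Cs th) (Sn th) - INR s2 * Sn th * P (Cs th) (Sn th).

Definition weightW (s1 s2 m : nat) : Z := (Z.of_nat s1 + Z.of_nat s2 + Z.of_nat m - 1)%Z.

(* Enumeration without repetition: [k] stands for [i + j]. *)
Definition Sset (s1 s2 m n t : nat) : list Z :=
  nodup Z.eq_dec
    (flat_map (fun l =>
       flat_map (fun k =>
         map (fun i => (Z.of_nat (i * s1 + (k - i) * s2) - Z.of_nat l * weightW s1 s2 m)%Z)
             (seq 0 (S k)))
         (seq l (l * n + 1)))
       (seq 1 t)).

Lemma Sset_spec (s1 s2 m n t : nat) (z : Z) :
  In z (Sset s1 s2 m n t) <->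
  exists i j l : nat,
    (l <= i + j <= l * (n + 1))%nat /\ (1 <= l <= t)%nat /\
    z = (Z.of_nat i * Z.of_nat s1 + Z.of_nat j * Z.of_nat s2
         - Z.of_nat l * weightW s1 s2 m)%Z.
Proof.
unfold Sset; rewrite nodup_In, in_flat_map; split.
- intros [l [Hl H]]; apply in_flat_map in H; destruct H as [k [Hk H]].
  apply in_map_iff in H; destruct H as [i [Hz Hi]].
  apply in_seq in Hl; apply in_seq in Hk; apply in_seq in Hi.
  exists i, (k - i)%nat, l.
  rewrite <- Hz, Nat2Z.inj_add, !Nat2Z.inj_mul; repeat split; nia.
- intros [i [j [l [H1 [H2 H3]]]]].
  exists l; split; [apply in_seq; lia|].
  apply in_flat_map; exists (i + j)%nat; split; [apply in_seq; nia|].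
  apply in_map_iff; exists i; split; [|apply in_seq; lia].
  replace (i + j - i)%nat with j by lia.
  rewrite H3, Nat2Z.inj_add, !Nat2Z.inj_mul; reflexivity.
Qed.

Lemma Sset_NoDup (s1 s2 m n t : nat) : NoDup (Sset s1 s2 m n t).
Proof. apply NoDup_nodup. Qed.

Definition sumZ (S : list Z) (u : Z -> R) : R := fold_right Rplus 0 (map u S).

(* The form [cdr dr + cdth dth] on the half-plane [r > 0]. *)
Record form1 := Form { cdr : R -> R -> R; cdth : R -> R -> R }.

Definition form_eq (w w' : form1) : Prop :=
  forall r th, 0 < r -> cdr w r th = cdr w' r th /\ cdth w r th = cdth w' r th.

Definition form_scal (K : R -> R -> R) (w : form1) : form1 :=
  Form (fun r th => K r th * cdr w r th) (fun r th => K r th * cdth w r th).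

(* Pull-back of [Q dx - P dy] by [(r, th) |-> (X r th, Y r th)]. *)
Definition pullback (X Y P Q : R -> R -> R) : form1 :=
  Form
    (fun r th => Q (X r th) (Y r th) * Derive (fun r' => X r' th) r
                 - P (X r th) (Y r th) * Derive (fun r' => Y r' th) r)
    (fun r th => Q (X r th) (Y r th) * Derive (fun th' => X r th') th
                 - P (X r th) (Y r th) * Derive (fun th' => Y r th') th).

Definition sform (S : list Z) (A B : Z -> R -> R) : form1 :=
  Form (fun r th => sumZ S (fun j => powerRZ r j * A j th))
       (fun r th => sumZ S (fun j => powerRZ r j * (- (r * B j th)))).

Definition perturbed (P0 : R -> R -> R) (Pi : nat -> R -> R -> R) (eps x y : R) : R :=
  P0 x y + Series (fun i => eps ^ S i * Pi (S i) x y).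

Definition form_family (w : nat -> form1) (eps : R) : form1 :=
  Form (perturbed (fun _ _ => 1) (fun i => cdr (w i)) eps)
       (perturbed (fun _ _ => 0) (fun i => cdth (w i)) eps).

Definition Omega (a : nat -> R -> R -> R) (w : nat -> form1) (l : nat) : form1 :=
  Form (fun r th => sum_n_m (fun j => a (l - j)%nat r th * cdr (w j) r th) 1 l)
       (fun r th => sum_n_m (fun j => a (l - j)%nat r th * cdth (w j) r th) 1 l).

(* [r = r(th)], [0 <= th <= tau], is a leaf of [w = 0] going from [r = h] to
   [r = p]. *)
Definition is_poincare (tau : R) (w : form1) (h p : R) : Prop :=
  exists r : R -> R,
    r 0 = h /\ r tau = p /\
    forall th, 0 <= th <= tau ->
      0 < r th /\ ex_derive r th /\
      cdr w (r th) th * Derive r th + cdth w (r th) th = 0.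

(* [M k], [k >= 1], are the coefficients of the expansion
   [h + eps M_1(h) + eps^2 M_2(h) + ...] of the Poincaré map; [M 0] is not used. *)
Definition is_melnikov (tau : R) (w : nat -> form1) (M : nat -> R -> R) : Prop :=
  forall h, 0 < h ->
    exists eps0, 0 < eps0 /\
      forall eps, Rabs eps < eps0 ->
        exists p, is_poincare tau (form_family w eps) h p /\
          is_pseries (fun k => match k with O => h | S _ => M k h end) eps p.

(* Functions of [theta_1, ..., theta_l] are functions of a sequence
   [ths : nat -> R], [theta_i] being [ths i], which depend only on these
   entries ([ths 0] is not used). *)
Definition depends_on_first (l : nat) (u : (nat -> R) -> R) : Prop :=
  forall ths ths' : nat -> R,
    (forall i, (1 <= i <= l)%nat -> ths i = ths' i) -> u ths = u ths'.

Definition set_param (ths : nat -> R) (i : nat) (x : R) : nat -> R :=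
  fun n => if Nat.eq_dec n i then x else ths n.

Definition periodic_fun (tau : R) (l : nat) (u : R -> (nat -> R) -> R) : Prop :=
  (forall th, depends_on_first l (u th)) /\
  (forall th ths, u (th + tau) ths = u th ths) /\
  (forall th ths i, (1 <= i <= l)%nat -> u th (set_param ths i (ths i + tau)) = u th ths).

(* Main.v *)
Require Import Defs.
From Stdlib Require Import Reals ZArith Arith List Lia Lra.
From Coquelicot Require Import Coquelicot.
Open Scope R_scope.

(* In generalized polar coordinates the unperturbed system becomes
   [rho' = rho^m F(theta)], [theta' = rho^(m-1) G(theta)].  A zero of [G] would
   give an invariant ray, on which no orbit is periodic, and comparing the
   radius before and after one turn of a periodic orbit gives
   [int_0^tau F / G = 0]; hence the rescaling by [H] is periodic, and expanding
   each form in quasi-homogeneous parts puts the foliation in the form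
   [dr + sum_i eps^i w_i = 0].

   The [a_i] are chosen so that [a_l dr + Omega_l] is the exact form [d S_l],
   [S_l = - sum_j r^(j+1) int_(theta_l)^theta B_(l,j)], for [1 <= l <= k].
   Multiplying the equation of a leaf by [sum_(i <= k) eps^i a_i] shows that
   [r + sum_(l <= k) eps^l S_l + eps^(k+1) int Omega_(k+1)] varies by
   [O(eps^(k+2))] along it.  When [M_1], ..., [M_k] vanish, so do the integrals
   of the [B_(l,j)] over a period, because distinct powers of [h] are linearly
   independent; then the [S_l] are periodic, their increment is [O(p - h)], and
   the coefficient of [eps^(k+1)] in [p] can be read off. *)

(** * Calculus and finite sums *)

(** Two points shape the proof. First, a leaf is only known to be a positive differentiable curve
    over [0, tau], with nothing assumed on its dependence on eps, so it cannot be expanded in eps.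
    Bounds on the coefficients of w_i that are geometric in i and uniform in theta give it a slope
    of order eps, a continuation argument keeps r within h/2 of h, and all remainders are estimated
    on that interval, for eps > 0. Second, the formula for M_(k+1) uses the means of the B_(l,j) of
    order at most k, and the means of order k+1 are known to vanish only through that formula; hence
    an induction on the order. The parameter theta_l is the free lower limit of the l-th primitive.
    The estimates hold for any fixed values of the parameters, which is why M_(k+1) does not depend
    on them. For the center, each use of uniqueness of solutions is one application of
    [gronwall_zero] to a squared distance. *)

Lemma continuous_Rplus (f g : R -> R) (x : R) :
  continuous f x -> continuous g x -> continuous (fun t => f t + g t) x.
Proof. exact (fun hf hg => continuous_plus f g x hf hg). Qed.

Lemma continuous_Rmult (f g : R -> R) (x : R) :
  continuous f x -> continuous g x -> continuous (fun t => f t * g t) x.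
Proof. exact (fun hf hg => continuous_mult f g x hf hg). Qed.

Lemma continuous_Ropp (f : R -> R) (x : R) :
  continuous f x -> continuous (fun t => - f t) x.
Proof. exact (fun hf => continuous_opp f x hf). Qed.

Lemma continuous_Rpow (f : R -> R) (n : nat) (x : R) :
  continuous f x -> continuous (fun t => f t ^ n) x.
Proof.
intros hf; induction n as [|n IH]; simpl.
- apply continuous_const.
- now apply continuous_Rmult.
Qed.

Lemma continuous_Rdiv (f g : R -> R) (x : R) :
  continuous f x -> continuous g x -> g x <> 0 -> continuous (fun t => f t / g t) x.
Proof.
intros hf hg hx; apply continuous_Rmult; [exact hf|].
apply (continuous_comp g Rinv); [exact hg|].
apply continuous_Rinv; exact hx.
Qed.

Lemma derivable_continuous_at (f : R -> R) (x l : R) :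
  is_derive f x l -> continuous f x.
Proof. intros h; apply (ex_derive_continuous f); now exists l. Qed.

Lemma is_derive_value (f : R -> R) (x l l' : R) :
  is_derive f x l -> l = l' -> is_derive f x l'.
Proof. now intros h <-. Qed.

Lemma is_derive_Rplus (f g : R -> R) (x f' g' : R) :
  is_derive f x f' -> is_derive g x g' -> is_derive (fun t => f t + g t) x (f' + g').
Proof. exact (is_derive_plus f g x f' g'). Qed.

Lemma is_derive_Rminus (f g : R -> R) (x f' g' : R) :
  is_derive f x f' -> is_derive g x g' -> is_derive (fun t => f t - g t) x (f' - g').
Proof. exact (is_derive_minus f g x f' g'). Qed.

Lemma is_derive_Ropp (f : R -> R) (x f' : R) :
  is_derive f x f' -> is_derive (fun t => - f t) x (- f').
Proof. exact (is_derive_opp f x f'). Qed.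

Lemma is_derive_Rmult (f g : R -> R) (x f' g' : R) :
  is_derive f x f' -> is_derive g x g' ->
  is_derive (fun t => f t * g t) x (f' * g x + f x * g').
Proof. intros hf hg; exact (is_derive_mult f g x f' g' hf hg Rmult_comm). Qed.

Lemma is_derive_Rscal (f : R -> R) (c x f' : R) :
  is_derive f x f' -> is_derive (fun t => c * f t) x (c * f').
Proof. exact (is_derive_scal f x c f'). Qed.

Lemma is_derive_Rcomp (f g : R -> R) (x f' g' : R) :
  is_derive f (g x) f' -> is_derive g x g' -> is_derive (fun t => f (g t)) x (g' * f').
Proof. exact (is_derive_comp f g x f' g'). Qed.

Lemma is_derive_Rpow (f : R -> R) (n : nat) (x f' : R) :
  is_derive f x f' -> is_derive (fun t => f t ^ n) x (INR n * f' * f x ^ (n - 1)).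
Proof. intros hf; rewrite Nat.sub_1_r; exact (is_derive_pow f n x f' hf). Qed.

Lemma bounded_on_segment (f : R -> R) (a b : R) :
  (forall x, a <= x <= b -> continuous f x) ->
  exists C, 0 < C /\ forall x, a <= x <= b -> Rabs (f x) <= C.
Proof.
intros hf; destruct (Rle_dec a b) as [hab|hab].
- destruct (continuity_ab_maj (fun x => Rabs (f x)) a b hab) as [M [hM _]].
  + intros c hc; apply continuity_pt_filterlim.
    apply (continuous_comp f Rabs); [now apply hf|apply continuous_Rabs].
  + exists (Rabs (f M) + 1); split; [pose proof (Rabs_pos (f M)); lra|].
    intros x hx; specialize (hM x hx); simpl in hM; lra.
- exists 1; split; [lra|]; intros x hx; lra.
Qed.

Lemma ex_RInt_everywhere (f : R -> R) (a b : R) :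
  (forall x, continuous f x) -> ex_RInt f a b.
Proof. intros hf; apply (ex_RInt_continuous f); intros; apply hf. Qed.

Lemma is_derive_primitive (f : R -> R) (a x : R) :
  (forall x, continuous f x) -> is_derive (fun t => RInt f a t) x (f x).
Proof.
intros hf; apply (is_derive_RInt f (fun t => RInt f a t) a x); [|apply hf].
exists (mkposreal 1 Rlt_0_1); intros y _; apply (RInt_correct f).
now apply ex_RInt_everywhere.
Qed.

Lemma RInt_Chasles_everywhere (f : R -> R) (a b c : R) :
  (forall x, continuous f x) -> RInt f a b + RInt f b c = RInt f a c.
Proof. intros hf; apply (RInt_Chasles f); now apply ex_RInt_everywhere. Qed.

Lemma RInt_periodic_shift (f : R -> R) (tau a b : R) :
  (forall x, continuous f x) -> (forall x, f (x + tau) = f x) ->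
  RInt f (a + tau) (b + tau) = RInt f a b.
Proof.
intros hf hper.
pose proof (RInt_comp_lin f 1 tau a b) as h.
rewrite !Rmult_1_l in h; rewrite <- h by now apply ex_RInt_everywhere.
apply RInt_ext; intros x _; change (1 * f (1 * x + tau) = f x); now rewrite !Rmult_1_l.
Qed.

Lemma RInt_over_period (f : R -> R) (tau a : R) :
  (forall x, continuous f x) -> (forall x, f (x + tau) = f x) ->
  RInt f a (a + tau) = RInt f 0 tau.
Proof.
intros hf hper.
pose proof (RInt_Chasles_everywhere f 0 a (a + tau) hf) as h1.
pose proof (RInt_Chasles_everywhere f 0 (0 + tau) (a + tau) hf) as h2.
rewrite RInt_periodic_shift in h2 by assumption.
rewrite Rplus_0_l in h2; lra.
Qed.

Lemma MVT_derive (f df : R -> R) (a b : R) :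
  a <= b -> (forall x, a <= x <= b -> is_derive f x (df x)) ->
  exists c, a <= c <= b /\ f b - f a = df c * (b - a).
Proof.
intros hab hf.
destruct (MVT_gen f a b df) as [c [hc e]].
- intros x hx; apply hf; rewrite Rmin_left, Rmax_right in hx by assumption; lra.
- intros x hx; apply continuity_pt_filterlim, (derivable_continuous_at f x (df x)), hf.
  now rewrite Rmin_left, Rmax_right in hx.
- rewrite Rmin_left, Rmax_right in hc by assumption; now exists c.
Qed.

Lemma derive_bound_increment (f df : R -> R) (a b C : R) :
  a <= b -> (forall x, a <= x <= b -> is_derive f x (df x) /\ Rabs (df x) <= C) ->
  Rabs (f b - f a) <= C * (b - a).
Proof.
intros hab hf.
destruct (MVT_derive f df a b hab) as [c [hc e]]; [intros; now apply hf|].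
rewrite e, Rabs_mult, (Rabs_pos_eq (b - a)) by lra.
apply Rmult_le_compat_r; [lra|now apply hf].
Qed.

(** L may depend on the bounded time interval, since coefficients along a solution are only bounded
    on such intervals. E exp(-L t) does not increase after t0 and E exp(L t) does not decrease
    before it, so E cannot leave 0 in either direction. *)
Lemma gronwall_zero (E E' : R -> R) (t0 : R) :
  (forall t, is_derive E t (E' t)) -> (forall t, 0 <= E t) ->
  (forall N, exists L, forall t, Rabs t <= N -> Rabs (E' t) <= L * E t) ->
  E t0 = 0 -> forall t, E t = 0.
Proof.
intros hE hpos hL h0 t.
destruct (hL (Rmax (Rabs t0) (Rabs t))) as [L hb]; clear hL.
assert (hN : forall s, (t0 <= s <= t \/ t <= s <= t0) ->
             Rabs s <= Rmax (Rabs t0) (Rabs t)).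
{ intros s hs; pose proof (Rmax_l (Rabs t0) (Rabs t)); pose proof (Rmax_r (Rabs t0) (Rabs t)).
  pose proof (Rle_abs t0); pose proof (Rle_abs t).
  pose proof (Rabs_maj2 t0); pose proof (Rabs_maj2 t); apply Rabs_le; lra. }
assert (hphi : forall K s, is_derive (fun s => E s * exp (K * s)) s
                 ((E' s + K * E s) * exp (K * s))).
{ intros K s; eapply is_derive_value.
  - apply (is_derive_Rmult E (fun s => exp (K * s))); [apply hE|].
    apply (is_derive_Rcomp exp (fun s => K * s)); [apply is_derive_exp|].
    apply is_derive_Rscal, (is_derive_id s).
  - unfold one; simpl; ring. }
apply Rle_antisym; [|apply hpos].
destruct (Rle_dec t0 t) as [h|h].
- destruct (MVT_derive _ _ t0 t h (fun x _ => hphi (- L) x)) as [c [hc e]].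
  rewrite h0 in e.
  assert (E' c + - L * E c <= 0).
  { specialize (hb c (hN c (or_introl hc))); revert hb; unfold Rabs; destruct Rcase_abs; lra. }
  pose proof (exp_pos (- L * c)); pose proof (exp_pos (- L * t)).
  assert (0 <= - (E' c + - L * E c) * exp (- L * c) * (t - t0)).
  { apply Rmult_le_pos; [apply Rmult_le_pos|]; lra. }
  apply (Rmult_le_reg_r (exp (- L * t))); lra.
- assert (h' : t <= t0) by lra.
  destruct (MVT_derive _ _ t t0 h' (fun x _ => hphi L x)) as [c [hc e]].
  rewrite h0 in e.
  assert (0 <= E' c + L * E c).
  { specialize (hb c (hN c (or_intror hc))); revert hb; unfold Rabs; destruct Rcase_abs; lra. }
  pose proof (exp_pos (L * c)); pose proof (exp_pos (L * t)).
  assert (0 <= (E' c + L * E c) * exp (L * c) * (t0 - t)).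
  { apply Rmult_le_pos; [apply Rmult_le_pos|]; lra. }
  apply (Rmult_le_reg_r (exp (L * t))); lra.
Qed.

(** * Integer powers and sums over lists of exponents *)

Lemma is_derive_powerRZ (j : Z) (r : R) :
  0 < r -> is_derive (fun x => powerRZ x j) r (IZR j * powerRZ r (j - 1)).
Proof.
intros hr.
(* Writing x^j as exp (j ln x) near r > 0 treats both signs of j at once. *)
apply (is_derive_ext_loc (fun x => exp (IZR j * ln x))).
- exists (mkposreal r hr); intros y hy.
  assert (0 < y).
  { apply (Rabs_lt_between' y r r) in hy; lra. }
  now rewrite powerRZ_Rpower.
- eapply is_derive_value.
  + apply (is_derive_Rcomp exp (fun x => IZR j * ln x)); [apply is_derive_exp|].
    apply is_derive_Rscal, is_derive_Reals, derivable_pt_lim_ln, hr.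
  + replace (exp (IZR j * ln r)) with (powerRZ r j) by now rewrite powerRZ_Rpower.
    replace j with (j - 1 + 1)%Z at 2 by lia.
    rewrite powerRZ_add, powerRZ_1 by lra; field; lra.
Qed.

Lemma continuous_powerRZ (u : R -> R) (j : Z) (x : R) :
  0 < u x -> continuous u x -> continuous (fun t => powerRZ (u t) j) x.
Proof.
intros hpos hu; apply (continuous_comp u (fun y => powerRZ y j)); [exact hu|].
exact (derivable_continuous_at _ _ _ (is_derive_powerRZ j (u x) hpos)).
Qed.

Lemma powerRZ_pow (r : R) (k : nat) (j : Z) :
  0 < r -> r ^ k * powerRZ r j = powerRZ r (Z.of_nat k + j).
Proof. intros hr; rewrite powerRZ_add by lra; now rewrite pow_powerRZ. Qed.

Lemma sumZ_cons (z : Z) (L : list Z) (u : Z -> R) : sumZ (z :: L) u = u z + sumZ L u.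
Proof. reflexivity. Qed.

Lemma sumZ_ext (L : list Z) (u v : Z -> R) :
  (forall z, In z L -> u z = v z) -> sumZ L u = sumZ L v.
Proof.
induction L as [|z L IH]; intros h; [reflexivity|].
rewrite !sumZ_cons; f_equal; [apply h; now left|].
apply IH; intros; apply h; now right.
Qed.

Lemma sumZ_plus (L : list Z) (u v : Z -> R) :
  sumZ L (fun z => u z + v z) = sumZ L u + sumZ L v.
Proof. induction L as [|z L IH]; [unfold sumZ; simpl; ring|rewrite !sumZ_cons, IH; ring]. Qed.

Lemma sumZ_scal (L : list Z) (c : R) (u : Z -> R) :
  sumZ L (fun z => c * u z) = c * sumZ L u.
Proof. induction L as [|z L IH]; [unfold sumZ; simpl; ring|rewrite !sumZ_cons, IH; ring]. Qed.

Lemma sumZ_zero (L : list Z) : sumZ L (fun _ => 0) = 0.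
Proof. induction L as [|z L IH]; [reflexivity|rewrite sumZ_cons, IH; ring]. Qed.

Lemma sumZ_opp (L : list Z) (u : Z -> R) : sumZ L (fun z => - u z) = - sumZ L u.
Proof. induction L as [|z L IH]; [unfold sumZ; simpl; ring|rewrite !sumZ_cons, IH; ring]. Qed.

Lemma sumZ_exchange (L L' : list Z) (u : Z -> Z -> R) :
  sumZ L (fun z => sumZ L' (u z)) = sumZ L' (fun y => sumZ L (fun z => u z y)).
Proof.
induction L as [|z L IH].
- symmetry; apply sumZ_zero.
- rewrite sumZ_cons, IH, <- sumZ_plus; reflexivity.
Qed.

Lemma sumZ_abs_le (L : list Z) (u v : Z -> R) :
  (forall z, In z L -> Rabs (u z) <= v z) -> Rabs (sumZ L u) <= sumZ L v.
Proof.
induction L as [|z L IH]; intros h.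
- unfold sumZ; simpl; rewrite Rabs_R0; lra.
- rewrite !sumZ_cons; eapply Rle_trans; [apply Rabs_triang|].
  apply Rplus_le_compat; [apply h; now left|apply IH; intros; apply h; now right].
Qed.

Lemma is_derive_sumZ (L : list Z) (u : Z -> R -> R) (u' : Z -> R) (x : R) :
  (forall z, In z L -> is_derive (u z) x (u' z)) ->
  is_derive (fun t => sumZ L (fun z => u z t)) x (sumZ L u').
Proof.
induction L as [|z L IH]; intros h.
- apply (is_derive_const 0).
- apply (is_derive_plus (u z) (fun t => sumZ L (fun z => u z t))).
  + apply h; now left.
  + apply IH; intros; apply h; now right.
Qed.

Lemma continuous_sumZ (L : list Z) (u : Z -> R -> R) (x : R) :
  (forall z, In z L -> continuous (u z) x) ->
  continuous (fun t => sumZ L (fun z => u z t)) x.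
Proof.
induction L as [|z L IH]; intros h.
- apply continuous_const.
- apply continuous_Rplus; [apply h; now left|apply IH; intros; apply h; now right].
Qed.

Lemma sumZ_indicator (L : list Z) (z0 : Z) (u : Z -> R) :
  NoDup L -> In z0 L -> sumZ L (fun z => if Z.eq_dec z0 z then u z else 0) = u z0.
Proof.
induction L as [|z L IH]; intros hd hin; [easy|].
inversion hd as [|? ? hnot hd']; subst; rewrite sumZ_cons.
destruct (Z.eq_dec z0 z) as [->|ne].
- rewrite (sumZ_ext L _ (fun _ => 0)), sumZ_zero; [ring|].
  intros y hy; destruct (Z.eq_dec z y); [subst; easy|reflexivity].
- destruct hin as [->|hin]; [easy|rewrite IH by assumption; ring].
Qed.

Lemma powers_independent (L : list Z) (c : Z -> R) :
  NoDup L -> (forall h, 0 < h -> sumZ L (fun j => powerRZ h j * c j) = 0) ->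
  forall j, In j L -> c j = 0.
Proof.
revert c; induction L as [|z L IH]; intros c hd h j hj; [easy|].
inversion hd as [|? ? hnot hd']; subst.
(* Dividing by [h^z] and differentiating removes the term [c z]. *)
assert (hq : forall h, 0 < h -> c z + sumZ L (fun j => powerRZ h (j - z) * c j) = 0).
{ intros x hx; pose proof (h x hx) as e; rewrite sumZ_cons in e.
  assert (hz : powerRZ x z <> 0) by (apply powerRZ_NOR; lra).
  apply (Rmult_eq_reg_l (powerRZ x z)); [|exact hz].
  rewrite Rmult_0_r, <- e at 1; rewrite Rmult_plus_distr_l; f_equal.
  rewrite <- sumZ_scal; apply sumZ_ext; intros y _.
  rewrite <- Rmult_assoc, <- powerRZ_add by lra; do 2 f_equal; lia. }
assert (htail : forall j, In j L -> c j = 0).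
(* The exponents being distinct, the factor y - z left by differentiation is nonzero, so the
   induction hypothesis can be applied to (y - z) c_y. *)
{ intros y hy; enough (e : IZR (y - z) * c y = 0).
  { apply Rmult_integral in e; destruct e as [e|e]; [|exact e].
    apply (eq_IZR _ 0) in e; assert (y = z) by lia; subst; easy. }
  revert y hy; apply (IH (fun y => IZR (y - z) * c y) hd'); intros x hx.
  assert (hder : is_derive (fun t => sumZ L (fun j => powerRZ t (j - z) * c j)) x
                   (sumZ L (fun j => IZR (j - z) * powerRZ x (j - z - 1) * c j))).
  { apply is_derive_sumZ; intros y _.
    eapply is_derive_value.
    - apply (is_derive_Rmult _ (fun _ => c y)); [now apply is_derive_powerRZ|].
      apply (is_derive_const (c y)).
    - unfold zero; simpl; ring. }
  assert (hconst : is_derive (fun t => sumZ L (fun j => powerRZ t (j - z) * c j)) x 0).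
  { apply (is_derive_ext_loc (fun _ => - c z)).
    - exists (mkposreal x hx); intros t ht.
      apply (Rabs_lt_between' t x x) in ht.
      assert (ht' : 0 < t) by lra; specialize (hq t ht'); lra.
    - apply (is_derive_const (- c z)). }
  pose proof (is_derive_unique _ _ _ hder) as e1.
  rewrite (is_derive_unique _ _ _ hconst) in e1.
  (* Multiplication by x^(z+1) turns the exponents y - z - 1 back into y. *)
  transitivity (powerRZ x (z + 1) * sumZ L (fun j => IZR (j - z) * powerRZ x (j - z - 1) * c j)).
  - rewrite <- sumZ_scal; apply sumZ_ext; intros y _.
    replace y with (z + 1 + (y - z - 1))%Z at 1 by lia.
    rewrite powerRZ_add by lra; ring.
  - rewrite <- e1; ring. }
destruct hj as [->|hj]; [|now apply htail].
pose proof (hq 1 Rlt_0_1) as e.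
rewrite (sumZ_ext L _ (fun _ => 0)), sumZ_zero in e; [lra|].
intros y hy; rewrite htail by assumption; ring.
Qed.

(** * Polar coordinates of quasi-homogeneous systems *)

(** One regularity class, closed under sums and products, that yields continuity along curves,
    bounds on squares and the estimates behind uniqueness of solutions. *)
Definition locally_lipschitz (f : R -> R -> R) : Prop :=
  forall N, exists C, 0 <= C /\ forall x y x' y',
    Rabs x <= N -> Rabs y <= N -> Rabs x' <= N -> Rabs y' <= N ->
    Rabs (f x y - f x' y') <= C * (Rabs (x - x') + Rabs (y - y')).

Lemma lipschitz_const (c : R) : locally_lipschitz (fun _ _ => c).
Proof.
intros N; exists 0; split; [lra|]; intros; rewrite Rminus_diag, Rabs_R0; lra.
Qed.

Lemma lipschitz_fst : locally_lipschitz (fun x _ => x).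
Proof.
intros N; exists 1; split; [lra|]; intros x y x' y' _ _ _ _.
pose proof (Rabs_pos (y - y')); lra.
Qed.

Lemma lipschitz_snd : locally_lipschitz (fun _ y => y).
Proof.
intros N; exists 1; split; [lra|]; intros x y x' y' _ _ _ _.
pose proof (Rabs_pos (x - x')); lra.
Qed.

Lemma lipschitz_plus (f g : R -> R -> R) :
  locally_lipschitz f -> locally_lipschitz g ->
  locally_lipschitz (fun x y => f x y + g x y).
Proof.
intros hf hg N; destruct (hf N) as [C [hC h1]], (hg N) as [D [hD h2]].
exists (C + D); split; [lra|]; intros x y x' y' hx hy hx' hy'.
replace (f x y + g x y - (f x' y' + g x' y'))
  with ((f x y - f x' y') + (g x y - g x' y')) by ring.
eapply Rle_trans; [apply Rabs_triang|]; rewrite Rmult_plus_distr_r.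
apply Rplus_le_compat; auto.
Qed.

Lemma lipschitz_bounded (f : R -> R -> R) (N : R) :
  locally_lipschitz f ->
  exists B, 0 <= B /\ forall x y, Rabs x <= N -> Rabs y <= N -> Rabs (f x y) <= B.
Proof.
intros hf; destruct (hf N) as [C [hC h]].
(* [Rabs N] keeps the constant nonnegative when N < 0, where the bound itself is vacuous. *)
exists (Rabs (f 0 0) + C * (Rabs N + Rabs N)); split.
{ pose proof (Rabs_pos (f 0 0)); pose proof (Rabs_pos N); nra. }
intros x y hx hy.
assert (0 <= N) by (pose proof (Rabs_pos x); lra).
replace (f x y) with ((f x y - f 0 0) + f 0 0) by ring.
eapply Rle_trans; [apply Rabs_triang|].
specialize (h x y 0 0 hx hy); rewrite Rabs_R0, !Rminus_0_r in h.
specialize (h H H); rewrite (Rabs_pos_eq N) by assumption; nra.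
Qed.

Lemma lipschitz_mult (f g : R -> R -> R) :
  locally_lipschitz f -> locally_lipschitz g ->
  locally_lipschitz (fun x y => f x y * g x y).
Proof.
intros hf hg N; destruct (hf N) as [C [hC h1]], (hg N) as [D [hD h2]].
destruct (lipschitz_bounded f N hf) as [A [hA b1]], (lipschitz_bounded g N hg) as [B [hB b2]].
exists (C * B + A * D); split; [nra|]; intros x y x' y' hx hy hx' hy'.
replace (f x y * g x y - f x' y' * g x' y')
  with ((f x y - f x' y') * g x y + f x' y' * (g x y - g x' y')) by ring.
eapply Rle_trans; [apply Rabs_triang|]; rewrite !Rabs_mult.
specialize (h1 x y x' y' hx hy hx' hy'); specialize (h2 x y x' y' hx hy hx' hy').
specialize (b1 x' y' hx' hy'); specialize (b2 x y hx hy).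
set (e := Rabs (x - x') + Rabs (y - y')) in *.
apply (Rle_trans _ ((C * e) * B + A * (D * e))); [|lra].
apply Rplus_le_compat; apply Rmult_le_compat; auto; apply Rabs_pos.
Qed.

Lemma lipschitz_opp (f : R -> R -> R) :
  locally_lipschitz f -> locally_lipschitz (fun x y => - f x y).
Proof.
intros hf N; destruct (hf N) as [C [hC h]]; exists C; split; [exact hC|].
intros x y x' y' hx hy hx' hy'.
replace (- f x y - - f x' y') with (- (f x y - f x' y')) by ring.
rewrite Rabs_Ropp; auto.
Qed.

Lemma lipschitz_pow (f : R -> R -> R) (k : nat) :
  locally_lipschitz f -> locally_lipschitz (fun x y => f x y ^ k).
Proof.
intros hf; induction k as [|k IH]; simpl.
- apply lipschitz_const.
- now apply lipschitz_mult.
Qed.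

Lemma lipschitz_sum (u : nat -> R -> R -> R) (k : nat) :
  (forall i, locally_lipschitz (u i)) ->
  locally_lipschitz (fun x y => sum_f_R0 (fun i => u i x y) k).
Proof. intros hu; induction k; simpl; [apply hu|now apply lipschitz_plus]. Qed.

Lemma lipschitz_eval2 (n : nat) (c : nat -> nat -> R) : locally_lipschitz (eval2 n c).
Proof.
apply (lipschitz_sum (fun a x y => sum_f_R0 (fun b => c a b * x ^ a * y ^ b) (n - a))); intros a.
apply (lipschitz_sum (fun b x y => c a b * x ^ a * y ^ b)); intros b.
apply lipschitz_mult; [apply lipschitz_mult; [apply lipschitz_const|]|].
- apply (lipschitz_pow (fun x _ => x)), lipschitz_fst.
- apply (lipschitz_pow (fun _ y => y)), lipschitz_snd.
Qed.

Lemma lipschitz_continuous (f : R -> R -> R) (u v : R -> R) (t : R) :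
  locally_lipschitz f -> continuous u t -> continuous v t ->
  continuous (fun s => f (u s) (v s)) t.
Proof.
intros hf hu hv.
apply continuity_pt_filterlim, continuity_pt_locally; intros eps.
apply continuity_pt_filterlim in hu; apply continuity_pt_filterlim in hv.
rewrite continuity_pt_locally in hu; rewrite continuity_pt_locally in hv.
destruct (hf (Rabs (u t) + Rabs (v t) + 1)) as [C [hC h]].
(* The 1 keeps (u s, v s) in the square where C is valid. In 2 C + 1, the 2 counts the coordinates
   and the 1 keeps the denominator positive when C = 0. *)
assert (hd : 0 < Rmin 1 (eps / (2 * C + 1))).
{ apply Rmin_glb_lt; [lra|]; apply Rdiv_lt_0_compat; [apply eps|lra]. }
specialize (hu (mkposreal _ hd)); specialize (hv (mkposreal _ hd)).
generalize (filter_and _ _ hu hv); apply filter_imp; intros s [hus hvs]; simpl in *.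
pose proof (Rmin_l 1 (eps / (2 * C + 1))); pose proof (Rmin_r 1 (eps / (2 * C + 1))).
pose proof (Rabs_triang (u s - u t) (u t)) as h1; pose proof (Rabs_triang (v s - v t) (v t)) as h2.
replace (u s - u t + u t) with (u s) in h1 by ring.
replace (v s - v t + v t) with (v s) in h2 by ring.
pose proof (Rabs_pos (u t)); pose proof (Rabs_pos (v t)).
eapply Rle_lt_trans; [apply h; lra|].
assert (hd' : (2 * C + 1) * (eps / (2 * C + 1)) = eps) by (field; lra).
set (e := eps / (2 * C + 1)) in *.
assert (0 < e) by lra.
nra.
Qed.

Lemma pow_unit_lipschitz (x y : R) (k : nat) :
  Rabs x <= 1 -> Rabs y <= 1 -> Rabs (x ^ k - y ^ k) <= INR k * Rabs (x - y).
Proof.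
intros hx hy; induction k as [|k IH].
- simpl; rewrite Rminus_diag, Rabs_R0; lra.
- rewrite S_INR; simpl.
  replace (x * x ^ k - y * y ^ k) with ((x - y) * x ^ k + y * (x ^ k - y ^ k)) by ring.
  eapply Rle_trans; [apply Rabs_triang|]; rewrite !Rabs_mult.
  assert (Rabs (x ^ k) <= 1).
  { rewrite <- RPow_abs, <- (pow1 k); apply pow_incr; split; [apply Rabs_pos|exact hx]. }
  pose proof (Rabs_pos (x - y)); pose proof (Rabs_pos (x ^ k - y ^ k)).
  pose proof (Rabs_pos y); pose proof (pos_INR k); nra.
Qed.

Lemma square_mean (a b : R) : 2 * (Rabs a * Rabs b) <= a ^ 2 + b ^ 2.
Proof. rewrite <- (pow2_abs a), <- (pow2_abs b); pose proof (pow2_ge_0 (Rabs a - Rabs b)); nra. Qed.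

Lemma sum_squares_zero (a b : R) : a ^ 2 + b ^ 2 = 0 -> a = 0 /\ b = 0.
Proof. intros h; split; nra. Qed.

Section Polar.

Context (s1 s2 m : nat) (P Q : R -> R -> R).
Context (hs1 : (1 <= s1)%nat) (hs2 : (1 <= s2)%nat).
Context (hqh : quasi_homogeneous s1 s2 m P Q).

(** The closed curve described by (Cs, Sn), that is rho = 1. *)
Definition unit_level (u v : R) : Prop :=
  INR s1 * u ^ (2 * s2) + INR s2 * v ^ (2 * s1) = 1.

(** F and, below, G as functions of a point instead of the angle: along an orbit the point (u, v) is
    available before any angle. Composed with (Cs, Sn) they are [polF] and [polG] by conversion. *)
Definition radial (u v : R) : R := u ^ (2 * s2 - 1) * P u v + v ^ (2 * s1 - 1) * Q u v.

Definition angular (u v : R) : R := INR s1 * u * Q u v - INR s2 * v * P u v.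

Lemma INR_weight_pos : 1 <= INR s1 /\ 1 <= INR s2.
Proof. split; apply (le_INR 1); assumption. Qed.

Lemma even_pow_nonneg (x : R) (k : nat) : 0 <= x ^ (2 * k).
Proof. rewrite pow_mult; apply pow_le, pow2_ge_0. Qed.

Lemma unit_level_bounded (u v : R) : unit_level u v -> Rabs u <= 1 /\ Rabs v <= 1.
Proof.
intros h; unfold unit_level in h; destruct INR_weight_pos as [i1 i2].
pose proof (even_pow_nonneg u s2); pose proof (even_pow_nonneg v s1).
assert (key : forall x k, (1 <= k)%nat -> x ^ (2 * k) <= 1 -> Rabs x <= 1).
{ intros x k hk hx; apply Rnot_lt_le; intros hlt.
  pose proof (Rlt_pow_R1 (Rabs x) (2 * k) hlt ltac:(lia)) as h1.
  rewrite RPow_abs, Rabs_pos_eq in h1 by apply even_pow_nonneg; lra. }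
split; eapply key; [exact hs2| |exact hs1|]; nra.
Qed.

Lemma unit_level_nonzero (u v : R) : unit_level u v -> 0 < u ^ 2 + v ^ 2.
Proof.
intros h; destruct (Rle_lt_or_eq_dec 0 (u ^ 2 + v ^ 2)) as [|e]; [nra|assumption|].
destruct (sum_squares_zero u v (eq_sym e)) as [-> ->]; unfold unit_level in h.
rewrite !pow_i in h by lia; lra.
Qed.

Lemma polar_unique (r a b r' a' b' : R) :
  0 < r -> 0 < r' -> unit_level a b -> unit_level a' b' ->
  r ^ s1 * a = r' ^ s1 * a' -> r ^ s2 * b = r' ^ s2 * b' ->
  r = r' /\ a = a' /\ b = b'.
Proof.
intros hr hr' h h' ea eb; unfold unit_level in h, h'.
(* The function s1 x^(2 s2) + s2 y^(2 s1) equals r^(2 s1 s2) at such a point, so it recovers r; then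
   a and b follow by division. *)
assert (V : forall r a b, INR s1 * a ^ (2 * s2) + INR s2 * b ^ (2 * s1) = 1 ->
   r ^ (2 * s1 * s2) = INR s1 * (r ^ s1 * a) ^ (2 * s2) + INR s2 * (r ^ s2 * b) ^ (2 * s1)).
{ clear; intros r a b h; rewrite !Rpow_mult_distr, <- !pow_mult.
  replace (s1 * (2 * s2))%nat with (2 * s1 * s2)%nat by ring.
  replace (s2 * (2 * s1))%nat with (2 * s1 * s2)%nat by ring.
  transitivity (r ^ (2 * s1 * s2) * 1); [ring|rewrite <- h; ring]. }
assert (e : r ^ (2 * s1 * s2) = r' ^ (2 * s1 * s2)).
{ rewrite (V r a b h), (V r' a' b' h'), ea, eb; reflexivity. }
assert (er : r = r').
{ apply (f_equal ln) in e; rewrite !ln_pow in e by assumption.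
  apply ln_inv; try assumption; apply Rmult_eq_reg_l in e; [exact e|].
  apply not_0_INR; nia. }
subst r'; split; [reflexivity|].
split; [apply (Rmult_eq_reg_l (r ^ s1))|apply (Rmult_eq_reg_l (r ^ s2))];
  try assumption; apply pow_nonzero; lra.
Qed.

Lemma polar_scaling (r a b : R) :
  0 < r -> P (r ^ s1 * a) (r ^ s2 * b) = r ^ (s1 + m - 1) * P a b /\
           Q (r ^ s1 * a) (r ^ s2 * b) = r ^ (s2 + m - 1) * Q a b.
Proof. intros hr; now apply hqh. Qed.

(** r^m / r stands for r^(m-1), whose exponent would be truncated at m = 0. *)
Lemma pow_ratio (r : R) (s : nat) : 0 < r -> (1 <= s)%nat ->
  r ^ (s + m - 1) * (/ r) ^ s = r ^ m / r.
Proof.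
intros hr hs; rewrite pow_inv.
apply (Rmult_eq_reg_r (r ^ s * r)); [|apply Rmult_integral_contrapositive; split; [apply pow_nonzero|]; lra].
replace (r ^ (s + m - 1) * / r ^ s * (r ^ s * r)) with (r ^ (s + m - 1) * r ^ 1)
  by (field; apply pow_nonzero; lra).
rewrite <- pow_add; replace (s + m - 1 + 1)%nat with (s + m)%nat by lia.
rewrite pow_add; field; lra.
Qed.

(** The pair (u, v) on the unit level replaces the angle, so nothing has to be lifted here. Its
    equation is that of (Cs, Sn) run at the speed rho^(m-1) G(u, v), which later lets uniqueness
    recover the angle. *)
Lemma polar_coordinates (x y : R -> R) :
  is_solution P Q x y -> (forall t, 0 < x t ^ 2 + y t ^ 2) ->
  exists rho u v : R -> R, forall t,
    0 < rho t /\ x t = rho t ^ s1 * u t /\ y t = rho t ^ s2 * v t /\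
    unit_level (u t) (v t) /\
    is_derive rho t (rho t ^ m * radial (u t) (v t)) /\
    is_derive u t (- v t ^ (2 * s1 - 1) * (rho t ^ m / rho t * angular (u t) (v t))) /\
    is_derive v t (u t ^ (2 * s2 - 1) * (rho t ^ m / rho t * angular (u t) (v t))).
Proof.
intros hsol hnz; destruct INR_weight_pos as [i1 i2].
set (V := fun t => INR s1 * x t ^ (2 * s2) + INR s2 * y t ^ (2 * s1)).
assert (hV : forall t, 0 < V t).
{ intros t; unfold V.
  pose proof (even_pow_nonneg (x t) s2); pose proof (even_pow_nonneg (y t) s1).
  destruct (Req_dec (x t) 0) as [ex|ex].
  - assert (y t <> 0) by (intros ey; specialize (hnz t); rewrite ex, ey in hnz; lra).
    assert (y t ^ (2 * s1) <> 0) by now apply pow_nonzero.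
    nra.
  - assert (x t ^ (2 * s2) <> 0) by now apply pow_nonzero.
    nra. }
(* N is the weight degree of V, so rho = V^(1/N) has weight one. *)
set (N := (2 * s1 * s2)%nat).
assert (hN : 0 < INR N) by (apply lt_0_INR; unfold N; nia).
set (rho := fun t => exp (/ INR N * ln (V t))).
assert (hrho : forall t, 0 < rho t) by (intros; apply exp_pos).
assert (hpow : forall t, rho t ^ N = V t).
{ intros t; rewrite <- Rpower_pow by apply hrho; unfold Rpower, rho; rewrite ln_exp.
  rewrite <- Rmult_assoc, Rinv_r, Rmult_1_l by lra; now apply exp_ln. }
set (u := fun t => x t * (/ rho t) ^ s1); set (v := fun t => y t * (/ rho t) ^ s2).
assert (hx : forall t, x t = rho t ^ s1 * u t).
{ intros t; unfold u; rewrite pow_inv; field; apply pow_nonzero; specialize (hrho t); lra. }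
assert (hy : forall t, y t = rho t ^ s2 * v t).
{ intros t; unfold v; rewrite pow_inv; field; apply pow_nonzero; specialize (hrho t); lra. }
assert (hunit : forall t, unit_level (u t) (v t)).
{ intros t; unfold unit_level.
  apply (Rmult_eq_reg_l (rho t ^ N)); [|rewrite hpow; specialize (hV t); lra].
  rewrite Rmult_1_r; transitivity (V t); [|now rewrite hpow].
  unfold V; rewrite (hx t), (hy t), !Rpow_mult_distr, <- !pow_mult.
  replace (s1 * (2 * s2))%nat with N by (unfold N; ring).
  replace (s2 * (2 * s1))%nat with N by (unfold N; ring); ring. }
assert (drho : forall t, is_derive rho t (rho t ^ m * radial (u t) (v t))).
{ intros t; destruct (hsol t) as [dx dy].
  assert (dV : is_derive V t (INR s1 * (INR (2 * s2) * P (x t) (y t) * x t ^ (2 * s2 - 1))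
                  + INR s2 * (INR (2 * s1) * Q (x t) (y t) * y t ^ (2 * s1 - 1)))).
  { apply is_derive_Rplus; apply is_derive_Rscal; now apply is_derive_Rpow. }
  eapply is_derive_value.
  - apply (is_derive_Rcomp exp (fun t => / INR N * ln (V t))); [apply is_derive_exp|].
    apply is_derive_Rscal, (is_derive_Rcomp ln V); [|exact dV].
    apply is_derive_Reals, derivable_pt_lim_ln, hV.
  - change (exp (/ INR N * ln (V t))) with (rho t).
    replace (INR N) with (2 * INR s1 * INR s2) by (unfold N; rewrite !mult_INR; simpl; ring).
    rewrite !mult_INR; change (INR 2) with 2.
    rewrite <- (hpow t), (hx t), (hy t).
    destruct (polar_scaling (rho t) (u t) (v t) (hrho t)) as [-> ->].
    rewrite !Rpow_mult_distr, <- !pow_mult; unfold radial.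
    assert (e1 : rho t * (rho t ^ (s1 + m - 1) * rho t ^ (s1 * (2 * s2 - 1))) = rho t ^ N * rho t ^ m).
    { rewrite <- !pow_add, tech_pow_Rmult; f_equal; unfold N; nia. }
    assert (e2 : rho t * (rho t ^ (s2 + m - 1) * rho t ^ (s2 * (2 * s1 - 1))) = rho t ^ N * rho t ^ m).
    { rewrite <- !pow_add, tech_pow_Rmult; f_equal; unfold N; nia. }
    assert (hnz' : rho t ^ N <> 0) by (apply pow_nonzero; specialize (hrho t); lra).
    transitivity (((rho t * (rho t ^ (s1 + m - 1) * rho t ^ (s1 * (2 * s2 - 1)))) * (u t ^ (2 * s2 - 1) * P (u t) (v t))
      + (rho t * (rho t ^ (s2 + m - 1) * rho t ^ (s2 * (2 * s1 - 1)))) * (v t ^ (2 * s1 - 1) * Q (u t) (v t))) / rho t ^ N).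
    + field; repeat split; try assumption; lra.
    + rewrite e1, e2; field; assumption. }
assert (dsig : forall t, is_derive (fun t => / rho t) t
                (- (rho t ^ m * radial (u t) (v t)) / rho t ^ 2)).
{ intros t; apply is_derive_inv; [apply drho|specialize (hrho t); lra]. }
assert (dquot : forall (z : R -> R) (z' : R) (s : nat) t, (1 <= s)%nat -> is_derive z t z' ->
   is_derive (fun t => z t * (/ rho t) ^ s) t
     (z' * (/ rho t) ^ s - INR s * (z t * (/ rho t) ^ s) * (rho t ^ m / rho t * radial (u t) (v t)))).
{ intros z z' s t hs hz; eapply is_derive_value.
  - apply is_derive_Rmult; [exact hz|]; apply is_derive_Rpow, dsig.
  - assert (e : (/ rho t) ^ s = / rho t * (/ rho t) ^ (s - 1)).
    { rewrite tech_pow_Rmult; f_equal; lia. }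
    cbv beta; rewrite e; generalize ((/ rho t) ^ (s - 1)); intros c.
    field; specialize (hrho t); lra. }
exists rho, u, v; intros t; destruct (hsol t) as [dx dy].
split; [apply hrho|]; split; [apply hx|]; split; [apply hy|]; split; [apply hunit|].
split; [apply drho|].
(* Multiplying P and Q by this 1 turns P - s1 u F into - v^(2 s1 - 1) G and Q - s2 v F into u^(2 s2
   - 1) G. *)
assert (key : INR s1 * u t * u t ^ (2 * s2 - 1) + INR s2 * v t * v t ^ (2 * s1 - 1) = 1).
{ rewrite <- (hunit t), !Rmult_assoc, !tech_pow_Rmult; do 2 f_equal; f_equal; lia. }
destruct (polar_scaling (rho t) (u t) (v t) (hrho t)) as [eP eQ].
rewrite <- hx, <- hy in eP, eQ.
split; (eapply is_derive_value; [apply dquot; eassumption|]).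
- rewrite eP; fold (u t).
  transitivity (rho t ^ m / rho t * (P (u t) (v t) * 1 - INR s1 * u t * radial (u t) (v t))).
  + rewrite <- (pow_ratio (rho t) s1) by auto; unfold u; ring.
  + rewrite <- key; unfold radial, angular; ring.
- rewrite eQ; fold (v t).
  transitivity (rho t ^ m / rho t * (Q (u t) (v t) * 1 - INR s2 * v t * radial (u t) (v t))).
  + rewrite <- (pow_ratio (rho t) s2) by auto; unfold v; ring.
  + rewrite <- key; unfold radial, angular; ring.
Qed.

End Polar.

(** * Consequences of the center condition *)

Lemma derive_zero_constant (f : R -> R) :
  (forall t, is_derive f t 0) -> forall a b, f a = f b.
Proof.
intros hf a b; destruct (Rle_dec a b) as [h|h].
- destruct (MVT_derive f (fun _ => 0) a b h) as [c [_ e]]; [intros; apply hf|lra].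
- destruct (MVT_derive f (fun _ => 0) b a) as [c [_ e]]; [lra|intros; apply hf|lra].
Qed.

Lemma lipschitz_radial (s1 s2 : nat) (P Q : R -> R -> R) :
  locally_lipschitz P -> locally_lipschitz Q -> locally_lipschitz (radial s1 s2 P Q).
Proof.
intros hP hQ; apply lipschitz_plus; apply lipschitz_mult; try assumption.
- apply (lipschitz_pow (fun x _ => x)), lipschitz_fst.
- apply (lipschitz_pow (fun _ y => y)), lipschitz_snd.
Qed.

Lemma lipschitz_angular (s1 s2 : nat) (P Q : R -> R -> R) :
  locally_lipschitz P -> locally_lipschitz Q -> locally_lipschitz (angular s1 s2 P Q).
Proof.
intros hP hQ; apply lipschitz_plus; [|apply lipschitz_opp];
  apply lipschitz_mult; try assumption.
- apply (lipschitz_mult (fun _ _ => INR s1)); [apply lipschitz_const|apply lipschitz_fst].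
- apply (lipschitz_mult (fun _ _ => INR s2)); [apply lipschitz_const|apply lipschitz_snd].
Qed.

(** Uniqueness for the constant solution at the origin: if x^2 + y^2 vanished at some time, Gronwall
    started there would make it vanish at t0. *)
Lemma solution_nonzero (P Q : R -> R -> R) (x y : R -> R) (t0 : R) :
  locally_lipschitz P -> locally_lipschitz Q -> P 0 0 = 0 -> Q 0 0 = 0 ->
  is_solution P Q x y -> 0 < x t0 ^ 2 + y t0 ^ 2 -> forall t, 0 < x t ^ 2 + y t ^ 2.
Proof.
intros hP hQ eP eQ hsol h0 t.
destruct (Rle_lt_or_eq_dec 0 (x t ^ 2 + y t ^ 2)) as [|e]; [nra|assumption|exfalso].
enough (x t0 ^ 2 + y t0 ^ 2 = 0) by lra.
apply (gronwall_zero (fun t => x t ^ 2 + y t ^ 2)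
         (fun t => 2 * x t * P (x t) (y t) + 2 * y t * Q (x t) (y t)) t).
- intros s; destruct (hsol s) as [dx dy]; eapply is_derive_value.
  + apply is_derive_Rplus; apply is_derive_Rpow; eassumption.
  + simpl; ring.
- intros s; apply Rplus_le_le_0_compat; apply pow2_ge_0.
- intros N.
  assert (cx : forall s, continuous x s) by (intros s; exact (derivable_continuous_at _ _ _ (proj1 (hsol s)))).
  assert (cy : forall s, continuous y s) by (intros s; exact (derivable_continuous_at _ _ _ (proj2 (hsol s)))).
  destruct (bounded_on_segment x (- N) N (fun s _ => cx s)) as [A [hA bx]].
  destruct (bounded_on_segment y (- N) N (fun s _ => cy s)) as [B [hB by_]].
  destruct (hP (A + B)) as [C [hC lP]], (hQ (A + B)) as [D [hD lQ]].
  (* As P and Q vanish at the origin, 2 |x P + y Q| <= 2 (C + D) (|x| + |y|)^2 <= 4 (C + D) (x^2 +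
     y^2). *)
  exists (4 * (C + D)); intros s hs; apply Rabs_le_between in hs.
  specialize (bx s hs); specialize (by_ s hs).
  specialize (lP (x s) (y s) 0 0); specialize (lQ (x s) (y s) 0 0).
  rewrite Rabs_R0, !Rminus_0_r in lP, lQ; rewrite eP, Rminus_0_r in lP; rewrite eQ, Rminus_0_r in lQ.
  specialize (lP ltac:(lra) ltac:(lra) ltac:(lra) ltac:(lra)).
  specialize (lQ ltac:(lra) ltac:(lra) ltac:(lra) ltac:(lra)).
  eapply Rle_trans; [apply Rabs_triang|]; rewrite !Rabs_mult, (Rabs_pos_eq 2) by lra.
  rewrite <- (pow2_abs (x s)), <- (pow2_abs (y s)).
  set (a := Rabs (x s)) in *; set (b := Rabs (y s)) in *.
  assert (0 <= a) by apply Rabs_pos; assert (0 <= b) by apply Rabs_pos.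
  set (p := Rabs (P (x s) (y s))) in *; set (q := Rabs (Q (x s) (y s))) in *.
  apply (Rle_trans _ (2 * (C + D) * ((a + b) * (a + b)))).
  + assert (a * p <= (a + b) * (C * (a + b))) by (apply Rmult_le_compat; try lra; apply Rabs_pos).
    assert (b * q <= (a + b) * (D * (a + b))) by (apply Rmult_le_compat; try lra; apply Rabs_pos).
    lra.
  + replace (4 * (C + D) * (a ^ 2 + b ^ 2)) with (2 * (C + D) * (2 * (a ^ 2 + b ^ 2))) by ring.
    apply Rmult_le_compat_l; [lra|]; pose proof (pow2_ge_0 (a - b)); nra.
- now symmetry.
Qed.

(** The speed kappa is a function of time common to both curves, so only powers of u and v need a
    Lipschitz bound, available on the unit square. Used to lift an orbit to the angle and to turn
    one coincidence of values of (Cs, Sn) into a period. *)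
Lemma lyapunov_flow_unique (a b : nat) (kappa u v u' v' : R -> R) (t0 : R) :
  (forall t, continuous kappa t) ->
  (forall t, is_derive u t (- v t ^ a * kappa t) /\ is_derive v t (u t ^ b * kappa t)) ->
  (forall t, is_derive u' t (- v' t ^ a * kappa t) /\ is_derive v' t (u' t ^ b * kappa t)) ->
  (forall t, Rabs (u t) <= 1 /\ Rabs (v t) <= 1) ->
  (forall t, Rabs (u' t) <= 1 /\ Rabs (v' t) <= 1) ->
  u t0 = u' t0 -> v t0 = v' t0 -> forall t, u t = u' t /\ v t = v' t.
Proof.
intros hk h h' hb hb' e e' t.
enough (E : (u t - u' t) ^ 2 + (v t - v' t) ^ 2 = 0) by (apply sum_squares_zero in E; lra).
revert t; apply (gronwall_zero _ (fun t =>
    2 * (u t - u' t) * (- (v t ^ a - v' t ^ a) * kappa t)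
    + 2 * (v t - v' t) * ((u t ^ b - u' t ^ b) * kappa t)) t0).
- intros t; destruct (h t) as [d1 d2], (h' t) as [d1' d2']; eapply is_derive_value.
  + apply is_derive_Rplus; apply is_derive_Rpow; apply is_derive_Rminus; eassumption.
  + simpl; ring.
- intros t; apply Rplus_le_le_0_compat; apply pow2_ge_0.
- intros N; destruct (bounded_on_segment kappa (- N) N (fun t _ => hk t)) as [K [hK bk]].
  exists (K * (INR a + INR b)); intros t ht; apply Rabs_le_between in ht; specialize (bk t ht).
  destruct (hb t) as [hu hv], (hb' t) as [hu' hv'].
  pose proof (pow_unit_lipschitz (v t) (v' t) a hv hv') as l1.
  pose proof (pow_unit_lipschitz (u t) (u' t) b hu hu') as l2.
  eapply Rle_trans; [apply Rabs_triang|]; rewrite !Rabs_mult, (Rabs_pos_eq 2), Rabs_Ropp by lra.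
  pose proof (square_mean (u t - u' t) (v t - v' t)) as sq.
  pose proof (pos_INR a); pose proof (pos_INR b).
  set (p := Rabs (u t - u' t)) in *; set (q := Rabs (v t - v' t)) in *.
  set (k := Rabs (kappa t)) in *.
  assert (0 <= p) by apply Rabs_pos; assert (0 <= q) by apply Rabs_pos; assert (0 <= k) by apply Rabs_pos.
  apply (Rle_trans _ (2 * p * (INR a * q * K) + 2 * q * (INR b * p * K))).
  + apply Rplus_le_compat; apply Rmult_le_compat_l; try lra;
      apply Rmult_le_compat; try assumption; apply Rabs_pos.
  + replace (2 * p * (INR a * q * K) + 2 * q * (INR b * p * K))
      with (K * (INR a + INR b) * (2 * (p * q))) by ring.
    apply Rmult_le_compat_l; [apply Rmult_le_pos; lra|exact sq].
- rewrite e, e'; ring.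
Qed.

(** A first integral of the Lyapunov system; Cs 0 is normalised so that its value is 1. *)
Lemma lyapunov_unit_level (s1 s2 : nat) (Cs Sn : R -> R) :
  (1 <= s1)%nat -> (1 <= s2)%nat -> is_lyapunov s1 s2 Cs Sn ->
  forall t, unit_level s1 s2 (Cs t) (Sn t).
Proof.
intros h1 h2 [hsol [e0 e1]] t; unfold unit_level.
rewrite (derive_zero_constant (fun t => INR s1 * Cs t ^ (2 * s2) + INR s2 * Sn t ^ (2 * s1))) with (b := 0).
- rewrite e0, e1, pow_i by lia.
  assert (0 < INR s1) by (apply lt_0_INR; lia); assert (0 < INR s2) by (apply lt_0_INR; lia).
  rewrite <- Rpower_pow by apply exp_pos; rewrite Rpower_mult, mult_INR; change (INR 2) with 2.
  replace (- / (2 * INR s2) * (2 * INR s2)) with (- (1)) by (field; lra).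
  rewrite Rpower_Ropp, Rpower_1 by assumption; field; lra.
- intros s; destruct (hsol s) as [d1 d2]; eapply is_derive_value.
  + apply is_derive_Rplus; apply is_derive_Rscal; apply is_derive_Rpow; eassumption.
  + rewrite !mult_INR; change (INR 2) with 2; ring.
Qed.

Section Center.

Context (s1 s2 m : nat) (P Q : R -> R -> R) (Cs Sn : R -> R) (tau : R).
Context (hs1 : (1 <= s1)%nat) (hs2 : (1 <= s2)%nat).
Context (hP : locally_lipschitz P) (hQ : locally_lipschitz Q).
Context (hqh : quasi_homogeneous s1 s2 m P Q) (hcenter : is_center P Q).
Context (hCS : is_lyapunov s1 s2 Cs Sn) (htau : is_least_period Cs Sn tau).

Let F := radial s1 s2 P Q.
Let G := angular s1 s2 P Q.

(** The form in which the center hypothesis is used. The last clause excludes an equilibrium, which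
    is the contradiction reached when G has a zero. *)
Lemma closed_orbit_through_ray (th0 : R) :
  exists (rho u v : R -> R) (T : R),
    (forall t, 0 < rho t /\ unit_level s1 s2 (u t) (v t) /\
       is_derive rho t (rho t ^ m * F (u t) (v t)) /\
       is_derive u t (- v t ^ (2 * s1 - 1) * (rho t ^ m / rho t * G (u t) (v t))) /\
       is_derive v t (u t ^ (2 * s2 - 1) * (rho t ^ m / rho t * G (u t) (v t)))) /\
    u 0 = Cs th0 /\ v 0 = Sn th0 /\ 0 < T /\
    rho T = rho 0 /\ u T = u 0 /\ v T = v 0 /\
    ~ (forall t, rho t = rho 0 /\ u t = u 0 /\ v t = v 0).
Proof.
destruct hcenter as [eP [eQ [delta [hd horb]]]].
pose proof (lyapunov_unit_level s1 s2 Cs Sn hs1 hs2 hCS th0) as hl.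
pose proof (unit_level_bounded s1 s2 hs1 hs2 _ _ hl) as [bc bs].
pose proof (unit_level_nonzero s1 s2 hs1 hs2 _ _ hl) as hnz.
(* r0 <= 1 gives r0^s <= r0, hence x0^2 + y0^2 <= 2 r0^2 <= delta^2 / 2 < delta^2. *)
set (r0 := Rmin 1 (delta / 2)).
assert (h0 : 0 < r0) by (apply Rmin_glb_lt; lra).
assert (h1 : r0 <= 1) by apply Rmin_l; assert (h2 : r0 <= delta / 2) by apply Rmin_r.
assert (hp : forall s, (1 <= s)%nat -> 0 < r0 ^ s <= r0).
{ intros s hs; split; [now apply pow_lt|].
  replace s with (S (s - 1)) by lia; simpl.
  assert (0 < r0 ^ (s - 1)) by now apply pow_lt.
  assert (r0 ^ (s - 1) <= 1) by (rewrite <- (pow1 (s - 1)); apply pow_incr; lra).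
  nra. }
destruct (hp s1 hs1) as [p1 p1'], (hp s2 hs2) as [p2 p2'].
destruct (horb (r0 ^ s1 * Cs th0) (r0 ^ s2 * Sn th0)) as [x [y [T [hsol [ex [ey [hT [hper [t1 ht1]]]]]]]]].
{ split.
  - destruct (Req_dec (Cs th0) 0) as [z|z].
    + assert (Sn th0 <> 0) by (intros z'; rewrite z, z' in hnz; lra).
      assert (r0 ^ s2 * Sn th0 <> 0) by (apply Rmult_integral_contrapositive; split; lra).
      nra.
    + assert (r0 ^ s1 * Cs th0 <> 0) by (apply Rmult_integral_contrapositive; split; lra).
      nra.
  - assert (sq : forall c w, 0 < c <= r0 -> Rabs w <= 1 -> (c * w) ^ 2 <= r0 ^ 2).
    { intros c w hc hw; rewrite Rpow_mult_distr, <- (pow2_abs w).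
      assert (c ^ 2 <= r0 ^ 2) by (apply pow_incr; lra).
      assert (Rabs w ^ 2 <= 1) by (rewrite <- (pow1 2); apply pow_incr; split; [apply Rabs_pos|exact hw]).
      pose proof (pow2_ge_0 c); pose proof (pow2_ge_0 (Rabs w)); nra. }
    pose proof (sq (r0 ^ s1) (Cs th0) (conj p1 p1') bc).
    pose proof (sq (r0 ^ s2) (Sn th0) (conj p2 p2') bs).
    assert (r0 ^ 2 <= (delta / 2) ^ 2) by (apply pow_incr; lra).
    nra. }
assert (hxy : forall t, 0 < x t ^ 2 + y t ^ 2).
{ apply (solution_nonzero P Q x y 0); try assumption; rewrite ex, ey.
  destruct (Req_dec (Cs th0) 0) as [z|z].
  - assert (Sn th0 <> 0) by (intros z'; rewrite z, z' in hnz; lra).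
    assert (r0 ^ s2 * Sn th0 <> 0) by (apply Rmult_integral_contrapositive; split; lra).
    nra.
  - assert (r0 ^ s1 * Cs th0 <> 0) by (apply Rmult_integral_contrapositive; split; lra).
    nra. }
destruct (polar_coordinates s1 s2 m P Q hs1 hs2 hqh x y hsol hxy) as [rho [u [v hpol]]].
exists rho, u, v, T.
destruct (hpol 0) as [q0 [qx [qy [qu _]]]].
destruct (polar_unique s1 s2 hs1 hs2 (rho 0) (u 0) (v 0) r0 (Cs th0) (Sn th0)) as [_ [e1 e2]];
  try assumption; try congruence.
destruct (hpol T) as [q0' [qx' [qy' [qu' _]]]].
destruct (hper 0) as [px py]; rewrite Rplus_0_l in px, py.
destruct (polar_unique s1 s2 hs1 hs2 (rho T) (u T) (v T) (rho 0) (u 0) (v 0)) as [f0 [f1 f2]];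
  try assumption; try congruence.
repeat split; try assumption; try apply hpol.
intros hconst; destruct (hpol t1) as [_ [rx [ry _]]]; destruct (hconst t1) as [c0 [c1 c2]].
rewrite c0, c1 in rx; rewrite c0, c2 in ry; destruct ht1 as [n|n]; apply n; congruence.
Qed.

(* If [G] vanished at [th0], the ray at [th0] would be invariant, and the
   radius would be both monotone and periodic along it. *)
Lemma center_angular_nonzero (th0 : R) : G (Cs th0) (Sn th0) <> 0.
Proof.
intros hG.
destruct (closed_orbit_through_ray th0) as [rho [u [v [T [hpol [e1 [e2 [hT [p0 [_ [_ hn]]]]]]]]]]].
pose proof (lyapunov_unit_level s1 s2 Cs Sn hs1 hs2 hCS th0) as hl.
pose proof (unit_level_bounded s1 s2 hs1 hs2 _ _ hl) as [bc bs].
assert (hb : forall t, Rabs (u t) <= 1 /\ Rabs (v t) <= 1).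
{ intros t; apply (unit_level_bounded s1 s2 hs1 hs2), hpol. }
assert (cr : forall t, continuous rho t).
{ intros t; destruct (hpol t) as [_ [_ [d _]]]; exact (derivable_continuous_at _ _ _ d). }
destruct (lipschitz_angular s1 s2 P Q hP hQ 1) as [C [hC lG]].
(* G vanishes at (Cs th0, Sn th0), so by its Lipschitz bound it is at most of the order of the
   distance to that point, and Gronwall keeps (u, v) there. *)
assert (hray : forall t, u t = Cs th0 /\ v t = Sn th0).
{ intros t.
  enough (E : (u t - Cs th0) ^ 2 + (v t - Sn th0) ^ 2 = 0) by (apply sum_squares_zero in E; lra).
  revert t; apply (gronwall_zero _ (fun t =>
     2 * (u t - Cs th0) * (- v t ^ (2 * s1 - 1) * (rho t ^ m / rho t * G (u t) (v t)))
     + 2 * (v t - Sn th0) * (u t ^ (2 * s2 - 1) * (rho t ^ m / rho t * G (u t) (v t)))) 0).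
  - intros t; destruct (hpol t) as [_ [_ [_ [d1 d2]]]]; eapply is_derive_value.
    + apply is_derive_Rplus; apply is_derive_Rpow; apply is_derive_Rminus;
        [exact d1|apply (is_derive_const (Cs th0))|exact d2|apply (is_derive_const (Sn th0))].
    + unfold zero; simpl; ring.
  - intros t; apply Rplus_le_le_0_compat; apply pow2_ge_0.
  - intros N; destruct (bounded_on_segment (fun t => rho t ^ m / rho t) (- N) N) as [K [hK bK]].
    { intros t _; apply continuous_Rdiv; [now apply continuous_Rpow|apply cr|].
      destruct (hpol t) as [q _]; lra. }
    exists (4 * K * C); intros t ht; apply Rabs_le_between in ht; specialize (bK t ht); simpl in bK.
    destruct (hb t) as [bu bv].
    assert (pw : forall z k, Rabs z <= 1 -> Rabs (z ^ k) <= 1).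
    { intros z k hz; rewrite <- RPow_abs, <- (pow1 k); apply pow_incr; split; [apply Rabs_pos|exact hz]. }
    pose proof (pw _ (2 * s1 - 1)%nat bv) as w1; pose proof (pw _ (2 * s2 - 1)%nat bu) as w2.
    specialize (lG (u t) (v t) (Cs th0) (Sn th0) bu bv bc bs); fold G in lG.
    rewrite hG, Rminus_0_r in lG.
    eapply Rle_trans; [apply Rabs_triang|]; rewrite !Rabs_mult, (Rabs_pos_eq 2), Rabs_Ropp by lra.
    rewrite <- (pow2_abs (u t - _)), <- (pow2_abs (v t - _)).
    set (p := Rabs (u t - Cs th0)) in *; set (q := Rabs (v t - Sn th0)) in *.
    set (k := Rabs (rho t ^ m / rho t)) in *; set (g := Rabs (G (u t) (v t))) in *.
    assert (0 <= p) by apply Rabs_pos; assert (0 <= q) by apply Rabs_pos.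
    assert (0 <= k) by apply Rabs_pos; assert (0 <= g) by apply Rabs_pos.
    assert (hkg : k * g <= K * (C * (p + q))) by (apply Rmult_le_compat; assumption).
    assert (hone : forall w, Rabs w <= 1 -> Rabs w * (k * g) <= K * (C * (p + q))).
    { intros w hw; rewrite <- (Rmult_1_l (K * _)); apply Rmult_le_compat; try assumption.
      - apply Rabs_pos. - now apply Rmult_le_pos. }
    apply (Rle_trans _ (2 * (K * C) * ((p + q) * (p + q)))).
    + pose proof (hone _ w1) as o1; pose proof (hone _ w2) as o2.
      assert (p * (Rabs (v t ^ (2 * s1 - 1)) * (k * g)) <= p * (K * (C * (p + q)))) by now apply Rmult_le_compat_l.
      assert (q * (Rabs (u t ^ (2 * s2 - 1)) * (k * g)) <= q * (K * (C * (p + q)))) by now apply Rmult_le_compat_l.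
      lra.
    + replace (4 * K * C * (p ^ 2 + q ^ 2)) with (2 * (K * C) * (2 * (p ^ 2 + q ^ 2))) by ring.
      apply Rmult_le_compat_l; [|pose proof (pow2_ge_0 (p - q)); nra].
      assert (0 <= K * C) by (apply Rmult_le_pos; lra); lra.
  - rewrite e1, e2; ring. }
assert (drho : forall t, is_derive rho t (rho t ^ m * F (Cs th0) (Sn th0))).
{ intros t; destruct (hpol t) as [_ [_ [d _]]]; destruct (hray t) as [r1 r2].
  now rewrite r1, r2 in d. }
destruct (MVT_derive rho _ 0 T ltac:(lra) (fun x _ => drho x)) as [c [_ e]].
(* rho returns to its initial value, so rho' = rho^m F vanishes somewhere. On the ray F has one
   value, which is therefore 0, and rho is constant. *)
assert (hF : F (Cs th0) (Sn th0) = 0).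
{ rewrite p0, Rminus_diag in e; symmetry in e.
  apply Rmult_integral in e; destruct e as [e|e]; [|lra].
  apply Rmult_integral in e; destruct e as [e|e]; [|exact e].
  destruct (hpol c) as [q _]; pose proof (pow_lt _ m q); lra. }
apply hn; intros t; split; [|rewrite e1, e2; apply hray].
apply derive_zero_constant; intros s; eapply is_derive_value; [apply drho|].
rewrite hF; ring.
Qed.

Lemma lyapunov_continuous (t : R) : continuous Cs t /\ continuous Sn t.
Proof.
destruct hCS as [hsol _]; split.
- exact (derivable_continuous_at _ _ _ (proj1 (hsol t))).
- exact (derivable_continuous_at _ _ _ (proj2 (hsol t))).
Qed.

Lemma center_ratio_continuous (t : R) :
  continuous (fun s => F (Cs s) (Sn s) / G (Cs s) (Sn s)) t.
Proof.
destruct (lyapunov_continuous t).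
apply continuous_Rdiv; [| |apply center_angular_nonzero]; apply lipschitz_continuous; try assumption.
- now apply lipschitz_radial.
- now apply lipschitz_angular.
Qed.

Lemma center_ratio_periodic (t : R) :
  F (Cs (t + tau)) (Sn (t + tau)) / G (Cs (t + tau)) (Sn (t + tau)) = F (Cs t) (Sn t) / G (Cs t) (Sn t).
Proof. destruct htau as [_ [hper _]]; destruct (hper t) as [-> ->]; reflexivity. Qed.

(* Along a periodic orbit [rho] is a multiple of [exp (RInt (F / G) 0 theta)],
   and the angle [theta] increases by a nonzero multiple of [tau] in one turn. *)
Lemma center_mean_zero : RInt (fun s => F (Cs s) (Sn s) / G (Cs s) (Sn s)) 0 tau = 0.
Proof.
destruct (closed_orbit_through_ray 0) as [rho [u [v [T [hpol [e1 [e2 [hT [p0 [p1 [p2 _]]]]]]]]]]].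
pose proof (lyapunov_unit_level s1 s2 Cs Sn hs1 hs2 hCS) as hl.
assert (hb : forall t, Rabs (u t) <= 1 /\ Rabs (v t) <= 1).
{ intros t; apply (unit_level_bounded s1 s2 hs1 hs2), hpol. }
assert (hbC : forall t, Rabs (Cs t) <= 1 /\ Rabs (Sn t) <= 1).
{ intros t; apply (unit_level_bounded s1 s2 hs1 hs2), hl. }
(* Angular speed in the time of the orbit; [theta] is its primitive, and [lift] shows that it is an
   angle for (u, v). *)
set (kappa := fun t => rho t ^ m / rho t * G (u t) (v t)).
assert (hk : forall t, continuous kappa t).
{ intros t; destruct (hpol t) as [q0 [_ [d0 [d1 d2]]]]; apply continuous_Rmult.
  - apply continuous_Rdiv; [apply continuous_Rpow| |lra]; exact (derivable_continuous_at _ _ _ d0).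
  - apply lipschitz_continuous; [now apply lipschitz_angular| |].
    + exact (derivable_continuous_at _ _ _ d1). + exact (derivable_continuous_at _ _ _ d2). }
set (theta := (fun t => RInt kappa 0 t) : R -> R).
assert (dth : forall t, is_derive theta t (kappa t)) by (intros; now apply is_derive_primitive).
assert (th0 : theta 0 = 0) by apply (RInt_point 0 kappa).
assert (lift : forall t, u t = Cs (theta t) /\ v t = Sn (theta t)).
{ apply (lyapunov_flow_unique (2 * s1 - 1) (2 * s2 - 1) kappa u v
           (fun t => Cs (theta t)) (fun t => Sn (theta t)) 0 hk).
  - intros t; destruct (hpol t) as [_ [_ [_ d]]]; exact d.
  - intros t; destruct hCS as [hsol _]; destruct (hsol (theta t)) as [d1 d2].
    split; eapply is_derive_value; try (rewrite Rmult_comm; reflexivity);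
      apply (is_derive_Rcomp _ theta); try assumption; apply dth.
  - exact hb.
  - intros t; apply hbC.
  - now rewrite th0.
  - now rewrite th0. }
set (w := fun s => F (Cs s) (Sn s) / G (Cs s) (Sn s)).
assert (cw : forall s, continuous w s) by apply center_ratio_continuous.
(* ln rho and the integral of F / G up to theta have the same derivative in t, and rho T = rho 0. *)
assert (hreturn : RInt w 0 (theta T) = 0).
{ assert (hc : forall t, is_derive (fun t => ln (rho t) - RInt w 0 (theta t)) t 0).
  { intros t; destruct (hpol t) as [q0 [_ [d0 _]]]; eapply is_derive_value.
    - apply is_derive_Rminus.
      + apply (is_derive_Rcomp ln rho); [apply is_derive_Reals, derivable_pt_lim_ln, q0|exact d0].
      + apply (is_derive_Rcomp (fun t => RInt w 0 t) theta); [now apply is_derive_primitive|apply dth].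
    - destruct (lift t) as [l1 l2]; unfold w, kappa; rewrite l1, l2.
      field; split; [apply center_angular_nonzero|lra]. }
  pose proof (derive_zero_constant _ hc T 0) as e; cbv beta in e; rewrite p0, th0 in e.
  rewrite (RInt_point 0 w : RInt w 0 0 = 0) in e; lra. }
(* By the mean value theorem, theta T = 0 would give a zero of kappa, hence of G. *)
assert (hmove : theta T <> 0).
{ destruct (MVT_derive theta kappa 0 T ltac:(lra) (fun x _ => dth x)) as [c [_ e]].
  rewrite th0 in e; intros e'; rewrite e', Rminus_diag in e; symmetry in e.
  apply Rmult_integral in e; destruct e as [e|e]; [|lra].
  unfold kappa in e; destruct (hpol c) as [q0 _]; destruct (lift c) as [l1 l2].
  apply Rmult_integral in e; destruct e as [e|e].
  - assert (0 < rho c ^ m / rho c) by (apply Rdiv_lt_0_compat; [apply pow_lt|]; assumption); lra.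
  - rewrite l1, l2 in e; revert e; apply center_angular_nonzero. }
(* Since (u, v) returns, (Cs, Sn) has the same value at 0 and at theta T; uniqueness makes theta T a
   period. *)
assert (hperT : forall s, Cs (s + theta T) = Cs s /\ Sn (s + theta T) = Sn s).
{ destruct (lift T) as [l1 l2].
  apply (lyapunov_flow_unique (2 * s1 - 1) (2 * s2 - 1) (fun _ => 1)
           (fun s => Cs (s + theta T)) (fun s => Sn (s + theta T)) Cs Sn 0).
  - intros; apply continuous_const.
  - intros t; destruct hCS as [hsol _]; destruct (hsol (t + theta T)) as [d1 d2].
    assert (dsh : is_derive (fun s => s + theta T) t 1).
    { eapply is_derive_value.
      - apply is_derive_Rplus; [apply (is_derive_id t)|apply (is_derive_const (theta T))].
      - unfold one, zero; simpl; ring. }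
    split; eapply is_derive_value; try (rewrite Rmult_comm; reflexivity).
    + apply (is_derive_Rcomp Cs (fun s => s + theta T)); assumption.
    + apply (is_derive_Rcomp Sn (fun s => s + theta T)); assumption.
  - intros t; destruct hCS as [hsol _]; rewrite !Rmult_1_r; apply hsol.
  - intros t; apply hbC.
  - exact hbC.
  - rewrite Rplus_0_l; congruence.
  - rewrite Rplus_0_l; congruence. }
destruct htau as [htau0 [hper hleast]].
set (I := (fun s => RInt w 0 s) : R -> R).
assert (hshift : forall s, I (s + tau) = I s + I tau).
{ intros s; unfold I; rewrite <- (RInt_Chasles_everywhere w 0 s (s + tau) cw).
  rewrite (RInt_over_period w tau s cw center_ratio_periodic); reflexivity. }
assert (hnat : forall k s, I (s + INR k * tau) = I s + INR k * I tau
                 /\ Cs (s + INR k * tau) = Cs s /\ Sn (s + INR k * tau) = Sn s).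
{ induction k as [|k IH]; intros s.
  - simpl; rewrite !Rmult_0_l, !Rplus_0_r; auto.
  - rewrite S_INR; replace (s + (INR k + 1) * tau) with ((s + INR k * tau) + tau) by ring.
    destruct (IH s) as [h1 [h2 h3]], (hper (s + INR k * tau)) as [h4 h5].
    rewrite hshift, h1; repeat split; [ring|congruence|congruence]. }
assert (hZ : forall k s, I (s + IZR k * tau) = I s + IZR k * I tau
                 /\ Cs (s + IZR k * tau) = Cs s /\ Sn (s + IZR k * tau) = Sn s).
{ intros k s; destruct (Z_le_dec 0 k) as [hk0|hk0].
  - rewrite <- (Z2Nat.id k) by assumption; rewrite <- INR_IZR_INZ; apply hnat.
  - destruct (hnat (Z.to_nat (- k)) (s + IZR k * tau)) as [h1 h2].
    rewrite INR_IZR_INZ, Z2Nat.id, opp_IZR in h1, h2 by lia.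
    replace (s + IZR k * tau + - IZR k * tau) with s in h1, h2 by ring.
    split; [lra|]; destruct h2; split; congruence. }
destruct (Req_dec (I tau) 0) as [|hI]; [assumption|exfalso].
(* [theta T] is an integer multiple of the least period. *)
destruct (archimed (theta T / tau)) as [a1 a2].
(* The floor of theta T / tau. The remainder would be a period smaller than tau if it were positive,
   so it is zero; then 0 = I (theta T) = k I(tau), and k is nonzero because theta T is. *)
set (k := (up (theta T / tau) - 1)%Z).
assert (hk1 : 0 <= theta T - IZR k * tau < tau).
{ unfold k; rewrite minus_IZR; set (z := IZR (up (theta T / tau))) in *.
  assert (ez : theta T = theta T / tau * tau) by (field; lra).
  set (q := theta T / tau) in *; nra. }
destruct (Rle_lt_or_eq_dec 0 (theta T - IZR k * tau)) as [hlt|heq]; [lra| |].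
- apply (hleast (theta T - IZR k * tau) (conj hlt (proj2 hk1))); intros s.
  replace (s + (theta T - IZR k * tau)) with ((s + theta T) + IZR (- k) * tau)
    by (rewrite opp_IZR; ring).
  destruct (hZ (- k)%Z (s + theta T)) as [_ [h2 h3]], (hperT s); split; congruence.
- destruct (hZ k 0) as [h1 _]; rewrite Rplus_0_l in h1.
  replace (IZR k * tau) with (theta T) in h1 by lra.
  unfold I at 1 2 in h1; rewrite hreturn, (RInt_point 0 w : RInt w 0 0 = 0), Rplus_0_l in h1.
  symmetry in h1; apply Rmult_integral in h1; destruct h1 as [h1|h1]; [|easy].
  rewrite h1 in heq; lra.
Qed.

End Center.

(** * The normal form *)

Lemma continuous_family_bounded (L : list Z) (u : Z -> R -> R) (a b : R) :
  (forall j x, In j L -> a <= x <= b -> continuous (u j) x) ->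
  exists C, 0 < C /\ forall j x, In j L -> a <= x <= b -> Rabs (u j x) <= C.
Proof.
intros hu; induction L as [|z L IH].
- exists 1; split; [lra|easy].
- destruct (bounded_on_segment (u z) a b) as [D [hD h']]; [intros; apply hu; [now left|assumption]|].
  destruct IH as [C [hC h]]; [intros; apply hu; [now right|assumption]|].
  exists (C + D); split; [lra|]; intros j x [<-|hj] hx.
  + specialize (h' x hx); lra.
  + specialize (h j x hj hx); lra.
Qed.

(** Quantitative form of a positive radius of convergence, which adds up over finite sums and passes
    to bounds uniform in theta. *)
Definition geometric (c : nat -> R) : Prop :=
  exists C K, 0 < C /\ 0 < K /\ forall i, Rabs (c i) <= C * K ^ i.

Lemma geometric_plus (c c' : nat -> R) :
  geometric c -> geometric c' -> geometric (fun i => c i + c' i).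
Proof.
intros [C [K [hC [hK h]]]] [C' [K' [hC' [hK' h']]]].
exists (C + C'), (K + K'); repeat split; try lra; intros i.
eapply Rle_trans; [apply Rabs_triang|]; rewrite Rmult_plus_distr_r.
specialize (h i); specialize (h' i).
assert (K ^ i <= (K + K') ^ i) by (apply pow_incr; lra).
assert (K' ^ i <= (K + K') ^ i) by (apply pow_incr; lra).
apply Rplus_le_compat; eapply Rle_trans; try eassumption; apply Rmult_le_compat_l; lra.
Qed.

Lemma geometric_sum (c : nat -> nat -> R) (N : nat) :
  (forall a, (a <= N)%nat -> geometric (fun i => c i a)) ->
  geometric (fun i => sum_f_R0 (c i) N).
Proof.
induction N as [|N IH]; intros h; simpl; [now apply h|].
apply (geometric_plus (fun i => sum_f_R0 (c i) N)); [|now apply h].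
apply IH; intros; apply h; lia.
Qed.

(** The radius is the least upper bound of the r for which c_k r^k is bounded. Some r > 0 is among
    them, otherwise 0 would be an upper bound; then K = 1 / r. *)
Lemma geometric_of_radius (c : nat -> R) : Rbar_lt 0 (CV_radius c) -> geometric (fun i => Rabs (c i)).
Proof.
intros hc; destruct (CV_radius_bounded c) as [_ hleast].
destruct (Classical_Prop.classic (exists r, 0 < r /\ exists M, forall k, Rabs (c k * r ^ k) <= M))
  as [[r [hr [M hM]]]|hno].
- exists (Rabs M + 1), (/ r); split; [pose proof (Rabs_pos M); lra|].
  split; [now apply Rinv_0_lt_compat|]; intros i; rewrite Rabs_Rabsolu.
  specialize (hM i); rewrite Rabs_mult, (Rabs_pos_eq (r ^ i)) in hM by (apply pow_le; lra).
  assert (0 < r ^ i) by now apply pow_lt.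
  rewrite pow_inv; apply (Rmult_le_reg_r (r ^ i)); [assumption|].
  rewrite Rmult_assoc, Rinv_l, Rmult_1_r by lra; pose proof (Rle_abs M); lra.
- exfalso; apply (Rbar_lt_not_le _ _ hc), hleast.
  intros r hr; simpl; apply Rnot_lt_le; intros hlt; apply hno; now exists r.
Qed.

Lemma geometric_ex_series (c : nat -> R) (C K eps : R) :
  (forall i, Rabs (c (S i)) <= C * K ^ S i) -> 0 <= K -> K * Rabs eps < 1 ->
  ex_series (fun i => eps ^ S i * c (S i)).
Proof.
intros hc hK he.
apply (ex_series_le (fun i => eps ^ S i * c (S i)) (fun i => C * (K * Rabs eps) * (K * Rabs eps) ^ i)).
- intros i; change (Rabs (eps ^ S i * c (S i)) <= C * (K * Rabs eps) * (K * Rabs eps) ^ i).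
  rewrite Rabs_mult, <- RPow_abs.
  replace (C * (K * Rabs eps) * (K * Rabs eps) ^ i) with (Rabs eps ^ S i * (C * K ^ S i))
    by (rewrite Rpow_mult_distr; simpl; ring).
  apply Rmult_le_compat_l; [apply pow_le, Rabs_pos|apply hc].
- apply (ex_series_scal (C * (K * Rabs eps)) (fun i => (K * Rabs eps) ^ i)), ex_series_geom.
  rewrite Rabs_pos_eq; [exact he|]; apply Rmult_le_pos; [exact hK|apply Rabs_pos].
Qed.

(** Taking a quasi-homogeneous part does not increase it, so it bounds all parts of a polynomial at
    once, whatever the weight. *)
Definition coeff_norm (n : nat) (c : nat -> nat -> R) : R :=
  sum_f_R0 (fun a => sum_f_R0 (fun b => Rabs (c a b)) (n - a)) n.

Lemma coeff_norm_geometric (n : nat) (c : nat -> nat -> nat -> R) :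
  (forall a b, (a + b <= n)%nat -> Rbar_lt 0 (CV_radius (fun i => c i a b))) ->
  geometric (fun i => coeff_norm n (c i)).
Proof.
intros hc; unfold coeff_norm.
apply (geometric_sum (fun i a => sum_f_R0 (fun b => Rabs (c i a b)) (n - a))); intros a ha.
apply (geometric_sum (fun i b => Rabs (c i a b))); intros b hb.
apply (geometric_of_radius (fun i => c i a b)), hc; lia.
Qed.

Lemma coeff_norm_nonneg (n : nat) (c : nat -> nat -> R) : 0 <= coeff_norm n c.
Proof. apply cond_pos_sum; intros a; apply cond_pos_sum; intros b; apply Rabs_pos. Qed.

Lemma sum_abs_le (u v : nat -> R) (N : nat) :
  (forall a, (a <= N)%nat -> Rabs (u a) <= v a) -> Rabs (sum_f_R0 u N) <= sum_f_R0 v N.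
Proof.
induction N as [|N IH]; intros h; simpl; [now apply h|].
eapply Rle_trans; [apply Rabs_triang|apply Rplus_le_compat]; [|now apply h].
apply IH; intros; apply h; lia.
Qed.

Lemma coeff_norm_qh_part (n s1 s2 : nat) (k : Z) (c : nat -> nat -> R) :
  coeff_norm n (qh_part s1 s2 k c) <= coeff_norm n c.
Proof.
apply sum_Rle; intros a _; apply sum_Rle; intros b _; unfold qh_part.
destruct Z.eq_dec; [lra|rewrite Rabs_R0; apply Rabs_pos].
Qed.

Lemma eval2_bound (n : nat) (c : nat -> nat -> R) (x y N : R) :
  1 <= N -> Rabs x <= N -> Rabs y <= N -> Rabs (eval2 n c x y) <= N ^ n * coeff_norm n c.
Proof.
intros hN hx hy; unfold eval2, coeff_norm; rewrite scal_sum.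
apply sum_abs_le; intros a ha; rewrite Rmult_comm, scal_sum.
apply sum_abs_le; intros b hb; rewrite !Rabs_mult, <- !RPow_abs, Rmult_assoc.
apply Rmult_le_compat_l; [apply Rabs_pos|].
apply (Rle_trans _ (N ^ a * N ^ b)).
- apply Rmult_le_compat; try (apply pow_le, Rabs_pos);
    apply pow_incr; split; try assumption; apply Rabs_pos.
- rewrite <- pow_add; apply Rle_pow; [exact hN|lia].
Qed.

Lemma sumZ_sum_f_R0 (L : list Z) (u : Z -> nat -> R) (N : nat) :
  sumZ L (fun j => sum_f_R0 (u j) N) = sum_f_R0 (fun a => sumZ L (fun j => u j a)) N.
Proof.
induction N as [|N IH]; simpl; [reflexivity|].
now rewrite sumZ_plus, IH.
Qed.

(** The monomial x^a y^b has the single weight a s1 + b s2, so it occurs for the single index j = a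
    s1 + b s2 + e - W. The shift e is s2 for P and s1 for Q, which gives P_(i,J) and Q_(i,J) with J
    = j + W. *)
Lemma eval2_weight_decomposition (n s1 s2 : nat) (c : nat -> nat -> R) (L : list Z) (W e : Z) (r u v : R) :
  0 < r -> NoDup L ->
  (forall a b, (a + b <= n)%nat -> In (Z.of_nat (a * s1 + b * s2) + e - W)%Z L) ->
  eval2 n c (r ^ s1 * u) (r ^ s2 * v)
  = sumZ L (fun j => powerRZ r (j + W - e) * eval2 n (qh_part s1 s2 (j + W - e) c) u v).
Proof.
intros hr hd hL; unfold eval2.
rewrite (sumZ_ext L _ (fun j => sum_f_R0 (fun a => sum_f_R0 (fun b =>
   qh_part s1 s2 (j + W - e) c a b * u ^ a * v ^ b * powerRZ r (j + W - e)) (n - a)) n)).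
2:{ intros j _; rewrite scal_sum; apply sum_eq; intros a _.
    rewrite Rmult_comm; apply scal_sum. }
rewrite (sumZ_sum_f_R0 L (fun j a => sum_f_R0 (fun b =>
   qh_part s1 s2 (j + W - e) c a b * u ^ a * v ^ b * powerRZ r (j + W - e)) (n - a))).
apply sum_eq; intros a ha.
rewrite (sumZ_sum_f_R0 L (fun j b =>
   qh_part s1 s2 (j + W - e) c a b * u ^ a * v ^ b * powerRZ r (j + W - e))).
apply sum_eq; intros b hb.
set (z0 := (Z.of_nat (a * s1 + b * s2) + e - W)%Z).
rewrite (sumZ_ext L _ (fun j => if Z.eq_dec z0 j then c a b * u ^ a * v ^ b * powerRZ r (j + W - e) else 0)).
- rewrite (sumZ_indicator L z0 (fun j => c a b * u ^ a * v ^ b * powerRZ r (j + W - e))); [|exact hd|apply hL; lia].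
  replace (z0 + W - e)%Z with (Z.of_nat (s1 * a + s2 * b)) by (unfold z0; lia).
  rewrite <- pow_powerRZ, pow_add, !Rpow_mult_distr, !pow_mult; ring.
- intros j _; unfold qh_part.
  destruct (Z.eq_dec z0 j) as [e1|e1], (Z.eq_dec (Z.of_nat (a * s1 + b * s2)) (j + W - e)) as [e2|e2];
    unfold z0 in e1; try lia; ring.
Qed.

Lemma perturbed_combination (a b : nat -> R -> R -> R) (a0 b0 : R -> R -> R) (eps x y z w : R) :
  ex_series (fun i => eps ^ S i * a (S i) x y) -> ex_series (fun i => eps ^ S i * b (S i) x y) ->
  perturbed a0 a eps x y * z - perturbed b0 b eps x y * w
  = (a0 x y * z - b0 x y * w) + Series (fun i => eps ^ S i * (a (S i) x y * z - b (S i) x y * w)).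
Proof.
intros ha hb; unfold perturbed.
rewrite (Series_ext (fun i => eps ^ S i * (a (S i) x y * z - b (S i) x y * w))
  (fun i => (eps ^ S i * a (S i) x y) * z - (eps ^ S i * b (S i) x y) * w))
  by (intros; ring).
rewrite Series_minus by (now apply ex_series_scal_r).
rewrite !Series_scal_r; ring.
Qed.

Section NormalForm.

Context (s1 s2 m d n : nat) (P Q : nat -> nat -> R) (p q : nat -> nat -> nat -> R).
Context (Cs Sn : R -> R) (tau : R).
Context (hs1 : (1 <= s1)%nat) (hs2 : (1 <= s2)%nat).
Context (hqh : quasi_homogeneous s1 s2 m (eval2 d P) (eval2 d Q)).
Context (hcenter : is_center (eval2 d P) (eval2 d Q)).
Context (hconv : forall a b, (a + b <= n)%nat ->
     Rbar_lt 0 (CV_radius (fun i => p i a b)) /\ Rbar_lt 0 (CV_radius (fun i => q i a b))).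
Context (hCS : is_lyapunov s1 s2 Cs Sn) (htau : is_least_period Cs Sn tau).

(** This definition and the next ones unfold to the local definitions of the theorem, so the results
    of the section apply there by conversion. *)
Definition ratio_exp (th : R) : R :=
  exp (RInt (fun s => polF s1 s2 Cs Sn (eval2 d P) (eval2 d Q) s
                      / polG s1 s2 Cs Sn (eval2 d P) (eval2 d Q) s) 0 th).

Definition part_P (i : nat) (J : Z) : R -> R -> R :=
  eval2 n (qh_part s1 s2 (J - Z.of_nat s2) (p i)).

Definition part_Q (i : nat) (J : Z) : R -> R -> R :=
  eval2 n (qh_part s1 s2 (J - Z.of_nat s1) (q i)).

Definition part_F (i : nat) (J : Z) : R -> R := polF s1 s2 Cs Sn (part_P i J) (part_Q i J).

Definition part_G (i : nat) (J : Z) : R -> R := polG s1 s2 Cs Sn (part_P i J) (part_Q i J).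

Definition form_f (i : nat) (j : Z) (th : R) : R :=
  powerRZ (ratio_exp th) j *
  ((part_F i (j + weightW s1 s2 m) th * polG s1 s2 Cs Sn (eval2 d P) (eval2 d Q) th
    - part_G i (j + weightW s1 s2 m) th * polF s1 s2 Cs Sn (eval2 d P) (eval2 d Q) th)
   / polG s1 s2 Cs Sn (eval2 d P) (eval2 d Q) th ^ 2).

Definition form_g (i : nat) (j : Z) (th : R) : R :=
  powerRZ (ratio_exp th) j *
  (part_G i (j + weightW s1 s2 m) th / polG s1 s2 Cs Sn (eval2 d P) (eval2 d Q) th).

Let F := polF s1 s2 Cs Sn (eval2 d P) (eval2 d Q).
Let G := polG s1 s2 Cs Sn (eval2 d P) (eval2 d Q).
Let H := ratio_exp.
Let W := weightW s1 s2 m.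
Let S1 := Sset s1 s2 m n 1.

Lemma G_nonzero (th : R) : G th <> 0.
Proof.
exact (center_angular_nonzero s1 s2 m _ _ Cs Sn hs1 hs2 (lipschitz_eval2 d P)
         (lipschitz_eval2 d Q) hqh hcenter hCS th).
Qed.

Lemma ratio_continuous (th : R) : continuous (fun s => F s / G s) th.
Proof.
exact (center_ratio_continuous s1 s2 m _ _ Cs Sn hs1 hs2 (lipschitz_eval2 d P)
         (lipschitz_eval2 d Q) hqh hcenter hCS th).
Qed.

Lemma polF_continuous (A B : R -> R -> R) (th : R) :
  locally_lipschitz A -> locally_lipschitz B -> continuous (polF s1 s2 Cs Sn A B) th.
Proof.
intros hA hB; destruct (lyapunov_continuous s1 s2 Cs Sn hCS th).
exact (lipschitz_continuous _ Cs Sn th (lipschitz_radial s1 s2 A B hA hB) H0 H1).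
Qed.

Lemma polG_continuous (A B : R -> R -> R) (th : R) :
  locally_lipschitz A -> locally_lipschitz B -> continuous (polG s1 s2 Cs Sn A B) th.
Proof.
intros hA hB; destruct (lyapunov_continuous s1 s2 Cs Sn hCS th).
exact (lipschitz_continuous _ Cs Sn th (lipschitz_angular s1 s2 A B hA hB) H0 H1).
Qed.

Lemma ratio_exp_pos (th : R) : 0 < H th.
Proof. apply exp_pos. Qed.

Lemma ratio_exp_derive (th : R) : is_derive H th (H th * (F th / G th)).
Proof.
eapply is_derive_value.
- apply (is_derive_Rcomp exp (fun th => RInt (fun s => F s / G s) 0 th)); [apply is_derive_exp|].
  apply is_derive_primitive, ratio_continuous.
- apply Rmult_comm.
Qed.

Lemma polF_periodic (A B : R -> R -> R) (th : R) :
  polF s1 s2 Cs Sn A B (th + tau) = polF s1 s2 Cs Sn A B th.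
Proof. unfold polF; destruct htau as [_ [hper _]]; destruct (hper th) as [-> ->]; reflexivity. Qed.

Lemma polG_periodic (A B : R -> R -> R) (th : R) :
  polG s1 s2 Cs Sn A B (th + tau) = polG s1 s2 Cs Sn A B th.
Proof. unfold polG; destruct htau as [_ [hper _]]; destruct (hper th) as [-> ->]; reflexivity. Qed.

(** Over a period the exponent increases by the integral that [center_mean_zero] shows to vanish. *)
Lemma ratio_exp_periodic (th : R) : H (th + tau) = H th.
Proof.
unfold H, ratio_exp; f_equal.
set (w := fun s : R => F s / G s).
change (RInt w 0 (th + tau) = RInt w 0 th).
rewrite <- (RInt_Chasles_everywhere w 0 th (th + tau) ratio_continuous).
rewrite (RInt_over_period w tau th ratio_continuous).
- rewrite (center_mean_zero s1 s2 m _ _ Cs Sn tau hs1 hs2 (lipschitz_eval2 d P)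
    (lipschitz_eval2 d Q) hqh hcenter hCS htau : RInt w 0 tau = 0).
  apply Rplus_0_r.
- intros x; unfold w, F, G; now rewrite polF_periodic, polG_periodic.
Qed.

Lemma form_coefficients_continuous (i : nat) (j : Z) (th : R) :
  continuous (form_f i j) th /\ continuous (form_g i j) th.
Proof.
assert (cH : continuous (fun th => powerRZ (H th) j) th).
{ apply continuous_powerRZ; [apply ratio_exp_pos|].
  exact (derivable_continuous_at _ _ _ (ratio_exp_derive th)). }
assert (cF : continuous F th) by (apply polF_continuous; apply lipschitz_eval2).
assert (cG : continuous G th) by (apply polG_continuous; apply lipschitz_eval2).
assert (cF' : continuous (part_F i (j + W)) th) by (apply polF_continuous; apply lipschitz_eval2).
assert (cG' : continuous (part_G i (j + W)) th) by (apply polG_continuous; apply lipschitz_eval2).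
pose proof (G_nonzero th); split; apply continuous_Rmult; try exact cH; apply continuous_Rdiv; try assumption.
- apply continuous_Rplus; [|apply continuous_Ropp]; now apply continuous_Rmult.
- now apply (continuous_Rpow G).
- now apply pow_nonzero.
Qed.

Lemma form_coefficients_periodic (i : nat) (j : Z) (th : R) :
  form_f i j (th + tau) = form_f i j th /\ form_g i j (th + tau) = form_g i j th.
Proof.
pose proof (ratio_exp_periodic th) as e; unfold H in e.
unfold form_f, form_g, part_F, part_G; rewrite e, !polF_periodic, !polG_periodic; auto.
Qed.

(** Only the parts of p_i and q_i depend on i, and coefficient norms bound them. The other factors,
    H^j / G and H^j F / G^2, are finitely many continuous functions on [0, tau]. *)
Lemma form_coefficients_geometric :
  exists C K, 0 < C /\ 0 < K /\ forall i j th, In j S1 -> 0 <= th <= tau ->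
    Rabs (form_f i j th) <= C * K ^ i /\ Rabs (form_g i j th) <= C * K ^ i.
Proof.
assert (hgeo : geometric (fun i => coeff_norm n (p i) + coeff_norm n (q i))).
{ apply geometric_plus; apply coeff_norm_geometric; intros; now apply hconv. }
destruct hgeo as [C [K [hC [hK hb]]]].
set (M := INR s1 + INR s2).
assert (hM1 : 0 < INR s1) by (apply lt_0_INR; lia); assert (hM2 : 0 < INR s2) by (apply lt_0_INR; lia).
(* On the unit level |Cs| and |Sn| are at most 1, so a polynomial is bounded there by the sum of the
   absolute values of its coefficients. *)
assert (part : forall i J th, Rabs (part_F i J th) <= C * K ^ i /\ Rabs (part_G i J th) <= M * (C * K ^ i)).
{ intros i J th; specialize (hb i).
  pose proof (coeff_norm_nonneg n (p i)); pose proof (coeff_norm_nonneg n (q i)).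
  rewrite Rabs_pos_eq in hb by lra.
  pose proof (unit_level_bounded s1 s2 hs1 hs2 _ _ (lyapunov_unit_level s1 s2 Cs Sn hs1 hs2 hCS th)) as [bc bs].
  assert (bP : Rabs (part_P i J (Cs th) (Sn th)) <= coeff_norm n (p i)).
  { eapply Rle_trans; [apply (eval2_bound _ _ _ _ 1); try assumption; lra|].
    rewrite pow1, Rmult_1_l; apply coeff_norm_qh_part. }
  assert (bQ : Rabs (part_Q i J (Cs th) (Sn th)) <= coeff_norm n (q i)).
  { eapply Rle_trans; [apply (eval2_bound _ _ _ _ 1); try assumption; lra|].
    rewrite pow1, Rmult_1_l; apply coeff_norm_qh_part. }
  assert (pw : forall z k, Rabs z <= 1 -> Rabs (z ^ k) <= 1).
  { intros z k hz; rewrite <- RPow_abs, <- (pow1 k); apply pow_incr; split; [apply Rabs_pos|exact hz]. }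
  assert (mul : forall z y b, Rabs z <= 1 -> Rabs y <= b -> Rabs (z * y) <= b).
  { intros z y b hz hy; rewrite Rabs_mult, <- (Rmult_1_l b).
    apply Rmult_le_compat; try assumption; apply Rabs_pos. }
  unfold part_F, part_G, polF, polG; split.
  - eapply Rle_trans; [apply Rabs_triang|].
    pose proof (mul _ _ _ (pw _ (2 * s2 - 1)%nat bc) bP); pose proof (mul _ _ _ (pw _ (2 * s1 - 1)%nat bs) bQ).
    lra.
  - unfold Rminus; eapply Rle_trans; [apply Rabs_triang|]; rewrite Rabs_Ropp, !Rmult_assoc.
    rewrite (Rabs_mult (INR s1)), (Rabs_mult (INR s2)), !(Rabs_pos_eq (INR _)) by lra.
    pose proof (mul _ _ _ bc bQ) as u1; pose proof (mul _ _ _ bs bP) as u2.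
    assert (0 <= C * K ^ i) by lra.
    assert (INR s1 * Rabs (Cs th * part_Q i J (Cs th) (Sn th)) <= INR s1 * (C * K ^ i))
      by (apply Rmult_le_compat_l; lra).
    assert (INR s2 * Rabs (Sn th * part_P i J (Cs th) (Sn th)) <= INR s2 * (C * K ^ i))
      by (apply Rmult_le_compat_l; lra).
    unfold M; lra. }
assert (cH : forall j th, continuous (fun th => powerRZ (H th) j) th).
{ intros j th; apply continuous_powerRZ; [apply ratio_exp_pos|].
  exact (derivable_continuous_at _ _ _ (ratio_exp_derive th)). }
assert (cF : forall th, continuous F th) by (intros; apply polF_continuous; apply lipschitz_eval2).
assert (cG : forall th, continuous G th) by (intros; apply polG_continuous; apply lipschitz_eval2).
destruct (continuous_family_bounded S1 (fun j th => powerRZ (H th) j / G th) 0 tau) as [A [hA bA]].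
{ intros; apply continuous_Rdiv; auto; apply G_nonzero. }
destruct (continuous_family_bounded S1 (fun j th => powerRZ (H th) j / G th * (F th / G th)) 0 tau) as [B [hB bB]].
{ intros; apply continuous_Rmult; [|apply ratio_continuous]; apply continuous_Rdiv; auto; apply G_nonzero. }
assert (hMp : 0 < M) by (unfold M; lra).
(* A C and B M C come from the two terms of f, A M C from the single term of g. *)
exists ((A + B * M + A * M) * C), K; split; [|split; [exact hK|]].
{ apply Rmult_lt_0_compat; [|exact hC].
  assert (0 < B * M) by now apply Rmult_lt_0_compat.
  assert (0 < A * M) by now apply Rmult_lt_0_compat. lra. }
intros i j th hj hth; destruct (part i (j + W)%Z th) as [b1 b2].
specialize (bA j th hj hth); specialize (bB j th hj hth); simpl in bA, bB.
assert (hCK : 0 <= C * K ^ i) by (apply Rmult_le_pos; [lra|apply pow_le; lra]).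
assert (0 <= A * (C * K ^ i)) by (apply Rmult_le_pos; lra).
assert (0 <= A * M * (C * K ^ i)) by (apply Rmult_le_pos; [apply Rmult_le_pos|]; lra).
assert (0 <= B * M * (C * K ^ i)) by (apply Rmult_le_pos; [apply Rmult_le_pos|]; lra).
pose proof (G_nonzero th) as hG.
assert (b3 : Rabs (powerRZ (H th) j / G th * part_F i (j + W) th) <= A * (C * K ^ i)).
{ rewrite Rabs_mult; apply Rmult_le_compat; try assumption; apply Rabs_pos. }
assert (b4 : Rabs (powerRZ (H th) j / G th * part_G i (j + W) th) <= A * (M * (C * K ^ i))).
{ rewrite Rabs_mult; apply Rmult_le_compat; try assumption; apply Rabs_pos. }
assert (b5 : Rabs (powerRZ (H th) j / G th * (F th / G th) * part_G i (j + W) th) <= B * (M * (C * K ^ i))).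
{ rewrite Rabs_mult; apply Rmult_le_compat; try assumption; apply Rabs_pos. }
split.
- replace (form_f i j th) with (powerRZ (H th) j / G th * part_F i (j + W) th
     - powerRZ (H th) j / G th * (F th / G th) * part_G i (j + W) th).
  + unfold Rminus; eapply Rle_trans; [apply Rabs_triang|]; rewrite Rabs_Ropp; lra.
  + unfold form_f; fold F G H W; field; exact hG.
- replace (form_g i j th) with (powerRZ (H th) j / G th * part_G i (j + W) th).
  + lra.
  + unfold form_g; fold F G H W; field; exact hG.
Qed.

(** Origin of n + 1 in the index set: dx and dy carry the weight of one more factor x or y, so a
    monomial of degree at most n counts as one of degree between 1 and n + 1, with l = 1. *)
Lemma part_exponent_in_S1 (a b : nat) :
  (a + b <= n)%nat ->
  In (Z.of_nat (a * s1 + b * s2) + Z.of_nat s1 - W)%Z S1 /\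
  In (Z.of_nat (a * s1 + b * s2) + Z.of_nat s2 - W)%Z S1.
Proof.
intros hab; split; apply Sset_spec.
- exists (S a), b, 1%nat; repeat split; try lia; unfold W; nia.
- exists a, (S b), 1%nat; repeat split; try lia; unfold W; nia.
Qed.

Let X r th := (r * H th) ^ s1 * Cs th.
Let Y r th := (r * H th) ^ s2 * Sn th.
Let w i := sform S1 (form_g i) (form_f i).

(* [A] and [B] stand for the values at [(Cs th, Sn th)] of quasi-homogeneous
   polynomials of weight degrees [j + W - s2] and [j + W - s1]. *)
Lemma part_dr (j : Z) (A B r th : R) :
  0 < r ->
  powerRZ (r * H th) (j + W - Z.of_nat s1) * B * (INR s1 * H th * (r * H th) ^ (s1 - 1) * Cs th)
  - powerRZ (r * H th) (j + W - Z.of_nat s2) * A * (INR s2 * H th * (r * H th) ^ (s2 - 1) * Sn th)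
  = H th * powerRZ (r * H th) (j + W - 1) * (INR s1 * Cs th * B - INR s2 * Sn th * A).
Proof.
intros hr; assert (hrho : 0 < r * H th) by (apply Rmult_lt_0_compat; [exact hr|apply ratio_exp_pos]).
assert (e : forall s, (1 <= s)%nat -> powerRZ (r * H th) (j + W - 1)
   = (r * H th) ^ (s - 1) * powerRZ (r * H th) (j + W - Z.of_nat s)).
{ intros s hs; rewrite powerRZ_pow by exact hrho; f_equal; lia. }
rewrite Rmult_minus_distr_l; f_equal; [rewrite (e s1 hs1)|rewrite (e s2 hs2)]; ring.
Qed.

(** Since H' = H F / G, the change of radius due to theta is r F / G times the change due to r, to
    which [part_dr] applies; what is left comes from the derivatives of Cs and Sn. *)
Lemma part_dth (j : Z) (A B r th : R) :
  0 < r ->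
  powerRZ (r * H th) (j + W - Z.of_nat s1) * B
    * (INR s1 * (r * (H th * (F th / G th))) * (r * H th) ^ (s1 - 1) * Cs th
       + (r * H th) ^ s1 * - Sn th ^ (2 * s1 - 1))
  - powerRZ (r * H th) (j + W - Z.of_nat s2) * A
    * (INR s2 * (r * (H th * (F th / G th))) * (r * H th) ^ (s2 - 1) * Sn th
       + (r * H th) ^ s2 * Cs th ^ (2 * s2 - 1))
  = powerRZ (r * H th) (j + W) * (F th / G th * (INR s1 * Cs th * B - INR s2 * Sn th * A)
       - (Cs th ^ (2 * s2 - 1) * A + Sn th ^ (2 * s1 - 1) * B)).
Proof.
intros hr; assert (hrho : 0 < r * H th) by (apply Rmult_lt_0_compat; [exact hr|apply ratio_exp_pos]).
assert (e : forall s, powerRZ (r * H th) (j + W)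
   = (r * H th) ^ s * powerRZ (r * H th) (j + W - Z.of_nat s)).
{ intros s; rewrite powerRZ_pow by exact hrho; f_equal; lia. }
assert (e' : powerRZ (r * H th) (j + W) = r * H th * powerRZ (r * H th) (j + W - 1)).
{ rewrite (e 1%nat), pow_1; reflexivity. }
transitivity (r * (F th / G th) * (H th * powerRZ (r * H th) (j + W - 1) * (INR s1 * Cs th * B - INR s2 * Sn th * A))
  - (powerRZ (r * H th) (j + W) * (Sn th ^ (2 * s1 - 1) * B) + powerRZ (r * H th) (j + W) * (Cs th ^ (2 * s2 - 1) * A))).
- rewrite <- (part_dr j A B r th hr); rewrite (e s1) at 1; rewrite (e s2); ring.
- rewrite e'; ring.
Qed.

Lemma normal_form :
  exists K : R -> R -> R,
    (forall r th, 0 < r -> K r th <> 0) /\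
    exists eps0, 0 < eps0 /\ forall eps, Rabs eps < eps0 ->
      form_eq (pullback X Y (perturbed (eval2 d P) (fun i => eval2 n (p i)) eps)
                            (perturbed (eval2 d Q) (fun i => eval2 n (q i)) eps))
              (form_scal K (form_family w eps)).
Proof.
(* The dr-coefficient of the pull-back of omega_0, by which the whole form is divided. *)
exists (fun r th => H th * powerRZ (r * H th) (W - 1) * G th); split.
{ intros r th hr; pose proof (ratio_exp_pos th).
  apply Rmult_integral_contrapositive; split; [|apply G_nonzero].
  apply Rmult_integral_contrapositive; split; [lra|apply powerRZ_NOR].
  apply Rmult_integral_contrapositive; lra. }
assert (hgeo : geometric (fun i => coeff_norm n (p i) + coeff_norm n (q i))).
{ apply geometric_plus; apply coeff_norm_geometric; intros; now apply hconv. }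
destruct hgeo as [C [K [hC [hK hb]]]].
(* For |eps| < 1 / K the perturbation series converge at every point (x, y), which affects only the
   constant in front of K^i. *)
exists (/ K); split; [now apply Rinv_0_lt_compat|]; intros eps heps.
assert (hKe : K * Rabs eps < 1).
{ apply (Rmult_lt_compat_l K) in heps; [|exact hK]; rewrite Rinv_r in heps; lra. }
assert (hex : forall x y, ex_series (fun i => eps ^ S i * eval2 n (p (S i)) x y) /\
                          ex_series (fun i => eps ^ S i * eval2 n (q (S i)) x y)).
{ intros x y; set (N := 1 + Rabs x + Rabs y).
  pose proof (Rabs_pos x); pose proof (Rabs_pos y).
  assert (hN : 0 <= N ^ n) by (apply pow_le; unfold N; lra).
  split; [apply (geometric_ex_series (fun i => eval2 n (p i) x y) (N ^ n * C) K)
         |apply (geometric_ex_series (fun i => eval2 n (q i) x y) (N ^ n * C) K)]; try lra;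
    intros i; specialize (hb (S i));
    pose proof (coeff_norm_nonneg n (p (S i))); pose proof (coeff_norm_nonneg n (q (S i)));
    rewrite Rabs_pos_eq in hb by lra;
    (eapply Rle_trans; [apply (eval2_bound _ _ _ _ N); unfold N; lra|]);
    rewrite Rmult_assoc; apply Rmult_le_compat_l; lra. }
intros r th hr; set (rho := r * H th).
assert (hH : 0 < H th) by apply ratio_exp_pos.
assert (hrho : 0 < rho) by (apply Rmult_lt_0_compat; assumption).
pose proof (G_nonzero th) as hG.
assert (erho : forall j, powerRZ rho j = powerRZ r j * powerRZ (H th) j) by (intros; apply powerRZ_mult).
assert (eX : X r th = rho ^ s1 * Cs th) by reflexivity; assert (eY : Y r th = rho ^ s2 * Sn th) by reflexivity.
assert (dr : forall s c, is_derive (fun r => (r * H th) ^ s * c) r (INR s * H th * rho ^ (s - 1) * c)).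
{ intros s c; eapply is_derive_value.
  - apply (is_derive_Rmult (fun r => (r * H th) ^ s) (fun _ => c)); [|apply (is_derive_const c)].
    apply is_derive_Rpow, (is_derive_Rmult (fun r => r) (fun _ => H th));
      [apply (is_derive_id r)|apply (is_derive_const (H th))].
  - unfold one, zero, rho; simpl; ring. }
assert (dth : forall s z z', is_derive z th z' -> is_derive (fun th => (r * H th) ^ s * z th) th
   (INR s * (r * (H th * (F th / G th))) * rho ^ (s - 1) * z th + rho ^ s * z')).
{ intros s z z' hz; eapply is_derive_value.
  - apply is_derive_Rmult; [|exact hz]; apply is_derive_Rpow, is_derive_Rscal, ratio_exp_derive.
  - unfold rho; ring. }
destruct hCS as [hsol _]; destruct (hsol th) as [dC dS].
assert (eP : forall i, eval2 n (p i) (X r th) (Y r th)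
   = sumZ S1 (fun j => powerRZ rho (j + W - Z.of_nat s2) * part_P i (j + W) (Cs th) (Sn th))).
{ intros i; rewrite eX, eY; apply eval2_weight_decomposition; [exact hrho|apply Sset_NoDup|].
  intros a b hab; now apply part_exponent_in_S1. }
assert (eQ : forall i, eval2 n (q i) (X r th) (Y r th)
   = sumZ S1 (fun j => powerRZ rho (j + W - Z.of_nat s1) * part_Q i (j + W) (Cs th) (Sn th))).
{ intros i; rewrite eX, eY; apply eval2_weight_decomposition; [exact hrho|apply Sset_NoDup|].
  intros a b hab; now apply part_exponent_in_S1. }
destruct (hqh rho (Cs th) (Sn th) hrho) as [eP0 eQ0].
rewrite <- eX, <- eY, pow_powerRZ in eP0, eQ0.
(* W is chosen so that the unperturbed polynomials occupy the index j = 0. *)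
replace (Z.of_nat (s1 + m - 1)) with (0 + W - Z.of_nat s2)%Z in eP0 by (unfold W, weightW; lia).
replace (Z.of_nat (s2 + m - 1)) with (0 + W - Z.of_nat s1)%Z in eQ0 by (unfold W, weightW; lia).
destruct (hex (X r th) (Y r th)) as [exP exQ].
(* Both components reduce to one identity for each i and one for omega_0, with a common factor k. *)
assert (combine : forall (z w' k c0 : R) (c : nat -> R),
   (forall i, eval2 n (q i) (X r th) (Y r th) * z - eval2 n (p i) (X r th) (Y r th) * w' = k * c i) ->
   eval2 d Q (X r th) (Y r th) * z - eval2 d P (X r th) (Y r th) * w' = k * c0 ->
   perturbed (eval2 d Q) (fun i => eval2 n (q i)) eps (X r th) (Y r th) * z
   - perturbed (eval2 d P) (fun i => eval2 n (p i)) eps (X r th) (Y r th) * w'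
   = k * (c0 + Series (fun i => eps ^ S i * c (S i)))).
{ intros z w' k c0 c hc h0; rewrite perturbed_combination by assumption.
  rewrite h0, Rmult_plus_distr_l, <- Series_scal_l; f_equal.
  apply Series_ext; intros i; rewrite hc; ring. }
split; cbn [cdr cdth pullback form_scal form_family].
- replace (Derive (fun r' => X r' th) r) with (INR s1 * H th * rho ^ (s1 - 1) * Cs th)
    by (symmetry; apply is_derive_unique, dr).
  replace (Derive (fun r' => Y r' th) r) with (INR s2 * H th * rho ^ (s2 - 1) * Sn th)
    by (symmetry; apply is_derive_unique, dr).
  unfold perturbed at 3; apply (combine _ _ _ _ (fun i => cdr (w i) r th)).
  + intros i; rewrite eP, eQ; unfold w; cbn [cdr sform].
    rewrite <- sumZ_scal, !(Rmult_comm (sumZ _ _)), <- !sumZ_scal.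
    unfold Rminus; rewrite <- sumZ_opp, <- sumZ_plus; apply sumZ_ext; intros j _.
    transitivity (H th * powerRZ rho (j + W - 1) * part_G i (j + W) th).
    * unfold part_G, polG, rho; rewrite <- part_dr by exact hr; ring.
    * unfold form_g; fold H W G; replace (j + W - 1)%Z with (j + (W - 1))%Z by lia.
      change (r * H th) with rho.
      rewrite powerRZ_add, (erho j) by lra; field; exact hG.
  + rewrite eP0, eQ0; unfold rho; rewrite part_dr by exact hr.
    replace (0 + W - 1)%Z with (W - 1)%Z by lia; fold rho; rewrite Rmult_1_r; reflexivity.
- replace (Derive (fun th' => X r th') th)
    with (INR s1 * (r * (H th * (F th / G th))) * rho ^ (s1 - 1) * Cs th + rho ^ s1 * - Sn th ^ (2 * s1 - 1))
    by (symmetry; apply is_derive_unique, dth, dC).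
  replace (Derive (fun th' => Y r th') th)
    with (INR s2 * (r * (H th * (F th / G th))) * rho ^ (s2 - 1) * Sn th + rho ^ s2 * Cs th ^ (2 * s2 - 1))
    by (symmetry; apply is_derive_unique, dth, dS).
  unfold perturbed at 3; apply (combine _ _ _ _ (fun i => cdth (w i) r th)).
  + intros i; rewrite eP, eQ; unfold w; cbn [cdth sform].
    rewrite <- sumZ_scal, !(Rmult_comm (sumZ _ _)), <- !sumZ_scal.
    unfold Rminus; rewrite <- sumZ_opp, <- sumZ_plus; apply sumZ_ext; intros j _.
    transitivity (powerRZ rho (j + W) * (F th / G th * part_G i (j + W) th - part_F i (j + W) th)).
    * unfold part_G, part_F, polF, polG, rho; rewrite <- part_dth by exact hr; ring.
    * unfold form_f; fold H W G F; replace (j + W)%Z with (1 + (j + (W - 1)))%Z at 1 by lia.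
      change (r * H th) with rho.
      rewrite !powerRZ_add, powerRZ_1, (erho j) by lra.
      unfold rho at 1; field; exact hG.
  (* The dtheta-coefficient of omega_0 is a multiple of (F / G) G - F = 0: removing it is the
     purpose of the rescaling by H. *)
  + rewrite eP0, eQ0; unfold rho; rewrite part_dth by exact hr; fold rho.
    replace (INR s1 * Cs th * _ - _) with (G th) by reflexivity.
    change (Cs th ^ (2 * s2 - 1) * _ + _) with (F th); field; exact hG.
Qed.

End NormalForm.

(** * Truncated expansions and leaves *)

(** [sum_n_m c 1 N] in a form that computes by recursion on N. *)
Fixpoint sum_from_1 (c : nat -> R) (N : nat) : R :=
  match N with O => 0 | S k => sum_from_1 c k + c (S k) end.

Lemma sum_from_1_S (c : nat -> R) (N : nat) : sum_from_1 c (S N) = sum_from_1 c N + c (S N).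
Proof. reflexivity. Qed.

Lemma sum_from_1_ext (c c' : nat -> R) (N : nat) :
  (forall j, (1 <= j <= N)%nat -> c j = c' j) -> sum_from_1 c N = sum_from_1 c' N.
Proof.
induction N as [|N IH]; intros h; simpl; [reflexivity|].
rewrite IH, h by (lia || intros; apply h; lia); reflexivity.
Qed.

Lemma sum_n_m_from_1 (c : nat -> R) (N : nat) : sum_n_m c 1 N = sum_from_1 c N.
Proof.
induction N as [|N IH].
- exact (sum_n_m_zero c 1 0 ltac:(lia)).
- rewrite sum_n_Sm by lia; rewrite IH; reflexivity.
Qed.

Lemma sum_from_1_plus (c c' : nat -> R) (N : nat) :
  sum_from_1 (fun j => c j + c' j) N = sum_from_1 c N + sum_from_1 c' N.
Proof. induction N as [|N IH]; simpl; [ring|rewrite IH; ring]. Qed.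

Lemma sum_from_1_scal (c : nat -> R) (x : R) (N : nat) :
  sum_from_1 (fun j => x * c j) N = x * sum_from_1 c N.
Proof. induction N as [|N IH]; simpl; [ring|rewrite IH; ring]. Qed.

Lemma sum_from_1_sumZ (L : list Z) (c : nat -> Z -> R) (N : nat) :
  sum_from_1 (fun j => sumZ L (c j)) N = sumZ L (fun z => sum_from_1 (fun j => c j z) N).
Proof.
induction N as [|N IH]; simpl; [symmetry; apply sumZ_zero|].
now rewrite IH, <- sumZ_plus.
Qed.

Lemma is_derive_sum_from_1 (c : nat -> R -> R) (c' : nat -> R) (N : nat) (x : R) :
  (forall j, (1 <= j <= N)%nat -> is_derive (c j) x (c' j)) ->
  is_derive (fun t => sum_from_1 (fun j => c j t) N) x (sum_from_1 c' N).
Proof.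
induction N as [|N IH]; intros h; simpl; [apply (is_derive_const 0)|].
apply (is_derive_Rplus (fun t => sum_from_1 (fun j => c j t) N)); [|apply h; lia].
apply IH; intros; apply h; lia.
Qed.

Lemma sum_from_1_rev (c : nat -> R) (N : nat) :
  sum_from_1 c (S N) = sum_f_R0 (fun i => c (S N - i)%nat) N.
Proof.
induction N as [|N IH]; [simpl; ring|].
rewrite decomp_sum by lia; simpl pred.
rewrite (sum_from_1_S c (S N)), IH, Rplus_comm; f_equal.
Qed.

(* Cauchy product of [sum_i a_i e^i] and [sum_j x_j e^j], cut at degree [k + 1]. *)
Lemma cauchy_triangle (a x : nat -> R) (e : R) (k : nat) :
  sum_f_R0 (fun i => a i * e ^ i * sum_from_1 (fun j => e ^ j * x j) (S k - i)) k
  = sum_from_1 (fun l => e ^ l * sum_from_1 (fun j => a (l - j)%nat * x j) l) (S k).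
Proof.
induction k as [|k IH]; [simpl; ring|].
(* From k to k + 1 every row i gains its term of total degree k + 2; the new row i = k + 1 consists
   of that term alone. *)
transitivity (sum_f_R0 (fun i => a i * e ^ i * sum_from_1 (fun j => e ^ j * x j) (S k - i)) (S k)
  + sum_f_R0 (fun i => e ^ S (S k) * (a i * x (S (S k) - i)%nat)) (S k)).
- rewrite <- sum_plus; apply sum_eq; intros i hi.
  replace (S (S k) - i)%nat with (S (S k - i)) by lia; rewrite sum_from_1_S.
  replace (e ^ S (S k)) with (e ^ i * e ^ S (S k - i)) by (rewrite <- pow_add; f_equal; lia).
  ring.
- rewrite (sum_from_1_S _ (S k)), <- IH; f_equal.
  + rewrite (tech5 _ k), Nat.sub_diag; simpl; ring.
  + rewrite sum_from_1_rev, scal_sum; apply sum_eq; intros i hi.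
    replace (S (S k) - (S (S k) - i))%nat with i by lia; ring.
Qed.

(** Here x_j and om_l stand for w_j and Omega_l on the tangent vector (dr, 1), and Gam for the whole
    perturbation. In the product with a_i e^i, cutting Gam at degree k + 1 - i leaves exactly
    Omega_1, ..., Omega_(k+1); what is cut off has order e^(k+2). *)
Lemma leaf_identity (a x om : nat -> R) (e dr Gam : R) (k : nat) :
  a 0%nat = 1 ->
  (forall l, (1 <= l <= S k)%nat -> sum_from_1 (fun j => a (l - j)%nat * x j) l = om l) ->
  dr + Gam = 0 ->
  dr + sum_from_1 (fun l => e ^ l * (a l * dr + om l)) k
  = - (e ^ S k * om (S k)
       + sum_f_R0 (fun i => a i * e ^ i * (Gam - sum_from_1 (fun j => e ^ j * x j) (S k - i))) k).
Proof.
intros ha hom hleaf.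
pose proof (cauchy_triangle a x e k) as tri.
rewrite (sum_from_1_ext _ (fun l => e ^ l * om l)) in tri
  by (intros j hj; rewrite hom by exact hj; reflexivity).
rewrite sum_from_1_S in tri.
assert (e1 : sum_f_R0 (fun i => a i * e ^ i * (Gam - sum_from_1 (fun j => e ^ j * x j) (S k - i))) k
   = sum_f_R0 (fun i => a i * e ^ i) k * Gam
     - sum_f_R0 (fun i => a i * e ^ i * sum_from_1 (fun j => e ^ j * x j) (S k - i)) k).
{ rewrite (Rmult_comm _ Gam), scal_sum, <- minus_sum; apply sum_eq; intros; ring. }
assert (e2 : sum_f_R0 (fun i => a i * e ^ i) k = 1 + sum_from_1 (fun l => e ^ l * a l) k).
{ clear - ha; induction k as [|k IH]; simpl; [rewrite ha; ring|rewrite IH; simpl; ring]. }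
assert (e3 : sum_from_1 (fun l => e ^ l * (a l * dr + om l)) k
   = dr * sum_from_1 (fun l => e ^ l * a l) k + sum_from_1 (fun l => e ^ l * om l) k).
{ rewrite <- sum_from_1_scal, <- sum_from_1_plus; apply sum_from_1_ext; intros; ring. }
rewrite e1, e2, e3, tri; replace Gam with (- dr) by lra; ring.
Qed.

(** K |eps| <= 1/2 bounds the geometric factor 1 / (1 - K |eps|) by 2. *)
Lemma series_tail_bound (c : nat -> R) (C K eps : R) (N : nat) :
  0 <= C -> 0 <= K -> K * Rabs eps <= 1 / 2 ->
  (forall i, Rabs (c (S i)) <= C * K ^ S i) ->
  Rabs (Series (fun i => eps ^ S i * c (S i)) - sum_from_1 (fun j => eps ^ j * c j) N)
  <= 2 * C * (K * Rabs eps) ^ S N.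
Proof.
intros hC hK he hc; set (x := K * Rabs eps) in *.
assert (hx : 0 <= x) by (apply Rmult_le_pos; [exact hK|apply Rabs_pos]).
assert (ex : forall k, ex_series (fun i => eps ^ S (k + i) * c (S (k + i)))).
{ intros k; apply (ex_series_incr_n (fun i => eps ^ S i * c (S i))).
  apply (geometric_ex_series c C K); [exact hc|exact hK|fold x; lra]. }
assert (split : Series (fun i => eps ^ S i * c (S i))
   = sum_from_1 (fun j => eps ^ j * c j) N + Series (fun i => eps ^ S (N + i) * c (S (N + i)))).
{ induction N as [|N IH]; [simpl; ring|].
  rewrite IH, (Series_incr_1 (fun i => eps ^ S (N + i) * c (S (N + i)))) by apply ex.
  rewrite Nat.add_0_r; simpl sum_from_1; rewrite Rplus_assoc; do 2 f_equal.
  apply Series_ext; intros i; rewrite <- plus_n_Sm; reflexivity. }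
rewrite split; replace (_ + _ - _) with (Series (fun i => eps ^ S (N + i) * c (S (N + i)))) by ring.
assert (term : forall i, Rabs (eps ^ S (N + i) * c (S (N + i))) <= C * x ^ S N * x ^ i).
{ intros i; rewrite Rabs_mult, <- RPow_abs.
  replace (C * x ^ S N * x ^ i) with (Rabs eps ^ S (N + i) * (C * K ^ S (N + i))).
  - apply Rmult_le_compat_l; [apply pow_le, Rabs_pos|apply hc].
  - rewrite Rmult_assoc, <- pow_add; change (S N + i)%nat with (S (N + i)).
    unfold x; rewrite Rpow_mult_distr; ring. }
assert (hgeom : ex_series (fun i => C * x ^ S N * x ^ i)).
{ apply (ex_series_scal (C * x ^ S N) (fun i => x ^ i)), ex_series_geom.
  rewrite Rabs_pos_eq; lra. }
eapply Rle_trans; [apply Series_Rabs|].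
{ apply (ex_series_le (fun i => Rabs (eps ^ S (N + i) * c (S (N + i)))) (fun i => C * x ^ S N * x ^ i)); [|exact hgeom].
  intros i; change (Rabs (Rabs (eps ^ S (N + i) * c (S (N + i)))) <= C * x ^ S N * x ^ i).
  rewrite Rabs_Rabsolu; apply term. }
eapply Rle_trans; [apply (Series_le _ (fun i => C * x ^ S N * x ^ i)); [|exact hgeom]|].
{ intros i; split; [apply Rabs_pos|apply term]. }
rewrite Series_scal_l, Series_geom by (rewrite Rabs_pos_eq; lra).
replace (2 * C * x ^ S N) with (C * x ^ S N * 2) by ring.
apply Rmult_le_compat_l; [apply Rmult_le_pos; [exact hC|now apply pow_le]|].
rewrite <- (Rinv_inv 2); apply Rinv_le_contravar; lra.
Qed.

Lemma power_series_geometric (c : nat -> R) (eps0 : R) :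
  0 < eps0 -> (forall eps, Rabs eps < eps0 -> ex_pseries c eps) ->
  exists C K, 0 < C /\ 0 < K /\ forall i, Rabs (c i) <= C * K ^ i.
Proof.
intros h0 hex.
destruct (geometric_of_radius c) as [C [K [hC [hK h]]]].
(* The series converges at eps0 / 2, so its terms tend to 0 there and the radius is at least eps0 /
   2. *)
- apply Rbar_lt_le_trans with (Finite (eps0 / 2)); [simpl; lra|].
  apply Rbar_not_lt_le; intros hlt.
  rewrite <- (Rabs_pos_eq (eps0 / 2)) in hlt by lra.
  apply (CV_disk_outside c (eps0 / 2) hlt).
  destruct (hex (eps0 / 2)) as [l hl]; [rewrite Rabs_pos_eq; lra|].
  apply (is_lim_seq_ext (fun k => scal (pow_n (eps0 / 2) k) (c k))).
  + intros k; rewrite pow_n_pow; apply Rmult_comm.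
  + apply ex_series_lim_0; now exists l.
- exists C, K; repeat split; try assumption; intros i; rewrite <- (Rabs_Rabsolu (c i)); apply h.
Qed.

(* Continuation: as long as [r] stays in the closed interval of radius [delta]
   it moves by at most [C tau < delta], hence it never leaves it. *)
Lemma stays_close (r dr : R -> R) (h delta C tau : R) :
  0 <= tau -> 0 <= C -> C * tau < delta -> r 0 = h ->
  (forall th, 0 <= th <= tau -> is_derive r th (dr th)) ->
  (forall th, 0 <= th <= tau -> Rabs (r th - h) <= delta -> Rabs (dr th) <= C) ->
  forall th, 0 <= th <= tau -> Rabs (r th - h) <= C * tau.
Proof.
intros htau hC hsmall h0 hder hbound.
(* T will be the supremum of these times. Before T the sharper bound C tau holds, at T it holds by
   continuity, and the margin delta - C tau would allow r to be followed past T if T < tau. *)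
set (good := fun t => 0 <= t <= tau /\ forall s, 0 <= s <= t -> Rabs (r s - h) <= delta).
assert (hmove : forall t, good t -> forall s, 0 <= s <= t -> Rabs (r s - h) <= C * tau).
{ intros t [ht hg] s hs; rewrite <- h0.
  eapply Rle_trans; [apply (derive_bound_increment r dr 0 s C); [lra|]|].
  - intros x hx; split; [apply hder; lra|apply hbound; [lra|apply hg; lra]].
  - apply Rmult_le_compat_l; lra. }
assert (hzero : good 0).
{ split; [lra|]; intros s hs; replace s with 0 by lra.
  rewrite h0, Rminus_diag, Rabs_R0; assert (0 <= C * tau) by now apply Rmult_le_pos. lra. }
destruct (completeness good) as [T [hub hleast]].
{ exists tau; intros t [ht _]; lra. }
{ now exists 0. }
assert (hT : 0 <= T <= tau).
{ split; [apply hub, hzero|apply hleast; intros t [ht _]; lra]. }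
assert (hcont : forall t, 0 <= t <= tau -> forall eps : posreal, locally t (fun s => Rabs (r s - r t) < eps)).
{ intros t ht; apply continuity_pt_locally, continuity_pt_filterlim.
  exact (derivable_continuous_at _ _ _ (hder t ht)). }
assert (below : forall s, 0 <= s < T -> Rabs (r s - h) <= C * tau).
{ intros s hs; apply Rnot_lt_le; intros hlt; apply (Rlt_irrefl s).
  apply Rlt_le_trans with T; [lra|]; apply hleast; intros t ht.
  apply Rnot_lt_le; intros hst; apply (Rlt_not_le _ _ hlt), (hmove t ht); lra. }
assert (gap : 0 < delta - C * tau) by lra.
assert (atT : Rabs (r T - h) <= C * tau).
{ destruct (Rle_lt_or_eq_dec 0 T (proj1 hT)) as [hpos|<-]; [|apply (hmove 0 hzero); lra].
  apply le_epsilon; intros e he.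
  destruct (hcont T hT (mkposreal e he)) as [[d hd] hloc].
  set (s := Rmax (T / 2) (T - d / 2)).
  assert (hs1 : T / 2 <= s) by apply Rmax_l; assert (hs2 : T - d / 2 <= s) by apply Rmax_r.
  assert (hs3 : s < T) by (apply Rmax_lub_lt; lra).
  assert (hs : Rabs (r s - r T) < e).
  { apply hloc; change (Rabs (s - T) < d); rewrite Rabs_left; lra. }
  pose proof (below s ltac:(lra)) as hb.
  replace (r T - h) with ((r s - h) + - (r s - r T)) by ring.
  eapply Rle_trans; [apply Rabs_triang|]; rewrite Rabs_Ropp; lra. }
assert (goodT : forall s, 0 <= s <= T -> Rabs (r s - h) <= C * tau).
{ intros s hs; destruct (Req_dec s T) as [->|ne]; [exact atT|apply below; lra]. }
destruct (Rle_lt_or_eq_dec T tau (proj2 hT)) as [hlt|<-]; [exfalso|exact goodT].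
destruct (hcont T hT (mkposreal _ gap)) as [[d hd] hloc].
set (t := Rmin tau (T + d / 2)).
assert (ht1 : t <= tau) by apply Rmin_l; assert (ht2 : t <= T + d / 2) by apply Rmin_r.
assert (ht3 : T < t) by (apply Rmin_glb_lt; lra).
apply (Rlt_not_le _ _ ht3), hub; split; [lra|]; intros s hs.
destruct (Rle_dec s T) as [hsT|hsT]; [specialize (goodT s ltac:(lra)); lra|].
assert (hs' : Rabs (r s - r T) < delta - C * tau).
{ apply hloc; change (Rabs (s - T) < d); rewrite Rabs_pos_eq; lra. }
replace (r s - h) with ((r s - r T) + (r T - h)) by ring.
eapply Rle_trans; [apply Rabs_triang|]; lra.
Qed.

(** On [h/2, 3h/2] the radius stays away from 0, where negative powers blow up; bounds on the powers
    and on their derivatives give the constant. *)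
Lemma powerRZ_lipschitz (L : list Z) (h : R) :
  0 < h -> exists C, 0 < C /\ forall j r, In j L -> Rabs (r - h) <= h / 2 ->
    Rabs (powerRZ r j) <= C /\ Rabs (powerRZ r j - powerRZ h j) <= C * Rabs (r - h).
Proof.
intros hh.
destruct (continuous_family_bounded L (fun j r => powerRZ r j) (h / 2) (3 * h / 2)) as [C [hC b1]].
{ intros j x _ hx; apply (continuous_powerRZ (fun r => r)); [lra|apply continuous_id]. }
destruct (continuous_family_bounded L (fun j r => IZR j * powerRZ r (j - 1)) (h / 2) (3 * h / 2)) as [D [hD b2]].
{ intros j x _ hx; apply (continuous_Rmult (fun _ => IZR j)); [apply continuous_const|].
  apply (continuous_powerRZ (fun r => r)); [lra|apply continuous_id]. }
exists (C + D); split; [lra|]; intros j r hj hr.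
apply Rabs_le_between in hr.
split; [specialize (b1 j r hj ltac:(lra)); simpl in b1; lra|].
apply (Rle_trans _ (D * Rabs (r - h))); [|apply Rmult_le_compat_r; [apply Rabs_pos|lra]].
assert (inc : forall x y, h / 2 <= x -> x <= y -> y <= 3 * h / 2 ->
          Rabs (powerRZ y j - powerRZ x j) <= D * (y - x)).
{ intros x y h1 h2 h3; apply (derive_bound_increment (fun x => powerRZ x j) (fun x => IZR j * powerRZ x (j - 1)));
    [exact h2|]; intros z hz; split; [apply is_derive_powerRZ; lra|apply (b2 j z hj); lra]. }
destruct (Rle_dec h r) as [hle|hle].
- rewrite (Rabs_pos_eq (r - h)) by lra; apply inc; lra.
- rewrite (Rabs_minus_sym (powerRZ r j)), (Rabs_minus_sym r), (Rabs_pos_eq (h - r)) by lra; apply inc; lra.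
Qed.

(** * The recursion for the multipliers *)

(** Product of two Laurent polynomials collected by exponent: the pair (v, z) contributes to v + z
    only, and L lists that exponent exactly once. *)
Lemma sumZ_regroup (L L1 L2 : list Z) (c y x : Z -> R) :
  NoDup L -> (forall v z, In v L1 -> In z L2 -> In (v + z)%Z L) ->
  sumZ L (fun u => c u * sumZ L1 (fun v => sumZ L2 (fun z => if Z.eq_dec (v + z) u then y v * x z else 0)))
  = sumZ L1 (fun v => sumZ L2 (fun z => c (v + z)%Z * (y v * x z))).
Proof.
intros hd hin.
rewrite (sumZ_ext L _ (fun u => sumZ L1 (fun v => sumZ L2 (fun z =>
  if Z.eq_dec (v + z) u then c u * (y v * x z) else 0)))).
- rewrite (sumZ_exchange L L1 (fun u v => sumZ L2 (fun z =>
    if Z.eq_dec (v + z) u then c u * (y v * x z) else 0))).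
  apply sumZ_ext; intros v hv.
  rewrite (sumZ_exchange L L2 (fun u z => if Z.eq_dec (v + z) u then c u * (y v * x z) else 0)).
  apply sumZ_ext; intros z hz.
  apply (sumZ_indicator L (v + z) (fun u => c u * (y v * x z))); [exact hd|now apply hin].
- intros u _; rewrite <- sumZ_scal; apply sumZ_ext; intros v _.
  rewrite <- sumZ_scal; apply sumZ_ext; intros z _.
  destruct Z.eq_dec; ring.
Qed.

Lemma sumZ_abs_const (L : list Z) (u : Z -> R) (c : R) :
  (forall z, In z L -> Rabs (u z) <= c) -> Rabs (sumZ L u) <= INR (length L) * c.
Proof.
intros h; eapply Rle_trans; [apply (sumZ_abs_le L u (fun _ => c) h)|].
clear h; induction L as [|z L IH]; [unfold sumZ; simpl; lra|].
rewrite sumZ_cons; change (length (z :: L)) with (S (length L)); rewrite S_INR; lra.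
Qed.

Lemma uniform_constant (Pr : nat -> R -> Prop) (N : nat) :
  (forall l C C', C <= C' -> Pr l C -> Pr l C') ->
  (forall l, (l <= N)%nat -> exists C, 0 < C /\ Pr l C) ->
  exists C, 0 < C /\ forall l, (l <= N)%nat -> Pr l C.
Proof.
intros hmono; induction N as [|N IH]; intros h.
- destruct (h 0%nat) as [C [hC hp]]; [lia|]; exists C; split; [exact hC|].
  intros l hl; replace l with 0%nat by lia; exact hp.
- destruct IH as [C [hC hp]]; [intros; apply h; lia|].
  destruct (h (S N)) as [C' [hC' hp']]; [lia|].
  exists (C + C'); split; [lra|]; intros l hl.
  destruct (Nat.eq_dec l (S N)) as [->|ne].
  + apply (hmono _ C'); [lra|exact hp'].
  + apply (hmono _ C); [lra|apply hp; lia].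
Qed.

Section Recursion.

Context (E : nat -> list Z) (f g : nat -> Z -> R -> R).

Definition coef : Type := Z -> R -> (nat -> R) -> R.

(* Coefficient of [r^u] in [sum_(1 <= j <= l) a_(l-j) * sum_(z in E 1) r^z phi_(j,z)],
   where [a_i = - sum_(v in E i) r^v b_(i,v)]. *)
Definition conv (b : nat -> coef) (phi : nat -> Z -> R -> R) (l : nat) : coef :=
  fun u th ths => sum_from_1 (fun j => sumZ (E (l - j)) (fun v => sumZ (E 1) (fun z =>
    if Z.eq_dec (v + z) u then - b (l - j)%nat v th ths * phi j z th else 0))) l.

(** Forced by the dr-component of d S_l = a_l dr + Omega_l: the r-derivative of r^(u+1) brings the
    factor u + 1. *)
Definition next_b (b : nat -> coef) (l : nat) : coef :=
  fun u th ths => conv b g l u th ths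
    + IZR (u + 1) * RInt (fun s => conv b f l u s ths) (ths l) th.

(* [b_0 = -1], so that [a_0 = 1] when [E 0] is [[0]]. *)
Fixpoint b_table (N : nat) : nat -> coef :=
  match N with
  | O => fun _ _ _ _ => -1
  | S N' => fun i => if Nat.leb i N' then b_table N' i else next_b (b_table N') (S N')
  end.

(** The recursion uses all earlier orders, so tables of b_0, ..., b_N are built and b_i is read in
    the first one that contains it; entries beyond N are never read. *)
Definition b_coef (i : nat) : coef := b_table i i.

Definition a_fun (i : nat) (r th : R) (ths : nat -> R) : R :=
  - sumZ (E i) (fun v => powerRZ r v * b_coef i v th ths).

Definition A_coef : nat -> coef := conv b_coef g.
Definition B_coef : nat -> coef := conv b_coef f.

Lemma b_coef_next (l : nat) : b_coef (S l) = next_b (b_table l) (S l).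
Proof.
unfold b_coef; cbn [b_table]; destruct (Nat.leb_spec (S l) l) as [h|h]; [lia|reflexivity].
Qed.

Lemma b_table_stable (N i : nat) : (i <= N)%nat -> b_table N i = b_coef i.
Proof.
induction N as [|N IH]; intros hi.
- now replace i with 0%nat by lia.
- cbn [b_table]; destruct (Nat.leb_spec i N) as [h|h]; [now apply IH|].
  replace i with (S N) by lia; symmetry; apply b_coef_next.
Qed.

Lemma conv_ext (b b' : nat -> coef) (phi : nat -> Z -> R -> R) (l : nat) (u : Z) (th : R) (ths : nat -> R) :
  (forall i, (i < l)%nat -> b i = b' i) -> conv b phi l u th ths = conv b' phi l u th ths.
Proof.
intros h; apply sum_from_1_ext; intros j hj.
rewrite h by lia; reflexivity.
Qed.

Lemma b_coef_S (l : nat) (u : Z) (th : R) (ths : nat -> R) :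
  b_coef (S l) u th ths = A_coef (S l) u th ths
    + IZR (u + 1) * RInt (fun s => B_coef (S l) u s ths) (ths (S l)) th.
Proof.
rewrite b_coef_next; unfold next_b; f_equal; [|f_equal; apply RInt_ext; intros s _];
  apply conv_ext; intros i hi; apply b_table_stable; lia.
Qed.

Context (hE0 : E 0%nat = 0%Z :: nil) (hnd : forall l, NoDup (E l)).
Context (hadd : forall l j v z, (1 <= j <= l)%nat -> In v (E (l - j)) -> In z (E 1) -> In (v + z)%Z (E l)).

Lemma a_fun_0 (r th : R) (ths : nat -> R) : a_fun 0 r th ths = 1.
Proof. unfold a_fun; rewrite hE0; unfold sumZ, b_coef; simpl; ring. Qed.

(** Only a_0 = 1 contributes at order 1, so Omega_1 is w_1, and A_1, B_1 are g_1, f_1 without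
    parameters. *)
Lemma conv_1 (phi : nat -> Z -> R -> R) (u : Z) (th : R) (ths : nat -> R) :
  In u (E 1) -> conv b_coef phi 1 u th ths = phi 1%nat u th.
Proof.
intros hu; unfold conv; simpl; rewrite hE0, sumZ_cons; unfold sumZ at 2; simpl.
rewrite (sumZ_ext _ _ (fun z => if Z.eq_dec u z then phi 1%nat z th else 0)).
- rewrite (sumZ_indicator (E 1) u (fun z => phi 1%nat z th)) by auto; ring.
- intros z _; destruct (Z.eq_dec z u), (Z.eq_dec u z); subst; try easy.
  unfold b_coef; simpl; ring.
Qed.

(** With phi = g and phi = f this gives the two components of Omega_l; by [hadd] the exponents of
    a_(l-j) and of w_j add up inside E l. *)
Lemma conv_form (phi : nat -> Z -> R -> R) (l : nat) (r th : R) (ths : nat -> R) :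
  0 < r ->
  sum_from_1 (fun j => a_fun (l - j) r th ths * sumZ (E 1) (fun z => powerRZ r z * phi j z th)) l
  = sumZ (E l) (fun u => powerRZ r u * conv b_coef phi l u th ths).
Proof.
intros hr; unfold conv.
rewrite (sumZ_ext (E l) _ (fun u => sum_from_1 (fun j => powerRZ r u * sumZ (E (l - j)) (fun v =>
  sumZ (E 1) (fun z => if Z.eq_dec (v + z) u then - b_coef (l - j) v th ths * phi j z th else 0))) l))
  by (intros; now rewrite sum_from_1_scal).
rewrite <- (sum_from_1_sumZ (E l) (fun j u => powerRZ r u * sumZ (E (l - j)) (fun v =>
  sumZ (E 1) (fun z => if Z.eq_dec (v + z) u then - b_coef (l - j) v th ths * phi j z th else 0)))).
apply sum_from_1_ext; intros j hj.
rewrite (sumZ_regroup (E l) (E (l - j)) (E 1) (powerRZ r) (fun v => - b_coef (l - j) v th ths) (fun z => phi j z th));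
  [|apply hnd|intros; now apply (hadd l j)].
unfold a_fun; rewrite <- sumZ_opp, Rmult_comm, <- sumZ_scal; apply sumZ_ext; intros v _.
rewrite Rmult_comm, <- sumZ_scal; apply sumZ_ext; intros z _.
rewrite powerRZ_add by lra; ring.
Qed.

Context (tau : R) (htau : 0 < tau).
Context (hcf : forall i j th, continuous (f i j) th) (hcg : forall i j th, continuous (g i j) th).
Context (hpf : forall i j th, f i j (th + tau) = f i j th) (hpg : forall i j th, g i j (th + tau) = g i j th).

Lemma continuous_sum_from_1 (c : nat -> R -> R) (N : nat) (x : R) :
  (forall j, (1 <= j <= N)%nat -> continuous (c j) x) ->
  continuous (fun t => sum_from_1 (fun j => c j t) N) x.
Proof.
induction N as [|N IH]; intros h; simpl; [apply continuous_const|].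
apply (continuous_Rplus (fun t => sum_from_1 (fun j => c j t) N)); [|apply h; lia].
apply IH; intros; apply h; lia.
Qed.

Lemma conv_continuous (phi : nat -> Z -> R -> R) (l : nat) (u : Z) (ths : nat -> R) :
  (forall i j th, continuous (phi i j) th) ->
  (forall i v th, (i < l)%nat -> continuous (fun t => b_coef i v t ths) th) ->
  forall th, continuous (fun t => conv b_coef phi l u t ths) th.
Proof.
intros hphi hb th; apply (continuous_sum_from_1 (fun j t => sumZ (E (l - j)) (fun v => sumZ (E 1) (fun z =>
    if Z.eq_dec (v + z) u then - b_coef (l - j)%nat v t ths * phi j z t else 0)))).
intros j hj; apply (continuous_sumZ _ (fun v t => sumZ (E 1) (fun z =>
    if Z.eq_dec (v + z) u then - b_coef (l - j)%nat v t ths * phi j z t else 0))); intros v _.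
apply (continuous_sumZ _ (fun z t =>
    if Z.eq_dec (v + z) u then - b_coef (l - j)%nat v t ths * phi j z t else 0)); intros z _.
destruct Z.eq_dec; [|apply continuous_const].
apply continuous_Rmult; [|apply hphi]; apply continuous_Ropp, hb; lia.
Qed.

Lemma b_coef_continuous (l : nat) (v : Z) (ths : nat -> R) (th : R) :
  continuous (fun t => b_coef l v t ths) th.
Proof.
revert v ths th; induction l as [l IH] using (well_founded_induction Wf_nat.lt_wf); intros v ths th.
destruct l as [|l]; [apply continuous_const|].
apply (continuous_ext (fun t => A_coef (S l) v t ths
    + IZR (v + 1) * RInt (fun s => B_coef (S l) v s ths) (ths (S l)) t)).
{ intros t; symmetry; apply b_coef_S. }
apply continuous_Rplus; [apply conv_continuous; auto|].
apply (continuous_Rmult (fun _ => IZR (v + 1))); [apply continuous_const|].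
eapply derivable_continuous_at, is_derive_primitive, conv_continuous; auto.
Qed.

Lemma A_coef_continuous (l : nat) (u : Z) (ths : nat -> R) (th : R) :
  continuous (fun t => A_coef l u t ths) th.
Proof. apply conv_continuous; [exact hcg|intros; apply b_coef_continuous]. Qed.

Lemma B_coef_continuous (l : nat) (u : Z) (ths : nat -> R) (th : R) :
  continuous (fun t => B_coef l u t ths) th.
Proof. apply conv_continuous; [exact hcf|intros; apply b_coef_continuous]. Qed.

(** * Periodicity in the angle and in the parameters *)

Lemma set_param_same (ths : nat -> R) (i : nat) (x : R) : set_param ths i x i = x.
Proof. unfold set_param; now destruct Nat.eq_dec. Qed.

Lemma set_param_other (ths : nat -> R) (i j : nat) (x : R) : j <> i -> set_param ths i x j = ths j.
Proof. intros h; unfold set_param; now destruct Nat.eq_dec. Qed.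

Lemma periodic_mono (l l' : nat) (c : R -> (nat -> R) -> R) :
  (l <= l')%nat -> periodic_fun tau l c -> periodic_fun tau l' c.
Proof.
intros hl [h1 [h2 h3]]; split; [|split; [exact h2|]].
- intros th ths ths' h; apply h1; intros; apply h; lia.
- intros th ths i hi; destruct (le_dec i l) as [h|h]; [apply h3; lia|].
  apply h1; intros j hj; apply set_param_other; lia.
Qed.

Lemma periodic_ext (l : nat) (c c' : R -> (nat -> R) -> R) :
  (forall th ths, c th ths = c' th ths) -> periodic_fun tau l c -> periodic_fun tau l c'.
Proof.
intros e [h1 [h2 h3]]; split; [|split].
- intros th ths ths' h; rewrite <- !e; now apply h1.
- intros th ths; rewrite <- !e; apply h2.
- intros th ths i hi; rewrite <- !e; now apply h3.
Qed.

Lemma periodic_without_params (l : nat) (u : R -> R) :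
  (forall th, u (th + tau) = u th) -> periodic_fun tau l (fun th _ => u th).
Proof. intros h; repeat split; auto; intros th ths ths' _; reflexivity. Qed.

Lemma periodic_binary (op : R -> R -> R) (l : nat) (c c' : R -> (nat -> R) -> R) :
  periodic_fun tau l c -> periodic_fun tau l c' ->
  periodic_fun tau l (fun th ths => op (c th ths) (c' th ths)).
Proof.
intros [h1 [h2 h3]] [k1 [k2 k3]]; split; [|split].
- intros th ths ths' h; rewrite (h1 th ths ths' h), (k1 th ths ths' h); reflexivity.
- intros th ths; now rewrite h2, k2.
- intros th ths i hi; now rewrite h3, k3.
Qed.

Lemma periodic_sumZ (L : list Z) (l : nat) (c : Z -> R -> (nat -> R) -> R) :
  (forall z, In z L -> periodic_fun tau l (c z)) ->
  periodic_fun tau l (fun th ths => sumZ L (fun z => c z th ths)).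
Proof.
induction L as [|z L IH]; intros h.
- now apply (periodic_without_params l (fun _ => 0)).
- apply (periodic_binary Rplus l (c z) (fun th ths => sumZ L (fun z => c z th ths))).
  + apply h; now left.
  + apply IH; intros; apply h; now right.
Qed.

Lemma periodic_sum_from_1 (N l : nat) (c : nat -> R -> (nat -> R) -> R) :
  (forall j, (1 <= j <= N)%nat -> periodic_fun tau l (c j)) ->
  periodic_fun tau l (fun th ths => sum_from_1 (fun j => c j th ths) N).
Proof.
induction N as [|N IH]; intros h; simpl.
- now apply (periodic_without_params l (fun _ => 0)).
- apply (periodic_binary Rplus l (fun th ths => sum_from_1 (fun j => c j th ths) N) (c (S N)));
    [apply IH; intros|]; apply h; lia.
Qed.

(** Zero mean makes the primitive periodic in its upper limit and, for the same reason, in its lower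
    limit, the new parameter of index l + 1. As c does not depend on that parameter, shifting it
    leaves the integrand unchanged. *)
Lemma periodic_primitive (l : nat) (c : R -> (nat -> R) -> R) :
  periodic_fun tau l c -> (forall ths th, continuous (fun t => c t ths) th) ->
  (forall ths, RInt (fun s => c s ths) 0 tau = 0) ->
  periodic_fun tau (S l) (fun th ths => RInt (fun s => c s ths) (ths (S l)) th).
Proof.
intros [h1 [h2 h3]] hc h0.
assert (shift : forall ths x, RInt (fun s => c s ths) x (x + tau) = 0).
{ intros ths x; rewrite (RInt_over_period (fun s => c s ths)); auto. }
split; [|split].
- intros th ths ths' h; rewrite (h (S l)) by lia.
  apply RInt_ext; intros s _; apply h1; intros; apply h; lia.
- intros th ths.
  rewrite <- (RInt_Chasles_everywhere (fun s => c s ths) (ths (S l)) th (th + tau) (hc ths)), shift.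
  apply Rplus_0_r.
- intros th ths i hi; destruct (Nat.eq_dec i (S l)) as [->|ne].
  + rewrite set_param_same, (RInt_ext (fun s => c s (set_param ths (S l) (ths (S l) + tau))) (fun s => c s ths)).
    * rewrite <- (RInt_Chasles_everywhere (fun s => c s ths) (ths (S l)) (ths (S l) + tau) th (hc ths)), shift.
      symmetry; apply Rplus_0_l.
    * intros s _; apply h1; intros j hj; apply set_param_other; lia.
  + rewrite set_param_other by lia; apply RInt_ext; intros s _; apply h3; lia.
Qed.

(** What M_1 = ... = M_k = 0 amounts to for the recursion. All values of the parameters are
    included, because the b_l have to be periodic in theta for each of them. *)
Definition mean_zero_upto (k : nat) : Prop :=
  forall l u ths, (1 <= l <= k)%nat -> In u (E l) -> RInt (fun s => B_coef l u s ths) 0 tau = 0.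

(** At order l only b_(l-j) with j >= 1 occurs, hence at most the parameters theta_1, ...,
    theta_(l-1). *)
Lemma conv_periodic (phi : nat -> Z -> R -> R) (l : nat) (u : Z) :
  (forall i j th, phi i j (th + tau) = phi i j th) ->
  (forall i v, (i < l)%nat -> In v (E i) -> periodic_fun tau i (b_coef i v)) ->
  periodic_fun tau (l - 1) (conv b_coef phi l u).
Proof.
intros hphi hb; apply (periodic_sum_from_1 l (l - 1) (fun j th ths => sumZ (E (l - j)) (fun v => sumZ (E 1) (fun z =>
    if Z.eq_dec (v + z) u then - b_coef (l - j)%nat v th ths * phi j z th else 0)))).
intros j hj; apply (periodic_sumZ _ (l - 1) (fun v th ths => sumZ (E 1) (fun z =>
    if Z.eq_dec (v + z) u then - b_coef (l - j)%nat v th ths * phi j z th else 0))); intros v hv.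
apply (periodic_sumZ _ (l - 1) (fun z th ths =>
    if Z.eq_dec (v + z) u then - b_coef (l - j)%nat v th ths * phi j z th else 0)); intros z _.
destruct Z.eq_dec; [|now apply (periodic_without_params (l - 1) (fun _ => 0))].
apply (periodic_binary (fun x y => - x * y) (l - 1) (b_coef (l - j)%nat v) (fun th _ => phi j z th)).
- apply (periodic_mono (l - j)); [lia|apply hb; [lia|exact hv]].
- now apply periodic_without_params.
Qed.

Lemma b_coef_periodic (k l : nat) (v : Z) :
  mean_zero_upto k -> (l <= k)%nat -> In v (E l) -> periodic_fun tau l (b_coef l v).
Proof.
intros hk; revert v; induction l as [l IH] using (well_founded_induction Wf_nat.lt_wf); intros v hl hv.
destruct l as [|l]; [now apply (periodic_without_params 0 (fun _ => -1))|].
assert (hb : forall i v, (i < S l)%nat -> In v (E i) -> periodic_fun tau i (b_coef i v)).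
{ intros i v' hi hv'; apply IH; try assumption; lia. }
apply (periodic_ext (S l) (fun th ths => A_coef (S l) v th ths
    + IZR (v + 1) * RInt (fun s => B_coef (S l) v s ths) (ths (S l)) th)).
{ intros; symmetry; apply b_coef_S. }
apply (periodic_binary (fun x y => x + IZR (v + 1) * y) (S l) (A_coef (S l) v)
   (fun th ths => RInt (fun s => B_coef (S l) v s ths) (ths (S l)) th)).
- apply (periodic_mono (S l - 1)); [lia|]; now apply conv_periodic.
- apply periodic_primitive.
  + replace l with (S l - 1)%nat at 1 by lia; now apply conv_periodic.
  + intros; apply B_coef_continuous.
  + intros ths; apply hk; [lia|exact hv].
Qed.

Lemma AB_coef_periodic (k l : nat) (u : Z) :
  mean_zero_upto k -> (l <= S k)%nat ->
  periodic_fun tau (l - 1) (A_coef l u) /\ periodic_fun tau (l - 1) (B_coef l u).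
Proof.
intros hk hl; split; apply conv_periodic; auto;
  intros i v hi hv; apply (b_coef_periodic k); try assumption; lia.
Qed.

Lemma a_fun_periodic (k i : nat) (r : R) :
  mean_zero_upto k -> (i <= k)%nat -> periodic_fun tau i (a_fun i r).
Proof.
intros hk hi.
apply (periodic_ext i (fun th ths => sumZ (E i) (fun v => - (powerRZ r v * b_coef i v th ths)))).
{ intros; apply sumZ_opp. }
apply (periodic_sumZ (E i) i (fun v th ths => - (powerRZ r v * b_coef i v th ths))); intros v hv.
apply (periodic_binary (fun x _ => - (powerRZ r v * x)) i (b_coef i v) (b_coef i v));
  now apply (b_coef_periodic k).
Qed.

End Recursion.

(** * Melnikov functions *)

Section Melnikov.

Context (E : nat -> list Z) (f g : nat -> Z -> R -> R) (tau : R).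
Context (hE0 : E 0%nat = 0%Z :: nil) (hnd : forall l, NoDup (E l)).
Context (hadd : forall l j v z, (1 <= j <= l)%nat -> In v (E (l - j)) -> In z (E 1) -> In (v + z)%Z (E l)).
Context (htau : 0 < tau).
Context (hcf : forall i j th, continuous (f i j) th) (hcg : forall i j th, continuous (g i j) th).
Context (hgeo : exists C K, 0 < C /\ 0 < K /\ forall i j th, In j (E 1) -> 0 <= th <= tau ->
    Rabs (f i j th) <= C * K ^ i /\ Rabs (g i j th) <= C * K ^ i).

Let a := a_fun E f g.
Let A := A_coef E f g.
Let B := B_coef E f g.
Let w i := sform (E 1) (g i) (f i).

(** The parameters being fixed, continuity in theta on [0, tau] is enough. The last bound serves
    [potential_increment]. *)
Lemma coefficient_bounds (k : nat) (ths : nat -> R) :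
  exists U, 1 <= U /\ forall l, (l <= S k)%nat ->
    INR (length (E l)) <= U /\
    forall u th, In u (E l) -> 0 <= th <= tau ->
      Rabs (b_coef E f g l u th ths) <= U /\ Rabs (A l u th ths) <= U /\ Rabs (B l u th ths) <= U /\
      Rabs (RInt (fun s => B l u s ths) (ths l) 0) <= U.
Proof.
destruct (uniform_constant (fun l U => INR (length (E l)) <= U /\
    forall u th, In u (E l) -> 0 <= th <= tau ->
      Rabs (b_coef E f g l u th ths) <= U /\ Rabs (A l u th ths) <= U /\ Rabs (B l u th ths) <= U /\
      Rabs (RInt (fun s => B l u s ths) (ths l) 0) <= U) (S k)) as [U [hU h]].
- intros l C C' hC [h1 h2]; split; [lra|]; intros u th hu hth.
  destruct (h2 u th hu hth) as [? [? [? ?]]]; repeat split; lra.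
- intros l _.
  destruct (continuous_family_bounded (E l) (fun u th => b_coef E f g l u th ths) 0 tau) as [U1 [h1 b1]].
  { intros; now apply b_coef_continuous. }
  destruct (continuous_family_bounded (E l) (fun u th => A l u th ths) 0 tau) as [U2 [h2 b2]].
  { intros; now apply A_coef_continuous. }
  destruct (continuous_family_bounded (E l) (fun u th => B l u th ths) 0 tau) as [U3 [h3 b3]].
  { intros; now apply B_coef_continuous. }
  destruct (continuous_family_bounded (E l) (fun u _ => RInt (fun s => B l u s ths) (ths l) 0) 0 tau) as [U4 [h4 b4]].
  { intros; apply continuous_const. }
  pose proof (pos_INR (length (E l))).
  exists (INR (length (E l)) + U1 + U2 + U3 + U4); split; [lra|]; split; [lra|].
  intros u th hu hth; specialize (b1 u th hu hth); specialize (b2 u th hu hth).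
  specialize (b3 u th hu hth); specialize (b4 u th hu hth); repeat split; simpl in *; lra.
- exists (1 + U); split; [lra|]; intros l hl; destruct (h l hl) as [h1 h2]; split; [lra|].
  intros u th hu hth; destruct (h2 u th hu hth) as [? [? [? ?]]]; repeat split; lra.
Qed.

(** r^u comes from the dr-components, r^(u+1) from the dtheta-components and the potentials. *)
Lemma exponent_bounds (k : nat) (h : R) :
  0 < h -> exists D, 1 <= D /\ forall l u r, (l <= S k)%nat -> In u (E l) -> Rabs (r - h) <= h / 2 ->
    Rabs (powerRZ r u) <= D /\ Rabs (powerRZ r (u + 1)) <= D /\
    Rabs (powerRZ r (u + 1) - powerRZ h (u + 1)) <= D * Rabs (r - h).
Proof.
intros hh.
set (L := flat_map (fun l => E l ++ map (fun u => (u + 1)%Z) (E l)) (seq 0 (S (S k)))).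
destruct (powerRZ_lipschitz L h hh) as [D [hD b]].
exists (1 + D); split; [lra|]; intros l u r hl hu hr.
assert (h1 : In u L).
{ apply in_flat_map; exists l; split; [apply in_seq; lia|apply in_or_app; now left]. }
assert (h2 : In (u + 1)%Z L).
{ apply in_flat_map; exists l; split; [apply in_seq; lia|apply in_or_app; right].
  now apply (in_map (fun u => (u + 1)%Z)). }
destruct (b u r h1 hr) as [b1 _], (b (u + 1)%Z r h2 hr) as [b2 b3].
pose proof (Rabs_pos (r - h)); repeat split; nra.
Qed.

(** The function S_l of the overview. *)
Definition potential (ths : nat -> R) (l : nat) (r th : R) : R :=
  - sumZ (E l) (fun u => powerRZ r (u + 1) * RInt (fun s => B_coef E f g l u s ths) (ths l) th).

(* [Omega_l] evaluated on the vector [(dr, 1)]. *)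
Definition omega_value (ths : nat -> R) (l : nat) (r th dr : R) : R :=
  sumZ (E l) (fun u => powerRZ r u * A_coef E f g l u th ths) * dr
  - sumZ (E l) (fun u => powerRZ r (u + 1) * B_coef E f g l u th ths).

Lemma omega_value_decomposition (ths : nat -> R) (l : nat) (r th dr : R) :
  0 < r ->
  sum_from_1 (fun j => a (l - j)%nat r th ths * (cdr (w j) r th * dr + cdth (w j) r th)) l
  = omega_value ths l r th dr.
Proof.
intros hr; unfold omega_value, A_coef, B_coef.
rewrite (sumZ_ext _ (fun u => powerRZ r (u + 1) * conv E (b_coef E f g) f l u th ths)
   (fun u => r * (powerRZ r u * conv E (b_coef E f g) f l u th ths)))
  by (intros; rewrite powerRZ_add, powerRZ_1 by lra; ring).
rewrite sumZ_scal.
rewrite <- !(conv_form E f g hnd hadd) by assumption.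
rewrite Rmult_comm, <- sum_from_1_scal.
unfold Rminus; rewrite Ropp_mult_distr_l, <- sum_from_1_scal, <- sum_from_1_plus.
apply sum_from_1_ext; intros j _; unfold w; cbn [cdr cdth sform]; fold a.
rewrite (sumZ_ext (E 1) (fun z => powerRZ r z * - (r * f j z th)) (fun z => - r * (powerRZ r z * f j z th)))
  by (intros; ring).
rewrite sumZ_scal; ring.
Qed.

(** By [b_coef_S] the A-part of Omega_l cancels that of a_l; what remains is the r-derivative and
    the theta-derivative of the potential. *)
Lemma potential_derive (ths : nat -> R) (l : nat) (r : R -> R) (th dr : R) :
  (1 <= l)%nat -> 0 < r th -> is_derive r th dr ->
  is_derive (fun t => potential ths l (r t) t) th
    (a l (r th) th ths * dr + omega_value ths l (r th) th dr).
Proof.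
intros hl hr hder; destruct l as [|l]; [lia|].
eapply is_derive_value.
- apply is_derive_Ropp, is_derive_sumZ; intros u _.
  apply (is_derive_Rmult (fun t => powerRZ (r t) (u + 1))
           (fun t => RInt (fun s => B_coef E f g (S l) u s ths) (ths (S l)) t)).
  + apply (is_derive_Rcomp (fun x => powerRZ x (u + 1)) r); [now apply is_derive_powerRZ|exact hder].
  + apply is_derive_primitive; intros; now apply B_coef_continuous.
- cbv beta; unfold a, a_fun, omega_value.
  rewrite Ropp_mult_distr_l_reverse, Rmult_comm, <- sumZ_scal.
  rewrite (Rmult_comm (sumZ _ _) dr), <- sumZ_scal.
  unfold Rminus; rewrite <- !sumZ_opp, <- !sumZ_plus; apply sumZ_ext; intros u _.
  rewrite b_coef_S; replace (u + 1 - 1)%Z with u by lia; ring.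
Qed.

(** The smallness of K e gives 1 + c1 >= 1/2, so |dr| <= 2 |c2|. *)
Lemma leaf_slope_bound (C K e c1 c2 dr : R) :
  0 < C -> 0 <= K * e -> 4 * C * (K * e) <= 1 ->
  Rabs c1 <= 2 * C * (K * e) -> Rabs c2 <= 2 * C * (K * e) ->
  (1 + c1) * dr + (0 + c2) = 0 -> Rabs dr <= 4 * C * (K * e).
Proof.
intros hC hKe hsmall h1 h2 heq.
assert (hc : 1 / 2 <= 1 + c1) by (apply Rabs_le_between in h1; lra).
assert (e1 : (1 + c1) * Rabs dr = Rabs c2).
{ rewrite <- (Rabs_pos_eq (1 + c1)), <- Rabs_mult by lra.
  replace ((1 + c1) * dr) with (- c2) by lra; apply Rabs_Ropp. }
pose proof (Rabs_pos dr); nra.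
Qed.

Lemma pow_le_self (e : R) (l : nat) : 0 <= e <= 1 -> (1 <= l)%nat -> e ^ l <= e.
Proof.
intros he hl; replace l with (S (l - 1)) by lia; simpl.
assert (e ^ (l - 1) <= 1) by (rewrite <- (pow1 (l - 1)); now apply pow_incr).
assert (0 <= e ^ (l - 1)) by (apply pow_le; lra); nra.
Qed.

Lemma sum_from_1_abs_const (c : nat -> R) (x : R) (N : nat) :
  (forall j, (1 <= j <= N)%nat -> Rabs (c j) <= x) -> Rabs (sum_from_1 c N) <= INR N * x.
Proof.
induction N as [|N IH]; intros h; simpl sum_from_1; [rewrite Rabs_R0; simpl; lra|].
rewrite S_INR; eapply Rle_trans; [apply Rabs_triang|].
rewrite Rmult_plus_distr_r, Rmult_1_l; apply Rplus_le_compat; [|apply h; lia].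
apply IH; intros; apply h; lia.
Qed.

Lemma vanishes_of_linear_bound (x C e0 : R) :
  0 < e0 -> (forall e, 0 < e < e0 -> Rabs x <= C * e) -> x = 0.
Proof.
intros he h; destruct (Req_dec x 0) as [|hx]; [assumption|exfalso].
assert (hp : 0 < Rabs x) by now apply Rabs_pos_lt.
set (D := Rabs C + 1); assert (hD : 0 < D) by (pose proof (Rabs_pos C); unfold D; lra).
set (e := Rmin (e0 / 2) (Rabs x / (2 * D))).
assert (h1 : 0 < e) by (apply Rmin_glb_lt; [lra|apply Rdiv_lt_0_compat; lra]).
assert (h2 : e <= e0 / 2) by apply Rmin_l; assert (h3 : e <= Rabs x / (2 * D)) by apply Rmin_r.
specialize (h e ltac:(lra)).
assert (h4 : e * (2 * D) <= Rabs x).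
{ apply (Rmult_le_compat_r (2 * D)) in h3; [|lra].
  replace (Rabs x / (2 * D) * (2 * D)) with (Rabs x) in h3 by (field; lra); exact h3. }
assert (C <= D) by (pose proof (Rle_abs C); unfold D; lra); nra.
Qed.

(* Along a leaf, [r + sum_l e^l potential_l - e^(k+1) int sum_u h^(u+1) B_(k+1,u)]
   has derivative of order [e^(k+2)]. *)
Lemma leaf_displacement (k : nat) (ths : nat -> R) (h : R) :
  0 < h ->
  exists C e0, 0 < C /\ 0 < e0 /\ forall e p, 0 < e < e0 ->
    is_poincare tau (form_family w e) h p ->
    Rabs (p - h) <= h / 2 /\
    Rabs ((p - h) + sum_from_1 (fun l => e ^ l * (potential ths l p tau - potential ths l h 0)) k
      - e ^ S k * sumZ (E (S k)) (fun u => powerRZ h (u + 1) * RInt (fun s => B (S k) u s ths) 0 tau))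
    <= C * e ^ S (S k).
Proof.
intros hh.
destruct hgeo as [C0 [K [hC0 [hK hfg]]]].
destruct (coefficient_bounds k ths) as [U [hU bU]].
destruct (exponent_bounds k h hh) as [D [hD bD]].
(* C1 K^i bounds the components of w_i near h: at most U terms, each a power below D times a
   coefficient below C0 K^i. Then C3 e will bound the slope of the leaf, and Ua the functions a_0,
   ..., a_k. *)
set (C1 := U * (D * C0)).
assert (hUD : 1 <= U * D) by nra.
assert (hC1 : 0 < C1) by (unfold C1; rewrite <- Rmult_assoc; apply Rmult_lt_0_compat; lra).
set (C3 := 4 * C1 * K).
assert (hC3 : 0 < C3) by (unfold C3; repeat apply Rmult_lt_0_compat; lra).
set (Ua := U * (D * U)).
assert (hUa : 0 < Ua) by (unfold Ua; repeat apply Rmult_lt_0_compat; lra).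
(* First summand: the dr-part of Omega_(k+1), with slope C3 e. Second: the error of replacing r by h
   in its dtheta-part, where |r - h| <= C3 e tau. *)
set (C4 := U * (D * U) * C3 + U * (D * (C3 * tau) * U)).
(* For the tails cut off in [leaf_identity]; (1 + K)^(k+2) dominates every power of K that
   occurs. *)
set (C5 := Ua * (4 * C1 * (1 + K) ^ S (S k))).
assert (hC4 : 0 < C4).
{ unfold C4; apply Rplus_lt_0_compat; repeat apply Rmult_lt_0_compat; lra. }
assert (hC5 : 0 < C5).
{ unfold C5; repeat apply Rmult_lt_0_compat; try lra; apply pow_lt; lra. }
(* When den e <= 1, the four summands give e <= 1, K e <= 1/2, C3 e <= 1 and C3 e tau <= h/4. *)
set (den := 1 + 2 * K + C3 + 4 * C3 * tau / h).
assert (hden0 : 0 < 4 * C3 * tau / h).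
{ apply Rdiv_lt_0_compat; [|exact hh]; repeat apply Rmult_lt_0_compat; lra. }
assert (hden : 0 < den) by (unfold den; lra).
exists ((C4 + C5 * INR (S k)) * tau), (/ den).
split; [|split; [now apply Rinv_0_lt_compat|]].
{ apply Rmult_lt_0_compat; [|exact htau]; apply Rplus_lt_le_0_compat; [exact hC4|].
  apply Rmult_le_pos; [lra|apply pos_INR]. }
intros e p he [r [r0 [rtau hleaf]]].
assert (hde : den * e <= 1).
{ destruct he as [he1 he2]; apply (Rmult_lt_compat_l den) in he2; [|exact hden].
  rewrite Rinv_r in he2; lra. }
unfold den in hde; rewrite !Rmult_plus_distr_r, Rmult_1_l in hde.
assert (q1 : 0 < 2 * K * e) by (repeat apply Rmult_lt_0_compat; lra).
assert (q2 : 0 < C3 * e) by (repeat apply Rmult_lt_0_compat; lra).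
assert (q3 : 0 < 4 * C3 * tau / h * e) by (apply Rmult_lt_0_compat; lra).
assert (he1 : e <= 1) by lra; assert (hKe : K * e <= 1 / 2) by lra; assert (hC3e : C3 * e <= 1) by lra.
assert (hclose : C3 * e * tau < h / 2).
{ assert (hx : 4 * C3 * tau / h * e * h = 4 * (C3 * e * tau)) by (field; lra).
  assert (4 * C3 * tau / h * e <= 1) by lra.
  assert (4 * C3 * tau / h * e * h <= 1 * h) by (apply Rmult_le_compat_r; lra).
  lra. }
assert (ae : Rabs e = e) by (apply Rabs_pos_eq; lra).
assert (hKe0 : 0 <= K * e) by lra.
assert (form_bounds : forall th y, 0 <= th <= tau -> Rabs (y - h) <= h / 2 -> forall i,
   Rabs (cdr (w i) y th) <= C1 * K ^ i /\ Rabs (cdth (w i) y th) <= C1 * K ^ i).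
{ intros th y hth hy i; unfold w; cbn [cdr cdth sform].
  assert (hy0 : 0 < y) by (apply Rabs_le_between in hy; lra).
  assert (hCK : 0 <= C0 * K ^ i) by (apply Rmult_le_pos; [lra|apply pow_le; lra]).
  destruct (bU 1%nat ltac:(lia)) as [hl _].
  assert (aux : forall u, (forall z, In z (E 1) -> Rabs (u z) <= D * (C0 * K ^ i)) ->
            Rabs (sumZ (E 1) u) <= C1 * K ^ i).
  { intros u hu; eapply Rle_trans; [apply sumZ_abs_const, hu|].
    replace (C1 * K ^ i) with (U * (D * (C0 * K ^ i))) by (unfold C1; ring).
    apply Rmult_le_compat_r; [apply Rmult_le_pos; lra|exact hl]. }
  split; apply aux; intros z hz; destruct (bD 1%nat z y ltac:(lia) hz hy) as [d1 [d2 _]];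
    destruct (hfg i z th hz hth) as [f1 f2].
  - rewrite Rabs_mult; apply Rmult_le_compat; try assumption; apply Rabs_pos.
  - replace (powerRZ y z * - (y * f i z th)) with (- (powerRZ y (z + 1) * f i z th))
      by (rewrite powerRZ_add, powerRZ_1 by lra; ring).
    rewrite Rabs_Ropp, Rabs_mult; apply Rmult_le_compat; try assumption; apply Rabs_pos. }
assert (slope : forall th, 0 <= th <= tau -> Rabs (r th - h) <= h / 2 -> Rabs (Derive r th) <= C3 * e).
{ intros th hth hr; destruct (hleaf th hth) as [_ [_ heq]].
  (* For N = 0 the truncated sum is empty, so the whole perturbation is bounded by 2 C1 K e. *)
  pose proof (series_tail_bound (fun i => cdr (w i) (r th) th) C1 K e 0) as t1.
  pose proof (series_tail_bound (fun i => cdth (w i) (r th) th) C1 K e 0) as t2.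
  simpl sum_from_1 in t1, t2; rewrite ae, Rminus_0_r, pow_1 in t1, t2.
  replace (C3 * e) with (4 * C1 * (K * e)) by (unfold C3; ring).
  eapply leaf_slope_bound; [exact hC1|exact hKe0| | | |exact heq].
  - unfold C3 in hC3e; lra.
  - apply t1; try lra; intros i; now apply form_bounds.
  - apply t2; try lra; intros i; now apply form_bounds. }
(* The slope bound is conditional on r being near h; [stays_close] removes the condition and
   improves h/2 to C3 e tau. *)
assert (near : forall th, 0 <= th <= tau -> Rabs (r th - h) <= C3 * e * tau).
{ apply (stays_close r (Derive r) h (h / 2) (C3 * e) tau); try lra; try assumption.
  intros th hth; apply Derive_correct, hleaf, hth. }
assert (near2 : forall th, 0 <= th <= tau -> Rabs (r th - h) <= h / 2).
{ intros th hth; specialize (near th hth); lra. }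
split; [rewrite <- rtau; apply near2; lra|].
(* In the last sum the radius is frozen at h, so that its increment is an exact integral over
   [0, tau]. *)
set (Phi := fun th => r th + sum_from_1 (fun l => e ^ l * potential ths l (r th) th) k
   + e ^ S k * - sumZ (E (S k)) (fun u => powerRZ h (u + 1) * RInt (fun s => B (S k) u s ths) 0 th)).
set (dPhi := fun th => Derive r th
   + sum_from_1 (fun l => e ^ l * (a l (r th) th ths * Derive r th + omega_value ths l (r th) th (Derive r th))) k
   + e ^ S k * - sumZ (E (S k)) (fun u => powerRZ h (u + 1) * B (S k) u th ths)).
replace (p - h + _ - _) with (Phi tau - Phi 0).
2:{ unfold Phi; rewrite r0, rtau.
    rewrite (sumZ_ext (E (S k)) (fun u => powerRZ h (u + 1) * RInt (fun s => B (S k) u s ths) 0 0) (fun _ => 0)), sumZ_zero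
      by (intros; rewrite RInt_point; apply Rmult_0_r).
    rewrite (sum_from_1_ext (fun l => e ^ l * (potential ths l p tau - potential ths l h 0))
      (fun l => e ^ l * potential ths l p tau + -1 * (e ^ l * potential ths l h 0))) by (intros; ring).
    rewrite sum_from_1_plus, sum_from_1_scal; ring. }
replace ((C4 + C5 * INR (S k)) * tau * e ^ S (S k)) with ((C4 + C5 * INR (S k)) * e ^ S (S k) * (tau - 0)) by ring.
apply (derive_bound_increment Phi dPhi); [lra|]; intros th hth.
destruct (hleaf th hth) as [hpos [hex heq]]; pose proof (near2 th hth) as hr.
pose proof (slope th hth hr) as hs; pose proof (near th hth) as hn.
split.
- apply is_derive_Rplus; [apply is_derive_Rplus|].
  + now apply Derive_correct.
  + apply (is_derive_sum_from_1 (fun l t => e ^ l * potential ths l (r t) t)); intros l hl.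
    apply is_derive_Rscal, potential_derive; [lia|exact hpos|now apply Derive_correct].
  + apply is_derive_Rscal, is_derive_Ropp, is_derive_sumZ; intros u _.
    apply is_derive_Rscal, is_derive_primitive; intros; now apply B_coef_continuous.
- set (x := fun j => cdr (w j) (r th) th * Derive r th + cdth (w j) (r th) th).
  set (Gam := Series (fun i => e ^ S i * cdr (w (S i)) (r th) th) * Derive r th
              + Series (fun i => e ^ S i * cdth (w (S i)) (r th) th)).
  assert (id : dPhi th = e ^ S k * (- omega_value ths (S k) (r th) th (Derive r th)
        - sumZ (E (S k)) (fun u => powerRZ h (u + 1) * B (S k) u th ths))
      - sum_f_R0 (fun i => a i (r th) th ths * e ^ i * (Gam - sum_from_1 (fun j => e ^ j * x j) (S k - i))) k).
  { unfold dPhi; rewrite (leaf_identity (fun l => a l (r th) th ths) x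
      (fun l => omega_value ths l (r th) th (Derive r th)) e (Derive r th) Gam k).
    - ring.
    - now apply a_fun_0.
    - intros l _; now apply omega_value_decomposition.
    - unfold Gam; rewrite <- heq; cbn [cdr cdth form_family]; unfold perturbed; ring. }
  assert (rem : forall N, Rabs (Gam - sum_from_1 (fun j => e ^ j * x j) N) <= 4 * C1 * (K * e) ^ S N).
  { intros N.
    pose proof (series_tail_bound (fun i => cdr (w i) (r th) th) C1 K e N) as t1.
    pose proof (series_tail_bound (fun i => cdth (w i) (r th) th) C1 K e N) as t2.
    rewrite ae in t1, t2.
    specialize (t1 ltac:(lra) ltac:(lra) hKe (fun i => proj1 (form_bounds th (r th) hth hr (S i)))).
    specialize (t2 ltac:(lra) ltac:(lra) hKe (fun i => proj2 (form_bounds th (r th) hth hr (S i)))).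
    cbv beta in t1, t2.
    set (y := 2 * C1 * (K * e) ^ S N) in *.
    replace (4 * C1 * (K * e) ^ S N) with (y * 1 + y) by (unfold y; ring).
    rewrite (sum_from_1_ext _ (fun j => Derive r th * (e ^ j * cdr (w j) (r th) th) + e ^ j * cdth (w j) (r th) th))
      by (intros; unfold x; ring).
    rewrite sum_from_1_plus, sum_from_1_scal; unfold Gam.
    replace (_ - _) with ((Series (fun i => e ^ S i * cdr (w (S i)) (r th) th)
        - sum_from_1 (fun j => e ^ j * cdr (w j) (r th) th) N) * Derive r th
      + (Series (fun i => e ^ S i * cdth (w (S i)) (r th) th)
        - sum_from_1 (fun j => e ^ j * cdth (w j) (r th) th) N)) by ring.
    eapply Rle_trans; [apply Rabs_triang|]; apply Rplus_le_compat; [|exact t2].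
    rewrite Rabs_mult; apply Rmult_le_compat; try apply Rabs_pos; [exact t1|lra]. }
  assert (abound : forall i, (i <= k)%nat -> Rabs (a i (r th) th ths) <= Ua).
  { intros i hi; destruct (bU i ltac:(lia)) as [hl hb]; unfold a, a_fun; rewrite Rabs_Ropp.
    eapply Rle_trans; [apply (sumZ_abs_const _ _ (D * U))|].
    - intros v hv; rewrite Rabs_mult.
      destruct (bD i v (r th) ltac:(lia) hv hr) as [d1 _]; destruct (hb v th hv hth) as [b1 _].
      apply Rmult_le_compat; try assumption; apply Rabs_pos.
    - apply Rmult_le_compat_r; [apply Rmult_le_pos; lra|exact hl]. }
  assert (part1 : Rabs (- omega_value ths (S k) (r th) th (Derive r th)
        - sumZ (E (S k)) (fun u => powerRZ h (u + 1) * B (S k) u th ths)) <= C4 * e).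
  { unfold omega_value; fold A B.
    replace (- (_ - _) - _) with (- (sumZ (E (S k)) (fun u => powerRZ (r th) u * A (S k) u th ths) * Derive r th)
      + sumZ (E (S k)) (fun u => (powerRZ (r th) (u + 1) - powerRZ h (u + 1)) * B (S k) u th ths)).
    2:{ rewrite (sumZ_ext (E (S k)) (fun u => (powerRZ (r th) (u + 1) - powerRZ h (u + 1)) * B (S k) u th ths)
          (fun u => powerRZ (r th) (u + 1) * B (S k) u th ths + - (powerRZ h (u + 1) * B (S k) u th ths)))
          by (intros; ring).
        rewrite sumZ_plus, sumZ_opp; ring. }
    destruct (bU (S k) ltac:(lia)) as [hl hb].
    eapply Rle_trans; [apply Rabs_triang|]; unfold C4; rewrite Rmult_plus_distr_r.
    apply Rplus_le_compat.
    - rewrite Rabs_Ropp, Rabs_mult, (Rmult_assoc (U * (D * U))).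
      apply Rmult_le_compat; try apply Rabs_pos; [|exact hs].
      eapply Rle_trans; [apply (sumZ_abs_const _ _ (D * U))|].
      + intros u hu; rewrite Rabs_mult.
        destruct (bD (S k) u (r th) ltac:(lia) hu hr) as [d1 _]; destruct (hb u th hu hth) as [_ [b1 _]].
        apply Rmult_le_compat; try assumption; apply Rabs_pos.
      + apply Rmult_le_compat_r; [apply Rmult_le_pos; lra|exact hl].
    - assert (hpos' : 0 <= D * (C3 * e * tau) * U) by (repeat apply Rmult_le_pos; lra).
      eapply Rle_trans; [apply (sumZ_abs_const _ _ (D * (C3 * e * tau) * U))|].
      + intros u hu; rewrite Rabs_mult.
        destruct (bD (S k) u (r th) ltac:(lia) hu hr) as [_ [_ d1]]; destruct (hb u th hu hth) as [_ [_ [b1 _]]].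
        apply Rmult_le_compat; try assumption; try apply Rabs_pos.
        eapply Rle_trans; [exact d1|]; apply Rmult_le_compat_l; lra.
      + replace (U * (D * (C3 * tau) * U) * e) with (U * (D * (C3 * e * tau) * U)) by ring.
        apply Rmult_le_compat_r; [exact hpos'|exact hl]. }
  assert (part2 : Rabs (sum_f_R0 (fun i => a i (r th) th ths * e ^ i * (Gam - sum_from_1 (fun j => e ^ j * x j) (S k - i))) k)
        <= C5 * e ^ S (S k) * INR (S k)).
  { rewrite <- sum_cte; apply sum_abs_le; intros i hi.
    rewrite !Rabs_mult, (Rabs_pos_eq (e ^ i)) by (apply pow_le; lra).
    assert (hei : 0 <= e ^ i) by (apply pow_le; lra).
    (* The factor e^i of a_i and a tail of order k + 2 - i combine to e^(k+2) for every i. *)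
    replace (C5 * e ^ S (S k)) with (Ua * e ^ i * (4 * C1 * ((1 + K) ^ S (S k) * e ^ S (S k - i)))).
    - apply Rmult_le_compat; [apply Rmult_le_pos; [apply Rabs_pos|exact hei]|apply Rabs_pos| |].
      + apply Rmult_le_compat_r; [exact hei|now apply abound].
      + eapply Rle_trans; [apply rem|]; rewrite Rpow_mult_distr.
        apply Rmult_le_compat_l; [lra|]; apply Rmult_le_compat_r; [apply pow_le; lra|].
        apply (Rle_trans _ ((1 + K) ^ S (S k - i))); [apply pow_incr; lra|].
        apply Rle_pow; [lra|lia].
    - replace (e ^ S (S k)) with (e ^ i * e ^ S (S k - i)) by (rewrite <- pow_add; f_equal; lia).
      unfold C5; ring. }
  rewrite id; unfold Rminus at 1; eapply Rle_trans; [apply Rabs_triang|]; rewrite Rabs_Ropp.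
  replace ((C4 + C5 * INR (S k)) * e ^ S (S k)) with (e ^ S k * (C4 * e) + C5 * e ^ S (S k) * INR (S k))
    by (simpl; ring).
  apply Rplus_le_compat; [|exact part2].
  rewrite Rabs_mult, (Rabs_pos_eq (e ^ S k)) by (apply pow_le; lra).
  apply Rmult_le_compat_l; [apply pow_le; lra|exact part1].
Qed.

(** With zero mean the primitive takes the same value at 0 and at tau, so the potential changes only
    through the radius. *)
Lemma potential_increment (k l : nat) (ths : nat -> R) (h p U D : R) :
  mean_zero_upto E f g tau k -> (1 <= l <= k)%nat -> 0 <= D -> 0 <= U ->
  INR (length (E l)) <= U ->
  (forall u, In u (E l) -> Rabs (RInt (fun s => B l u s ths) (ths l) 0) <= U) ->
  (forall u, In u (E l) -> Rabs (powerRZ p (u + 1) - powerRZ h (u + 1)) <= D * Rabs (p - h)) ->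
  Rabs (potential ths l p tau - potential ths l h 0) <= U * (D * Rabs (p - h) * U).
Proof.
intros hk hl hD hU hlen hint hpow; unfold potential; fold B.
replace (_ - _) with (- sumZ (E l) (fun u => (powerRZ p (u + 1) - powerRZ h (u + 1))
     * RInt (fun s => B l u s ths) (ths l) 0)).
- assert (0 <= D * Rabs (p - h) * U) by (repeat apply Rmult_le_pos; try assumption; apply Rabs_pos).
  rewrite Rabs_Ropp; eapply Rle_trans; [apply (sumZ_abs_const _ _ (D * Rabs (p - h) * U))|].
  + intros u hu; rewrite Rabs_mult; apply Rmult_le_compat; try apply Rabs_pos; auto.
  + now apply Rmult_le_compat_r.
- rewrite (sumZ_ext (E l) (fun u => powerRZ p (u + 1) * RInt (fun s => B l u s ths) (ths l) tau)
    (fun u => (powerRZ p (u + 1) - powerRZ h (u + 1)) * RInt (fun s => B l u s ths) (ths l) 0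
              + powerRZ h (u + 1) * RInt (fun s => B l u s ths) (ths l) 0)).
  + rewrite sumZ_plus; ring.
  + intros u hu.
    assert (cB : forall x, continuous (fun s => B l u s ths) x) by (intros; now apply B_coef_continuous).
    rewrite <- (RInt_Chasles_everywhere (fun s => B l u s ths) (ths l) 0 tau cB).
    pose proof (hk l u ths hl hu) as h0; fold B in h0; rewrite h0; ring.
Qed.

(** The power series of p gives p - h = O(e^(k+1)), so the potentials contribute e^l O(p - h) with l
    >= 1, that is O(e^(k+2)). Two expressions of p - h up to O(e^(k+2)) remain; dividing their
    difference by e^(k+1) leaves O(e). *)
Lemma melnikov_formula (M : nat -> R -> R) (k : nat) (ths : nat -> R) (h : R) :
  mean_zero_upto E f g tau k -> is_melnikov tau w M -> 0 < h ->
  (forall i, (1 <= i <= k)%nat -> M i h = 0) ->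
  M (S k) h = sumZ (E (S k)) (fun u => powerRZ h (u + 1) * RInt (fun s => B (S k) u s ths) 0 tau).
Proof.
intros hk hM hh hzero; destruct (hM h hh) as [eps0 [h0 hser]].
set (c := fun i => match i with O => h | S _ => M i h end) in *.
destruct (power_series_geometric c eps0 h0) as [Cp [Kp [hCp [hKp hc]]]].
{ intros eps heps; destruct (hser eps heps) as [p [_ hp]]; now exists p. }
destruct (leaf_displacement k ths h hh) as [C [e0 [hC [he0 hdisp]]]].
destruct (coefficient_bounds k ths) as [U [hU bU]].
destruct (exponent_bounds k h hh) as [D [hD bD]].
set (X := sumZ (E (S k)) (fun u => powerRZ h (u + 1) * RInt (fun s => B (S k) u s ths) 0 tau)).
(* R1 e^(k+2) bounds the tail of the power series, C6 e^(k+1) bounds p - h, and C7 e^(k+2) the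
   potentials. *)
set (R1 := 2 * Cp * Kp ^ S (S k)).
assert (hR1 : 0 < R1) by (unfold R1; repeat apply Rmult_lt_0_compat; try lra; now apply pow_lt).
set (C6 := Rabs (M (S k) h) + R1).
assert (hC6 : 0 < C6) by (unfold C6; pose proof (Rabs_pos (M (S k) h)); lra).
set (C7 := INR k * (U * (D * C6 * U))).
enough (hx : M (S k) h - X = 0) by lra.
apply (vanishes_of_linear_bound _ (C + R1 + C7) (Rmin 1 (Rmin eps0 (Rmin e0 (/ (2 * Kp)))))).
{ repeat apply Rmin_glb_lt; try lra; apply Rinv_0_lt_compat; lra. }
intros e [he hlt]; apply Rmin_Rgt_l in hlt; destruct hlt as [l1 hlt].
apply Rmin_Rgt_l in hlt; destruct hlt as [l2 hlt]; apply Rmin_Rgt_l in hlt; destruct hlt as [l3 l4].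
assert (ae : Rabs e = e) by (apply Rabs_pos_eq; lra).
assert (hKe : Kp * e <= 1 / 2).
{ apply Rgt_lt, (Rmult_lt_compat_l (2 * Kp)) in l4; [|lra]; rewrite Rinv_r in l4; lra. }
destruct (hser e ltac:(rewrite ae; lra)) as [p [hpoin hp]].
destruct (hdisp e p ltac:(lra) hpoin) as [hnear hd]; fold X in hd.
set (sum := sum_from_1 (fun l => e ^ l * (potential ths l p tau - potential ths l h 0)) k) in *.
assert (he1 : 0 < e ^ S k) by now apply pow_lt.
assert (htail : Rabs (p - h - e ^ S k * M (S k) h) <= R1 * e ^ S (S k)).
{ pose proof (series_tail_bound c Cp Kp e (S k) ltac:(lra) ltac:(lra)) as t.
  rewrite ae in t; specialize (t hKe (fun i => hc (S i))).
  assert (ep : p = h + Series (fun i => e ^ S i * c (S i))).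
  { apply is_pseries_unique in hp; rewrite <- hp; unfold PSeries.
    rewrite Series_incr_1.
    - simpl; f_equal; [ring|]; apply Series_ext; intros; ring.
    - apply (ex_series_ext (fun i => scal (pow_n e i) (c i))).
      + intros i; rewrite pow_n_pow; apply Rmult_comm.
      + destruct (hser e ltac:(rewrite ae; lra)) as [p' [_ hp']]; now exists p'. }
  assert (es : sum_from_1 (fun j => e ^ j * c j) (S k) = e ^ S k * M (S k) h).
  { rewrite sum_from_1_S, (sum_from_1_ext _ (fun j => 0 * c j)).
    - rewrite sum_from_1_scal; unfold c at 2; ring.
    - intros j hj; destruct j as [|j]; [lia|]; unfold c; rewrite hzero by lia; ring. }
  rewrite es, Rpow_mult_distr in t.
  replace (p - h - e ^ S k * M (S k) h) with (Series (fun i => e ^ S i * c (S i)) - e ^ S k * M (S k) h)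
    by (rewrite ep; ring).
  unfold R1; lra. }
assert (hee : e ^ S (S k) = e ^ S k * e) by (simpl; ring).
assert (hph : Rabs (p - h) <= C6 * e ^ S k).
{ replace (p - h) with ((p - h - e ^ S k * M (S k) h) + e ^ S k * M (S k) h) by ring.
  eapply Rle_trans; [apply Rabs_triang|]; rewrite Rabs_mult, (Rabs_pos_eq (e ^ S k)) by lra.
  unfold C6; rewrite Rmult_plus_distr_r.
  assert (R1 * e ^ S (S k) <= R1 * e ^ S k).
  { apply Rmult_le_compat_l; [lra|]; rewrite hee; nra. }
  lra. }
assert (hsum : Rabs sum <= C7 * e ^ S (S k)).
{ unfold sum, C7; rewrite Rmult_assoc; apply sum_from_1_abs_const; intros l hl.
  rewrite Rabs_mult, (Rabs_pos_eq (e ^ l)) by (apply pow_le; lra).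
  destruct (bU l ltac:(lia)) as [hlen hb].
  assert (hpot : Rabs (potential ths l p tau - potential ths l h 0) <= U * (D * Rabs (p - h) * U)).
  { apply (potential_increment k); try assumption; try lra.
    - intros u hu; apply (hb u 0 hu); lra.
    - intros u hu; apply (bD l u p ltac:(lia) hu hnear). }
  rewrite hee; replace (U * (D * C6 * U) * (e ^ S k * e)) with (e * (U * (D * (C6 * e ^ S k) * U))) by ring.
  apply Rmult_le_compat; [apply pow_le; lra|apply Rabs_pos|apply pow_le_self; [lra|lia]|].
  eapply Rle_trans; [exact hpot|]; apply Rmult_le_compat_l; [lra|].
  apply Rmult_le_compat_r; [lra|]; apply Rmult_le_compat_l; [lra|exact hph]. }
apply (Rmult_le_reg_l (e ^ S k)); [exact he1|].
rewrite <- (Rabs_pos_eq (e ^ S k)) at 1 by lra; rewrite <- Rabs_mult.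
replace (e ^ S k * (M (S k) h - X)) with
  ((p - h + sum - e ^ S k * X) + - (p - h - e ^ S k * M (S k) h) + - sum) by ring.
eapply Rle_trans; [apply Rabs_triang|]; rewrite Rabs_Ropp.
eapply Rle_trans; [apply Rplus_le_compat_r, Rabs_triang|]; rewrite Rabs_Ropp.
replace (e ^ S k * ((C + R1 + C7) * e)) with (C * e ^ S (S k) + R1 * e ^ S (S k) + C7 * e ^ S (S k))
  by (rewrite hee; ring).
lra.
Qed.

(** The formula of order k + 1 uses means of order at most k, so the means vanish one order after
    the other, the independence of the powers of h separating the exponents. *)
Lemma mean_zero_of_vanishing (M : nat -> R -> R) (k : nat) :
  is_melnikov tau w M -> (forall i h, (1 <= i <= k)%nat -> 0 < h -> M i h = 0) ->
  mean_zero_upto E f g tau k.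
Proof.
intros hM; induction k as [|k IH]; intros hzero; [intros l u ths hl; lia|].
assert (hk : mean_zero_upto E f g tau k) by (apply IH; intros; apply hzero; [lia|assumption]).
intros l u ths hl hu; destruct (Nat.eq_dec l (S k)) as [->|ne]; [|apply hk; [lia|exact hu]].
revert u hu; apply (powers_independent (E (S k)) (fun u => RInt (fun s => B (S k) u s ths) 0 tau) (hnd (S k))).
intros h hh; apply (Rmult_eq_reg_l h); [|lra].
rewrite Rmult_0_r; transitivity (M (S k) h); [|apply hzero; [lia|exact hh]].
rewrite (melnikov_formula M k ths h hk hM hh) by (intros; apply hzero; [lia|assumption]).
rewrite <- sumZ_scal; apply sumZ_ext; intros u _.
rewrite powerRZ_add, powerRZ_1 by lra; ring.
Qed.

End Melnikov.

(* [[0]] at [t = 0] (where [Sset] is empty) is the exponent of [a_0 = 1]. *)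
Definition exponents (s1 s2 m n t : nat) : list Z :=
  match t with O => 0%Z :: nil | S _ => Sset s1 s2 m n t end.

Lemma exponents_NoDup (s1 s2 m n t : nat) : NoDup (exponents s1 s2 m n t).
Proof.
destruct t; [repeat constructor; simpl; tauto|apply Sset_NoDup].
Qed.

(** The condition l <= i + j <= l (n + 1) is additive in the triple (i, j, l), and the order l - j
    with j >= 1 leaves room for one more unit of l. At order 0 the only exponent is 0. *)
Lemma exponents_add (s1 s2 m n l j : nat) (v z : Z) :
  (1 <= j <= l)%nat -> In v (exponents s1 s2 m n (l - j)) -> In z (exponents s1 s2 m n 1) ->
  In (v + z)%Z (exponents s1 s2 m n l).
Proof.
intros hj hv hz; destruct l as [|l]; [lia|]; simpl.
apply Sset_spec in hz; destruct hz as [i2 [j2 [l2 [h1 [h2 ez]]]]]; apply Sset_spec.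
destruct (S l - j)%nat as [|t] eqn:et.
- destruct hv as [<-|[]]; exists i2, j2, l2; repeat split; try lia.
- apply Sset_spec in hv; destruct hv as [i1 [j1 [l1 [k1 [k2 ev]]]]].
  exists (i1 + i2)%nat, (j1 + j2)%nat, (l1 + l2)%nat; repeat split; nia.
Qed.

Theorem theorem3p5
  (s1 s2 m d n : nat) (P Q : nat -> nat -> R) (p q : nat -> nat -> nat -> R)
  (Cs Sn : R -> R) (tau : R)
  (hs2 : (1 <= s2)%nat) (hs1 : (s2 <= s1)%nat) (hcop : Nat.gcd s1 s2 = 1%nat)
  (hqh : quasi_homogeneous s1 s2 m (eval2 d P) (eval2 d Q))
  (hcenter : is_center (eval2 d P) (eval2 d Q))
  (hconv : forall a b, (a + b <= n)%nat ->
     Rbar_lt 0 (CV_radius (fun i => p i a b)) /\ Rbar_lt 0 (CV_radius (fun i => q i a b)))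
  (hCS : is_lyapunov s1 s2 Cs Sn) (htau : is_least_period Cs Sn tau) :
  let W := weightW s1 s2 m in
  let calS := Sset s1 s2 m n in
  let F := polF s1 s2 Cs Sn (eval2 d P) (eval2 d Q) in
  let G := polG s1 s2 Cs Sn (eval2 d P) (eval2 d Q) in
  let PJ i J := eval2 n (qh_part s1 s2 (J - Z.of_nat s2) (p i)) in
  let QJ i J := eval2 n (qh_part s1 s2 (J - Z.of_nat s1) (q i)) in
  let FJ i J := polF s1 s2 Cs Sn (PJ i J) (QJ i J) in
  let GJ i J := polG s1 s2 Cs Sn (PJ i J) (QJ i J) in
  let H th := exp (RInt (fun s => F s / G s) 0 th) in
  let f i j th := powerRZ (H th) j *
    ((FJ i (j + W)%Z th * G th - GJ i (j + W)%Z th * F th) / G th ^ 2) in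
  let g i j th := powerRZ (H th) j * (GJ i (j + W)%Z th / G th) in
  let w i := sform (calS 1%nat) (g i) (f i) in
  let X r th := (r * H th) ^ s1 * Cs th in
  let Y r th := (r * H th) ^ s2 * Sn th in
  (exists K : R -> R -> R,
     (forall r th, 0 < r -> K r th <> 0) /\
     exists eps0, 0 < eps0 /\
       forall eps, Rabs eps < eps0 ->
         form_eq
           (pullback X Y
              (perturbed (eval2 d P) (fun i => eval2 n (p i)) eps)
              (perturbed (eval2 d Q) (fun i => eval2 n (q i)) eps))
           (form_scal K (form_family w eps))) /\
  forall M : nat -> R -> R, is_melnikov tau w M ->
    ((exists h, 0 < h /\ M 1%nat h <> 0) ->
     forall h, 0 < h ->
       M 1%nat h = sumZ (calS 1%nat) (fun j => powerRZ h (j + 1) * RInt (f 1%nat j) 0 tau)) /\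
    (forall k : nat, (1 <= k)%nat ->
     (forall i h, (1 <= i <= k)%nat -> 0 < h -> M i h = 0) ->
     exists (a : nat -> R -> R -> (nat -> R) -> R) (A B : nat -> Z -> R -> (nat -> R) -> R),
       (forall r th ths, 0 < r -> a 0%nat r th ths = 1) /\
       (forall i r, (i <= k)%nat -> 0 < r -> periodic_fun tau i (a i r)) /\
       (forall l, (2 <= l <= k + 1)%nat ->
          (forall ths,
             form_eq (Omega (fun i r th => a i r th ths) w l)
                     (sform (calS l) (fun j th => A l j th ths) (fun j th => B l j th ths))) /\
          (forall j, In j (calS l) ->
             periodic_fun tau (l - 1) (A l j) /\ periodic_fun tau (l - 1) (B l j))) /\
       (forall r th ths, 0 < r ->
          a 1%nat r th ths =
          - sumZ (calS 1%nat) (fun j => powerRZ r j *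
              (g 1%nat j th + IZR (j + 1) * RInt (f 1%nat j) (ths 1%nat) th))) /\
       (forall i r th ths, (2 <= i <= k)%nat -> 0 < r ->
          a i r th ths =
          - sumZ (calS i) (fun j => powerRZ r j *
              (A i j th ths + IZR (j + 1) * RInt (fun s => B i j s ths) (ths i) th))) /\
       (forall h ths, 0 < h ->
          M (k + 1)%nat h =
          sumZ (calS (k + 1)%nat) (fun j =>
            powerRZ h (j + 1) * RInt (fun th => B (k + 1)%nat j th ths) 0 tau))).
Proof.
intros W calS F G PJ QJ FJ GJ H f g w X Y.
assert (hs1' : (1 <= s1)%nat) by lia.
split; [exact (normal_form s1 s2 m d n P Q p q Cs Sn hs1' hs2 hqh hcenter hconv hCS)|].
intros M hM.
set (E := exponents s1 s2 m n).
assert (htau0 : 0 < tau) by apply htau.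
assert (hE0 : E 0%nat = 0%Z :: nil) by reflexivity.
assert (hnd : forall l, NoDup (E l)) by apply exponents_NoDup.
assert (hadd : forall l j v z, (1 <= j <= l)%nat -> In v (E (l - j)%nat) -> In z (E 1%nat) -> In (v + z)%Z (E l))
  by (intros l j v z; apply exponents_add).
assert (hEl : forall l, (1 <= l)%nat -> E l = calS l) by (intros [|l] hl; [lia|reflexivity]).
assert (hcf : forall i j th, continuous (f i j) th).
{ intros i j th; exact (proj1 (form_coefficients_continuous s1 s2 m d n P Q p q Cs Sn hs1' hs2 hqh hcenter hCS i j th)). }
assert (hcg : forall i j th, continuous (g i j) th).
{ intros i j th; exact (proj2 (form_coefficients_continuous s1 s2 m d n P Q p q Cs Sn hs1' hs2 hqh hcenter hCS i j th)). }
assert (hpf : forall i j th, f i j (th + tau) = f i j th).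
{ intros i j th; exact (proj1 (form_coefficients_periodic s1 s2 m d n P Q p q Cs Sn tau hs1' hs2 hqh hcenter hCS htau i j th)). }
assert (hpg : forall i j th, g i j (th + tau) = g i j th).
{ intros i j th; exact (proj2 (form_coefficients_periodic s1 s2 m d n P Q p q Cs Sn tau hs1' hs2 hqh hcenter hCS htau i j th)). }
assert (hgeo : exists C K, 0 < C /\ 0 < K /\ forall i j th, In j (E 1%nat) -> 0 <= th <= tau ->
    Rabs (f i j th) <= C * K ^ i /\ Rabs (g i j th) <= C * K ^ i).
{ exact (form_coefficients_geometric s1 s2 m d n P Q p q Cs Sn tau hs1' hs2 hqh hcenter hconv hCS). }
assert (hformula : forall k ths h, mean_zero_upto E f g tau k -> 0 < h ->
   (forall i, (1 <= i <= k)%nat -> M i h = 0) ->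
   M (S k) h = sumZ (E (S k)) (fun u => powerRZ h (u + 1) * RInt (fun s => B_coef E f g (S k) u s ths) 0 tau)).
{ intros k ths h hk hh.
  exact (melnikov_formula E f g tau hE0 hnd hadd htau0 hcf hcg hgeo M k ths h hk hM hh). }
(* From here on f and g enter only through continuity, periodicity and their geometric bounds. *)
clearbody f g.
split.
- intros _ h hh.
  (* At k = 0 there is no mean to check, and B_1 = f_1 has no parameter, so any values of the
     parameters will do. *)
  rewrite (hformula 0%nat (fun _ => 0) h) by (assumption || (intros; lia) || (intros l u ths hl; lia)).
  apply sumZ_ext; intros u hu; f_equal; apply RInt_ext; intros s _; now apply conv_1.
- intros k hk hzero.
  assert (hmean : mean_zero_upto E f g tau k)
    by exact (mean_zero_of_vanishing E f g tau hE0 hnd hadd htau0 hcf hcg hgeo M k hM hzero).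
  exists (a_fun E f g), (A_coef E f g), (B_coef E f g).
  split; [intros; now apply a_fun_0|].
  split; [intros i r hi _; now apply (a_fun_periodic E f g tau hcf hcg hpf hpg k)|].
  split; [|split; [|split]].
  + intros l hl; rewrite <- hEl by lia; split.
    * intros ths r th hr; split; cbn [cdr cdth Omega sform]; rewrite sum_n_m_from_1.
      -- exact (conv_form E f g hnd hadd g l r th ths hr).
      (* The dtheta-component of [sform] carries the factor - r, taken out so that [conv_form]
         applies to f. *)
      -- transitivity (- r * sumZ (E l) (fun u => powerRZ r u * conv E (b_coef E f g) f l u th ths)).
         ++ rewrite <- (conv_form E f g hnd hadd f l r th ths hr), <- sum_from_1_scal.
            apply sum_from_1_ext; intros j _; unfold w; cbn [cdth sform].
            rewrite (sumZ_ext _ _ (fun z => - r * (powerRZ r z * f j z th))) by (intros; ring).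
            rewrite sumZ_scal; change (calS 1%nat) with (E 1%nat); ring.
         ++ rewrite <- sumZ_scal; apply sumZ_ext; intros u _; unfold B_coef; ring.
    * intros u _; apply (AB_coef_periodic E f g tau hcf hcg hpf hpg k); [exact hmean|lia].
  + intros r th ths _; unfold a_fun; f_equal; apply sumZ_ext; intros u hu.
    rewrite b_coef_S; unfold A_coef, B_coef; rewrite conv_1 by assumption.
    do 3 f_equal; apply RInt_ext; intros s _; now apply conv_1.
  + intros i r th ths hi _; unfold a_fun; rewrite hEl by lia; f_equal; apply sumZ_ext; intros u hu.
    destruct i as [|i]; [lia|]; now rewrite b_coef_S.
  + intros h ths hh; rewrite Nat.add_1_r; apply hformula; auto.
Qed.
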